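(* $\otimes_d$ defines a bifunctor $\otimes_d:\mathrm{Modf}(\mathcal U_q(\hat{\mathfrak g}))\times\mathrm{Modf}(\mathcal U_q(\hat{\mathfrak g}))\rightarrow\mathrm{Modf}(\mathcal U_q(\hat{\mathfrak g}))$.
   Context: **Cartan data.** $C=(C_{i,j})_{1\le i,j\le n}$ is a symmetrizable generalized Cartan matrix ($C_{i,j}\in\mathbb Z$, $C_{i,i}=2$, $C_{i,j}\le 0$ for $i\neq j$, $C_{i,j}=0\Leftrightarrow C_{j,i}=0$), $I=\{1,\dots,n\}$, $D=\mathrm{diag}(r_1,\dots,r_n)$ with positive integers $r_i$ such that $B=DC$ is symmetric. $q\in\mathbb C^*$ is not a root of unity, with rational powers fixed compatibly ($q^{s+t}=q^sq^t$); $q_i=q^{r_i}$, $[l]_q=\frac{q^l-q^{-l}}{q-q^{-1}}$, and $\begin{bmatrix}s\\k\end{bmatrix}_{q_i}$ is the $q_i$-binomial coefficient. $(\mathfrak h,\{\alpha_i\},\{\alpha_i^\vee\})$ is a realization of $C$: $\mathfrak h$ is a $\mathbb Q$-vector space of dimension $2n-\mathrm{rank}(C)$, the $\alpha_i\in\mathfrak h^*$ and the $\alpha_i^\vee\in\mathfrak h$ are linearly independent families, $\alpha_j(\alpha_i^\vee)=C_{i,j}$. $Q^+=\sum_i\mathbb N\alpha_i$; for $\lambda\in\mathfrak h^*$, $\mathcal S(\lambda)=\lambda-Q^+$. **Quantum affinization.** $\mathcal U_q(\hat{\mathfrak g})$ is the $\mathbb C$-algebra with generators $x_{i,r}^{\pm}$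 ($i\in I,r\in\mathbb Z$), $k_h$ ($h\in\mathfrak h$), $h_{i,m}$ ($i\in I,m\in\mathbb Z\setminus\{0\}$) and relations: $k_hk_{h'}=k_{h+h'}$, $k_0=1$; all $k_h,h_{i,m}$ commute pairwise; $k_hx_{j,r}^{\pm}k_{-h}=q^{\pm\alpha_j(h)}x_{j,r}^{\pm}$; $h_{i,m}x_{j,r}^{\pm}-x_{j,r}^{\pm}h_{i,m}=\pm\frac1m[mB_{i,j}]_q x_{j,m+r}^{\pm}$; $x_{i,r}^+x_{j,s}^--x_{j,s}^-x_{i,r}^+=\delta_{i,j}\frac{\phi^+_{i,r+s}-\phi^-_{i,r+s}}{q_i-q_i^{-1}}$; $(w-q^{\pm B_{i,j}}z)x_i^{\pm}(z)x_j^{\pm}(w)=(q^{\pm B_{i,j}}w-z)x_j^{\pm}(w)x_i^{\pm}(z)$; and the affine quantum Serre relations: for $i\ne j$, $s=1-C_{i,j}$, $\sum_{\pi\in\Sigma_s}\sum_{k=0}^s(-1)^k\begin{bmatrix}s\\k\end{bmatrix}_{q_i}x_i^{\pm}(w_{\pi(1)})\cdots x_i^{\pm}(w_{\pi(k)})x_j^{\pm}(z)x_i^{\pm}(w_{\pi(k+1)})\cdots x_i^{\pm}(w_{\pi(s)})=0$. Here $x_i^\pm(w)=\sum_r x_{i,r}^\pm w^r$ and $\sum_{m\ge0}\phi^{\pm}_{i,\pm m}z^{\pm m}=k_{\pm r_i\alpha_i^\vee}\exp(\pm(q-q^{-1})\sum_{m\ge1}h_{i,\pm m}z^{\pm m})$,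 $\phi^+_{i,m}=0$ for $m<0$, $\phi^-_{i,m}=0$ for $m>0$. Convention: if $C_{i,j}C_{j,i}\le3$ for all $i\ne j$, $\mathcal U_q(\hat{\mathfrak g})$ denotes this algebra; otherwise it denotes the algebra defined in the same way without the affine quantum Serre relations. $\mathcal U_q'(\hat{\mathfrak g})=\mathcal U_q(\hat{\mathfrak g})\otimes\mathbb C(u)$. **Modules.** $V_\omega=\{v\mid k_h v=q^{\omega(h)}v\ \forall h\in\mathfrak h\}$ for $\omega\in\mathfrak h^*$. $\mathrm{Mod}(\mathcal U_q(\hat{\mathfrak g}))$ is the category of $\mathcal U_q(\hat{\mathfrak g})$-modules $V=\bigoplus_\omega V_\omega$ with all $V_\omega$ finite dimensional, all weights in a finite union $\bigcup_j\mathcal S(\lambda_j)$, and such that for all $\omega,i$ there is $R\ge0$ with $V_{\omega\pm r\alpha_i}=\{0\}$ for $r\ge R$. $\mathrm{Modf}(\mathcal U_q(\hat{\mathfrak g}))$ is the subcategory of finite dimensional representations in $\mathrm{Mod}(\mathcal U_q(\hat{\mathfrak g}))$. **Fusion.** $\Delta_u:\mathcal U'_q(\hat{\mathfrak g})\to(\mathcal U_q(\hat{\mathfrak g})\otimes_{\mathbb C}\mathcal U_q(\hat{\mathfrak g}))((u))$ is the $\mathbb C(u)$-algebra morphism with $\Delta_u(x^+_{i,r})=x^+_{i,r}\otimes1+\sum_{s\ge0}u^{r+s}(\phi^-_{i,-s}\otimes x^+_{i,r+s})$, $\Delta_u(x^-_{i,r})=u^r(1\otimes x^-_{i,r})+\sum_{s\ge0}u^s(x^-_{i,r-s}\otimes\phi^+_{i,s})$,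 $\Delta_u(\phi^\pm_{i,\pm m})=\sum_{0\le s\le m}u^{\pm s}(\phi^\pm_{i,\pm(m-s)}\otimes\phi^\pm_{i,\pm s})$, $\Delta_u(k_h)=k_h\otimes k_h$. For $V\in\mathrm{Mod}(\mathcal U_q(\hat{\mathfrak g}))$, $i(V)=V\otimes_{\mathbb C}\mathbb C(u)$. For $V_1,V_2\in\mathrm{Mod}(\mathcal U_q(\hat{\mathfrak g}))$, $i(V_1)\otimes_f i(V_2)$ is $(V_1\otimes_{\mathbb C}V_2)\otimes\mathbb C(u)$ with the $\mathcal U'_q(\hat{\mathfrak g})$-action $g.(v_1\otimes v_2)=\Delta_u(g)(v_1\otimes v_2)$ (the power series in $u$ obtained are expansions of elements of this $\mathbb C(u)$-vector space). $\mathcal A=\{f/g\mid f,g\in\mathbb C[u^\pm],g(1)\ne0\}\subset\mathbb C(u)$, $\mathcal U_q^u(\hat{\mathfrak g})=\mathcal U_q(\hat{\mathfrak g})\otimes_{\mathbb C}\mathcal A$. **The operation $\otimes_d$.** For finite dimensional $V_1,V_2$, let $N(V_1,V_2)=\mathcal U_q^u(\hat{\mathfrak g}).(V_1\otimes_{\mathbb C}V_2)\subset i(V_1)\otimes_f i(V_2)$ and define the $\mathcal U_q(\hat{\mathfrak g})$-module $V_1\otimes_dV_2=N(V_1,V_2)/((u-1)N(V_1,V_2))$. For morphisms $f_1:V_1\to V_1'$, $f_2:V_2\to V_2'$, $f_1\otimes_df_2$ is the map induced by the $\mathbb C(u)$-linear extension of $f_1\otimes f_2$. *)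

(* Defs.v *)
From HB Require Import structures.
From mathcomp Require Import all_boot all_order all_algebra all_fingroup.
From mathcomp Require Import generic_quotient all_classical reals complex.

Set Implicit Arguments.
Unset Strict Implicit.
Unset Printing Implicit Defensive.

Import Order.TTheory GRing.Theory Num.Theory.
Local Open Scope ring_scope.
Local Open Scope quotient_scope.

Section Spans.
Context {K : comNzRingType} {V : lmodType K}.
Implicit Types (P : V -> Prop) (v : V).

Definition in_span P v : Prop := exists (l : nat) (c : 'I_l -> K) (s : 'I_l -> V),
  (forall i, P (s i)) /\ v = \sum_i c i *: s i.

Definition linspan P : {pred V} := fun v => `[< in_span P v >].

Lemma linspan_submod_closed P : submod_closed (linspan P).
Proof.
split.
  by apply/asboolP; exists 0%N, (fun=> 0), (fun=> 0); split; [case | rewrite big_ord0].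
move=> a u v /asboolP[l [c [s [Ps ->]]]] /asboolP[l' [c' [s' [Ps' ->]]]].
apply/asboolP; exists (l + l')%N.
exists (fun i => match fintype.split i with inl j => a * c j | inr j => c' j end).
exists (fun i => match fintype.split i with inl j => s j | inr j => s' j end); split.
  by move=> i; case: (fintype.split i).
rewrite big_split_ord /= scaler_sumr; congr (_ + _); apply: eq_bigr => i _.
  by rewrite (unsplitK (inl i)) scalerA.
by rewrite (unsplitK (inr i)).
Qed.

HB.instance Definition _ P :=
  GRing.isSubmodClosed.Build K V (linspan P) (linspan_submod_closed P).

Lemma mem_linspan P v : P v -> v \in linspan P.
Proof.
move=> Pv; apply/asboolP; exists 1%N, (fun=> 1), (fun=> v); split=> //.
by rewrite big_ord_recl big_ord0 addr0 scale1r.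
Qed.

Definition span_type P : Type := {v : V | v \in linspan P}.
HB.instance Definition _ P := SubChoice.on (span_type P).
HB.instance Definition _ P := [SubChoice_isSubLmodule of span_type P by <:].

Definition quot_rel P : rel V := fun u v => u - v \in linspan P.

Lemma quot_rel_refl P : reflexive (quot_rel P).
Proof. by move=> v; rewrite /quot_rel subrr rpred0. Qed.

Lemma quot_rel_sym P : symmetric (quot_rel P).
Proof. by move=> u v; rewrite /quot_rel -opprB rpredN. Qed.

Lemma quot_rel_trans P : transitive (quot_rel P).
Proof.
by move=> v u w uv vw; rewrite /quot_rel -(subrKA v) rpredD.
Qed.

Canonical quot_equiv P :=
  EquivRel (quot_rel P) (quot_rel_refl P) (@quot_rel_sym P) (@quot_rel_trans P).

Definition quotmod P : Type := {eq_quot quot_equiv P}.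
HB.instance Definition _ P := Choice.on (quotmod P).
Definition qclass P (v : V) : quotmod P := \pi_({eq_quot quot_equiv P}) v.
Definition qrepr P (x : quotmod P) : V := repr (x : {eq_quot quot_equiv P}).

Lemma qreprK P : cancel (@qrepr P) (@qclass P).
Proof. exact: reprK. Qed.

Lemma qclassP P u v : reflect (qclass P u = qclass P v) (u - v \in linspan P).
Proof.
by apply: (iffP idP) => [uv|uv]; apply/(@eqmodP _ (quot_equiv P)).
Qed.

Lemma qrepr_class P v : qrepr (qclass P v) - v \in linspan P.
Proof. by apply/qclassP; rewrite qreprK. Qed.

Section Instances.
Variable P : V -> Prop.
Local Notation Q := (quotmod P).
Definition quot_add (x y : Q) : Q := qclass P (qrepr x + qrepr y).
Definition quot_opp (x : Q) : Q := qclass P (- qrepr x).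
Definition quot_scale a (x : Q) : Q := qclass P (a *: qrepr x).

Lemma quot_addE u v : quot_add (qclass P u) (qclass P v) = qclass P (u + v).
Proof. by apply/qclassP; rewrite opprD addrACA rpredD ?qrepr_class. Qed.
Lemma quot_oppE u : quot_opp (qclass P u) = qclass P (- u).
Proof. by apply/qclassP; rewrite -opprD rpredN qrepr_class. Qed.
Lemma quot_scaleE a u : quot_scale a (qclass P u) = qclass P (a *: u).
Proof. by apply/qclassP; rewrite -scalerBr rpredZ ?qrepr_class. Qed.

Lemma quot_ind (T : Q -> Prop) : (forall v, T (qclass P v)) -> forall x, T x.
Proof. by move=> h x; rewrite -(qreprK x). Qed.

Fact quot_addA : associative quot_add.
Proof.
elim/quot_ind=> u; elim/quot_ind=> v; elim/quot_ind=> w.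
by rewrite !quot_addE addrA.
Qed.
Fact quot_addC : commutative quot_add.
Proof. by elim/quot_ind=> u; elim/quot_ind=> v; rewrite !quot_addE addrC. Qed.
Fact quot_add0 : left_id (qclass P 0) quot_add.
Proof. by elim/quot_ind=> u; rewrite quot_addE add0r. Qed.
Fact quot_addN : left_inverse (qclass P 0) quot_opp quot_add.
Proof. by elim/quot_ind=> u; rewrite quot_oppE quot_addE addNr. Qed.
HB.instance Definition _ :=
  GRing.isZmodule.Build Q quot_addA quot_addC quot_add0 quot_addN.

Fact quot_scaleA a b x : quot_scale a (quot_scale b x) = quot_scale (a * b) x.
Proof. by elim/quot_ind: x => u; rewrite !quot_scaleE scalerA. Qed.
Fact quot_scale1 : left_id 1 quot_scale.
Proof. by elim/quot_ind=> u; rewrite quot_scaleE scale1r. Qed.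
Fact quot_scaleDr : right_distributive quot_scale +%R.
Proof.
move=> a; elim/quot_ind=> u; elim/quot_ind=> v.
by rewrite /GRing.add /= quot_addE !quot_scaleE quot_addE scalerDr.
Qed.
Fact quot_scaleDl x : {morph quot_scale^~ x : a b / a + b}.
Proof.
elim/quot_ind: x => u a b.
by rewrite !quot_scaleE [in RHS]/GRing.add /= quot_addE scalerDl.
Qed.
HB.instance Definition _ := GRing.Zmodule_isLmodule.Build K Q
  quot_scaleA quot_scale1 quot_scaleDr quot_scaleDl.

Lemma qclass_linear : linear (qclass P).
Proof.
by move=> a u v; rewrite [in RHS]/GRing.add [in RHS]/GRing.scale /= quot_scaleE quot_addE.
Qed.
End Instances.

End Spans.

Section Tensor.
Context {K : comNzRingType}.

Definition bilin (V W X : lmodType K) (f : V -> W -> X) : Prop :=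
  (forall w, linear (f^~ w)) /\ (forall v, linear (f v)).

Section Def.
Context {V W : lmodType K}.

Definition fsum (X : lmodType K) (f : V -> W -> X) (s : seq (V * W)) : X :=
  \sum_(p <- s) f p.1 p.2.

(* The formal sum s = [:: (v_1, w_1); ...; (v_l, w_l)] stands for *)
(* v_1 (x) w_1 + ... + v_l (x) w_l; two formal sums represent the same *)
(* tensor iff no bilinear map separates them. *)
Definition tens_rel : rel (seq (V * W)) := fun s t =>
  `[< forall (X : lmodType K) (f : V -> W -> X), bilin f -> fsum f s = fsum f t >].

Lemma tens_rel_refl : reflexive tens_rel.
Proof. by move=> s; apply/asboolP. Qed.
Lemma tens_rel_sym : symmetric tens_rel.
Proof. by move=> s t; apply/asboolP/asboolP=> st X f /st. Qed.
Lemma tens_rel_trans : transitive tens_rel.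
Proof.
move=> t s r /asboolP st /asboolP tr; apply/asboolP=> X f hf.
by rewrite st ?tr.
Qed.
Canonical tens_equiv := EquivRel tens_rel tens_rel_refl tens_rel_sym tens_rel_trans.
End Def.

Definition tens (V W : lmodType K) : Type := {eq_quot (@tens_equiv V W)}.
HB.instance Definition _ V W := Choice.on (tens V W).

Section Theory.
Context {V W : lmodType K}.
Local Notation T := (tens V W).

Definition tclass (s : seq (V * W)) : T := \pi_({eq_quot (@tens_equiv V W)}) s.
Definition trepr (t : T) : seq (V * W) := repr (t : {eq_quot (@tens_equiv V W)}).
Definition tens_in (v : V) (w : W) : T := tclass [:: (v, w)].

(* the linear map out of V (x) W induced by f, when f is bilinear *)
Definition tens_lift (X : lmodType K) (f : V -> W -> X) (t : T) : X :=
  fsum f (trepr t).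

Lemma treprK : cancel trepr tclass.
Proof. exact: reprK. Qed.
Lemma tclassP s t : (forall (X : lmodType K) (f : V -> W -> X), bilin f ->
  fsum f s = fsum f t) <-> tclass s = tclass t.
Proof.
split=> [h|h]; first by apply/eqquotP/asboolP.
by have /eqquotP/asboolP := h.
Qed.
Lemma tens_lift_class (X : lmodType K) (f : V -> W -> X) s : bilin f ->
  tens_lift f (tclass s) = fsum f s.
Proof.
move=> hf; rewrite /tens_lift; have /tclassP-> // := treprK (tclass s).
Qed.
Lemma tens_ind (Z : T -> Prop) : (forall s, Z (tclass s)) -> forall t, Z t.
Proof. by move=> h t; rewrite -(treprK t). Qed.

Definition sscale (a : K) (s : seq (V * W)) := [seq (a *: p.1, p.2) | p <- s].
Definition tens_add (s t : T) : T := tclass (trepr s ++ trepr t).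
Definition tens_opp (s : T) : T := tclass (sscale (-1) (trepr s)).
Definition tens_scale a (s : T) : T := tclass (sscale a (trepr s)).

Lemma fsum_cat (X : lmodType K) (f : V -> W -> X) s t :
  fsum f (s ++ t) = fsum f s + fsum f t.
Proof. exact: big_cat. Qed.
Lemma fsum_scale (X : lmodType K) (f : V -> W -> X) a s : bilin f ->
  fsum f (sscale a s) = a *: fsum f s.
Proof.
case=> f1 f2; rewrite /fsum big_map scaler_sumr; apply: eq_bigr => -[v w] _ /=.
have f0 : f 0 w = 0.
  by have := f1 w (-1) 0 0; rewrite addr0 scaler0 scaleN1r addNr.
by have := f1 w a v 0; rewrite f0 !addr0.
Qed.

Lemma tens_addE s t : tens_add (tclass s) (tclass t) = tclass (s ++ t).
Proof.
apply/tclassP=> X f hf; rewrite !fsum_cat.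
by rewrite -2!(tens_lift_class _ hf) treprK treprK !tens_lift_class.
Qed.
Lemma tens_scaleE a s : tens_scale a (tclass s) = tclass (sscale a s).
Proof.
apply/tclassP=> X f hf; rewrite !fsum_scale //.
by rewrite -(tens_lift_class _ hf) treprK tens_lift_class.
Qed.
Lemma tens_oppE s : tens_opp (tclass s) = tclass (sscale (-1) s).
Proof. exact: tens_scaleE. Qed.

Fact tens_addA : associative tens_add.
Proof.
by elim/tens_ind=> s; elim/tens_ind=> t; elim/tens_ind=> r; rewrite !tens_addE catA.
Qed.
Fact tens_addC : commutative tens_add.
Proof.
elim/tens_ind=> s; elim/tens_ind=> t; rewrite !tens_addE.
by apply/tclassP=> X f hf; rewrite !fsum_cat addrC.
Qed.
Fact tens_add0 : left_id (tclass [::]) tens_add.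
Proof. by elim/tens_ind=> s; rewrite tens_addE. Qed.
Fact tens_addN : left_inverse (tclass [::]) tens_opp tens_add.
Proof.
elim/tens_ind=> s; rewrite tens_oppE tens_addE; apply/tclassP=> X f hf.
by rewrite fsum_cat fsum_scale // scaleN1r addNr /fsum big_nil.
Qed.
HB.instance Definition _ :=
  GRing.isZmodule.Build T tens_addA tens_addC tens_add0 tens_addN.

Fact tens_scaleA a b x : tens_scale a (tens_scale b x) = tens_scale (a * b) x.
Proof.
elim/tens_ind: x => s; rewrite !tens_scaleE; apply/tclassP=> X f hf.
by rewrite !fsum_scale // scalerA.
Qed.
Fact tens_scale1 : left_id 1 tens_scale.
Proof.
elim/tens_ind=> s; rewrite !tens_scaleE; apply/tclassP=> X f hf.
by rewrite !fsum_scale // scale1r.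
Qed.
Fact tens_scaleDr : right_distributive tens_scale +%R.
Proof.
move=> a; elim/tens_ind=> s; elim/tens_ind=> t; rewrite /GRing.add /=.
rewrite tens_addE !tens_scaleE tens_addE; apply/tclassP=> X f hf.
by rewrite !(fsum_scale, fsum_cat) // scalerDr.
Qed.
Fact tens_scaleDl x : {morph tens_scale^~ x : a b / a + b}.
Proof.
elim/tens_ind: x => s a b; rewrite [in RHS]/GRing.add /=.
rewrite !tens_scaleE tens_addE; apply/tclassP=> X f hf.
by rewrite !(fsum_scale, fsum_cat) // scalerDl.
Qed.
HB.instance Definition _ := GRing.Zmodule_isLmodule.Build K T
  tens_scaleA tens_scale1 tens_scaleDr tens_scaleDl.

Lemma tens_in_bilin : bilin tens_in.
Proof.
split=> [w a v v'|v a w w'];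
  rewrite [in RHS]/GRing.add [in RHS]/GRing.scale /= tens_scaleE tens_addE;
  apply/tclassP=> X f hf; rewrite fsum_cat fsum_scale // /fsum !big_seq1 /=.
  by case: hf => -> _.
by case: hf => _ ->.
Qed.

Lemma tens_lift_linear (X : lmodType K) (f : V -> W -> X) : bilin f ->
  linear (tens_lift f).
Proof.
move=> hf a; elim/tens_ind=> s; elim/tens_ind=> t.
rewrite [in LHS]/GRing.add [in LHS]/GRing.scale /= tens_scaleE tens_addE.
by rewrite !tens_lift_class // fsum_cat fsum_scale.
Qed.

Lemma tens_lift_in (X : lmodType K) (f : V -> W -> X) v w : bilin f ->
  tens_lift f (tens_in v w) = f v w.
Proof. by move=> hf; rewrite tens_lift_class // /fsum big_seq1. Qed.

Lemma tens_sum (t : T) : t = \sum_(p <- trepr t) tens_in p.1 p.2.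
Proof.
rewrite -[LHS]treprK; elim: (trepr t) => [|[v w] s IHs]; first by rewrite big_nil.
by rewrite big_cons -IHs [RHS]tens_addE.
Qed.
End Theory.

Definition tens_map (V V' W W' : lmodType K) (f : V -> V') (g : W -> W') :
  tens V W -> tens V' W' := tens_lift (fun v w => tens_in (f v) (g w)).

Definition tens_mul (A B : algType K) (s t : tens A B) : tens A B :=
  tens_lift (fun a b => tens_map ( *%R a) ( *%R b) t) s.

End Tensor.

Definition ratfun (K : fieldType) : Type := {fraction {poly K}}.
HB.instance Definition _ (K : fieldType) := GRing.Field.on (ratfun K).

Section RatFun.
Variable K : fieldType.
Local Notation Ku := (ratfun K).

Definition ratpoly (p : {poly K}) : Ku := tofrac p.
Definition ratu : Ku := ratpoly 'X.

Definition ratfun_scale (a : K) (f : Ku) : Ku := ratpoly a%:P * f.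
Fact ratfun_scaleA a b f : ratfun_scale a (ratfun_scale b f) = ratfun_scale (a * b) f.
Proof. by rewrite /ratfun_scale mulrA /ratpoly -tofracM -polyCM. Qed.
Fact ratfun_scale1 : left_id 1 ratfun_scale.
Proof. by move=> f; rewrite /ratfun_scale /ratpoly tofrac1 mul1r. Qed.
Fact ratfun_scaleDr : right_distributive ratfun_scale +%R.
Proof. by move=> a f g; rewrite /ratfun_scale mulrDr. Qed.
Fact ratfun_scaleDl f : {morph ratfun_scale^~ f : a b / a + b}.
Proof. by move=> a b; rewrite /ratfun_scale /ratpoly polyCD tofracD mulrDl. Qed.
HB.instance Definition _ := GRing.Zmodule_isLmodule.Build K Ku
  ratfun_scaleA ratfun_scale1 ratfun_scaleDr ratfun_scaleDl.
Fact ratfun_scaleAl a (f g : Ku) : a *: (f * g) = (a *: f) * g.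
Proof. exact: mulrA. Qed.
HB.instance Definition _ := GRing.Lmodule_isLalgebra.Build K Ku ratfun_scaleAl.
Fact ratfun_scaleAr a (f g : Ku) : a *: (f * g) = f * (a *: g).
Proof. exact: mulrCA. Qed.
HB.instance Definition _ := GRing.Lalgebra_isAlgebra.Build K Ku ratfun_scaleAr.

(* A = {f/g | f, g in C[u, u^-1], g(1) != 0}; a Laurent polynomial is written *)
(* p / u^k with p a polynomial, and its value at 1 is p(1). *)
Definition in_A (f : Ku) : Prop := exists (p d : {poly K}) (k l : nat),
  d.[1] != 0 /\ f = (ratpoly p / ratu ^+ k) / (ratpoly d / ratu ^+ l).

(* Formal series sum_k L(k) u^k with coefficients in W, k ranging over Z. *)
(* W((u)) consists of those that are bounded below. *)
Definition is_laurent (W : zmodType) (L : int -> W) : Prop :=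
  exists k0 : int, forall k, k < k0 -> L k = 0.

Definition mono (W : zmodType) (k : int) (w : W) : int -> W :=
  fun j => if j == k then w else 0.

(* Product of Laurent series induced by a product W1 x W2 -> W; the sums are *)
(* finite when both series are bounded below. *)
Definition conv (W1 W2 W : zmodType) (op : W1 -> W2 -> W)
    (L1 : int -> W1) (L2 : int -> W2) : int -> W :=
  fun k => \sum_(i \in [set: int]) op (L1 i) (L2 (k - i)).

(* a is the expansion of f in C((u)): f = p / d and d * a = p in C((u)) *)
Definition is_expansion (f : Ku) (a : int -> K) : Prop :=
  is_laurent a /\ exists p d : {poly K},
    [/\ d != 0, f = ratpoly p / ratpoly d
      & forall k : int, \sum_(i < size d) d`_i * a (k - i%:Z) =
          if 0 <= k then p`_`|k|%N else 0].

(* the embedding of W (x) C(u) into W((u)) *)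
Definition is_tens_expansion (W : lmodType K) (m : tens W Ku) (L : int -> W) : Prop :=
  exists (l : nat) (w : 'I_l -> W) (f : 'I_l -> Ku) (a : 'I_l -> int -> K),
    [/\ forall i, is_expansion (f i) (a i), m = \sum_i tens_in (w i) (f i)
      & forall k, L k = \sum_i a i k *: w i].

Definition ratscale (W : lmodType K) (f : Ku) : tens W Ku -> tens W Ku :=
  tens_map id ( *%R f).

End RatFun.

Record cartan_datum (n : nat) := CartanDatum {
  gcm :> 'M[int]_n;
  gcm_diag : forall i, gcm i i = 2;
  gcm_offdiag : forall i j, i != j -> gcm i j <= 0;
  gcm_zero : forall i j, gcm i j = 0 <-> gcm j i = 0;
  symm : 'I_n -> nat;
  symm_gt0 : forall i, (0 < symm i)%N;
  symmP : forall i j, (symm i)%:Z * gcm i j = (symm j)%:Z * gcm j i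
}.

Definition symB n (C : cartan_datum n) (i j : 'I_n) : int := (symm C i)%:Z * C i j.

Record realization n (C : cartan_datum n) := Realization {
  hspace :> vectType rat;
  hspace_dim : \dim {:hspace} = (2 * n - \rank (map_mx intr C : 'M[rat]_n))%N;
  root : 'I_n -> 'Hom(hspace, rat^o);
  coroot : 'I_n -> hspace;
  root_free : free [tuple root i | i < n];
  coroot_free : free [tuple coroot i | i < n];
  root_coroot : forall i j, root j (coroot i) = (C i j)%:~R
}.

Record quantum_parameter (K : fieldType) := QuantumParameter {
  qpar : K;
  qpar_neq0 : qpar != 0;
  qpar_not_root : forall m : nat, (0 < m)%N -> qpar ^+ m != 1;
  qpow : rat -> K;
  qpowD : forall s t, qpow (s + t) = qpow s * qpow t;
  qpow1 : qpow 1 = qpar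
}.

Definition qint (K : fieldType) (q : K) (l : int) : K :=
  (q ^ l - q ^ (- l)) / (q - q^-1).
Definition qfact (K : fieldType) (q : K) (m : nat) : K :=
  \prod_(1 <= l < m.+1) qint q l%:Z.
Definition qbinom (K : fieldType) (q : K) (s k : nat) : K :=
  qfact q s / (qfact q k * qfact q (s - k)).

Section PowerSeries.
Variables (K : fieldType) (A : algType K).
Implicit Types f g : nat -> A.
Definition ps_one : nat -> A := fun m => (m == 0%N)%:R.
Definition ps_mul f g : nat -> A := fun m => \sum_(i < m.+1) f i * g (m - i)%N.
Definition ps_pow f (k : nat) : nat -> A := iter k (ps_mul f) ps_one.
(* exp(f) when f has zero constant term: f^k then starts in degree k *)
Definition ps_exp f : nat -> A := fun m => \sum_(k < m.+1) (k`!%:R)^-1 *: ps_pow f k m.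
End PowerSeries.

(* true stands for the superscript +, false for - *)
Definition sg (e : bool) : int := if e then 1 else -1.

Definition nzint : Type := {m : int | m != 0}.
Lemma signed_nz_subproof e (m : nat) : sg e * m.+1%:Z != 0.
Proof. by case: e. Qed.
Definition signed_nz (e : bool) (m : nat) : nzint :=
  exist _ (sg e * m.+1%:Z) (signed_nz_subproof e m).

Section QuantumAffinization.
Variables (K : fieldType) (n : nat) (C : cartan_datum n) (h : realization C)
  (qp : quantum_parameter K).
Local Notation q := (qpar qp).
Local Notation B := (symB C).
Definition qi (i : 'I_n) : K := q ^+ symm C i.

Section Relations.
Variables (A : algType K) (x : bool -> 'I_n -> int -> A) (k : h -> A)
  (hh : 'I_n -> nzint -> A).

(* e (q - q^-1) sum_(m >= 1) h_(i, e m) z^(e m), as a power series in z^e *)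
Definition phi_log (e : bool) (i : 'I_n) : nat -> A := fun m =>
  if m is m'.+1 then (sg e)%:~R * (q - q^-1) *: hh i (signed_nz e m') else 0.

Definition phi (e : bool) (i : 'I_n) (m : int) : A :=
  if 0 <= sg e * m
  then k ((sg e * (symm C i)%:Z)%:~R *: coroot h i) * ps_exp (phi_log e i) `|m|%N
  else 0.

(* The relations between formal currents are written coefficient by *)
(* coefficient. *)
Record qaff_relations : Prop := QAffRelations {
  rel_k0 : k 0 = 1;
  rel_kD : forall a b, k (a + b) = k a * k b;
  rel_kh : forall a i m, k a * hh i m = hh i m * k a;
  rel_hh : forall i m j m', hh i m * hh j m' = hh j m' * hh i m;
  rel_kx : forall a e j r,
    k a * x e j r * k (- a) = qpow qp ((sg e)%:~R * root h j a) *: x e j r;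
  rel_hx : forall i (m : nzint) e j r,
    hh i m * x e j r - x e j r * hh i m =
      ((sg e)%:~R * ((val m)%:~R)^-1 * qint q (val m * B i j)) *: x e j (val m + r);
  rel_xpm : forall i j r s,
    x true i r * x false j s - x false j s * x true i r =
      if i == j
      then (qi i - (qi i)^-1)^-1 *: (phi true i (r + s) - phi false i (r + s))
      else 0;
  (* coefficient of z^r w^s *)
  rel_xx : forall e i j r s,
    x e i r * x e j (s - 1) - q ^ (sg e * B i j) *: (x e i (r - 1) * x e j s) =
    q ^ (sg e * B i j) *: (x e j (s - 1) * x e i r) - x e j s * x e i (r - 1);
  (* coefficient of w_1^(rr 1) ... w_s^(rr s) z^r *)
  rel_serre : (forall i j, i != j -> C i j * C j i <= 3) ->
    forall e i j, i != j -> let s := `|1 - C i j|%N in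
    forall (rr : 'I_s -> int) (r : int),
    \sum_(pi : 'S_s) \sum_(l < s.+1) ((-1) ^+ l * qbinom (qi i) s l) *:
      ((\prod_(a < s | (a < l)%N) x e i (rr (pi a))) * x e j r *
       (\prod_(a < s | (l <= a)%N) x e i (rr (pi a)))) = 0
}.
End Relations.

Inductive qgen : Type :=
  | GX of bool & 'I_n & int
  | GK of h
  | GH of 'I_n & nzint.

Inductive qterm : Type :=
  | TConst of K
  | TGen of qgen
  | TAdd of qterm & qterm
  | TMul of qterm & qterm.

Fixpoint qeval (A : algType K) (v : qgen -> A) (t : qterm) : A :=
  match t with
  | TConst c => c%:A
  | TGen g => v g
  | TAdd t1 t2 => qeval v t1 + qeval v t2
  | TMul t1 t2 => qeval v t1 * qeval v t2
  end.

Definition qmodel (A : algType K) (v : qgen -> A) : Prop :=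
  qaff_relations (fun e i r => v (GX e i r)) (fun a => v (GK a)) (fun i m => v (GH i m)).

(* The presented algebra: two polynomials in the generators are identified *)
(* iff they agree in every algebra where the defining relations hold. *)
Definition qterm_rel (s t : qterm) : bool :=
  `[< forall (A : algType K) (v : qgen -> A), qmodel v -> qeval v s = qeval v t >].

HB.instance Definition _ := gen_eqMixin qterm.
HB.instance Definition _ := gen_choiceMixin qterm.

Lemma qterm_rel_refl : reflexive qterm_rel.
Proof. by move=> s; apply/asboolP. Qed.
Lemma qterm_rel_sym : symmetric qterm_rel.
Proof. by move=> s t; apply/asboolP/asboolP=> st A v hv; rewrite st. Qed.
Lemma qterm_rel_trans : transitive qterm_rel.
Proof.
move=> t s r /asboolP st /asboolP tr; apply/asboolP=> A v hv.
by rewrite st ?tr.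
Qed.
Canonical qterm_equiv :=
  EquivRel qterm_rel qterm_rel_refl qterm_rel_sym qterm_rel_trans.

Definition qaff : Type := {eq_quot qterm_equiv}.
HB.instance Definition _ := Choice.on qaff.
Definition uclass (t : qterm) : qaff := \pi_({eq_quot qterm_equiv}) t.
Definition urepr (a : qaff) : qterm := repr (a : {eq_quot qterm_equiv}).

Lemma ureprK : cancel urepr uclass.
Proof. exact: reprK. Qed.
Lemma uclassP s t : (forall (A : algType K) (v : qgen -> A), qmodel v ->
  qeval v s = qeval v t) <-> uclass s = uclass t.
Proof.
split=> [st|st]; first by apply/eqquotP/asboolP.
by have /eqquotP/asboolP := st.
Qed.
Lemma u_ind (Z : qaff -> Prop) : (forall s, Z (uclass s)) -> forall a, Z a.
Proof. by move=> hZ a; rewrite -(ureprK a). Qed.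

Definition u_add (a b : qaff) := uclass (TAdd (urepr a) (urepr b)).
Definition u_mul (a b : qaff) := uclass (TMul (urepr a) (urepr b)).
Definition u_scale (c : K) (a : qaff) := uclass (TMul (TConst c) (urepr a)).
Definition u_opp := u_scale (-1).

Lemma qeval_repr (A : algType K) (v : qgen -> A) t : qmodel v ->
  qeval v (urepr (uclass t)) = qeval v t.
Proof. by move=> hv; have /uclassP-> := ureprK (uclass t). Qed.

Lemma u_addE s t : u_add (uclass s) (uclass t) = uclass (TAdd s t).
Proof. by apply/uclassP=> A v hv /=; rewrite !qeval_repr. Qed.
Lemma u_mulE s t : u_mul (uclass s) (uclass t) = uclass (TMul s t).
Proof. by apply/uclassP=> A v hv /=; rewrite !qeval_repr. Qed.
Lemma u_scaleE c t : u_scale c (uclass t) = uclass (TMul (TConst c) t).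
Proof. by apply/uclassP=> A v hv /=; rewrite !qeval_repr. Qed.
Definition uE := (u_addE, u_mulE, u_scaleE).

Fact u_addA : associative u_add.
Proof.
elim/u_ind=> r; elim/u_ind=> s; elim/u_ind=> t; rewrite !uE.
by apply/uclassP=> A v hv /=; rewrite addrA.
Qed.
Fact u_addC : commutative u_add.
Proof.
elim/u_ind=> r; elim/u_ind=> s; rewrite !uE.
by apply/uclassP=> A v hv /=; rewrite addrC.
Qed.
Fact u_add0 : left_id (uclass (TConst 0)) u_add.
Proof.
elim/u_ind=> r; rewrite !uE.
by apply/uclassP=> A v hv /=; rewrite scale0r add0r.
Qed.
Fact u_addN : left_inverse (uclass (TConst 0)) u_opp u_add.
Proof.
elim/u_ind=> r; rewrite /u_opp !uE.
by apply/uclassP=> A v hv /=; rewrite scale0r mulr_algl scaleN1r addNr.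
Qed.
HB.instance Definition _ :=
  GRing.isZmodule.Build qaff u_addA u_addC u_add0 u_addN.

Lemma u_addrE s t : uclass s + uclass t = uclass (TAdd s t).
Proof. exact: u_addE. Qed.

Fact u_mulA : associative u_mul.
Proof.
elim/u_ind=> r; elim/u_ind=> s; elim/u_ind=> t; rewrite !uE.
by apply/uclassP=> A v hv /=; rewrite mulrA.
Qed.
Fact u_mul1 : left_id (uclass (TConst 1)) u_mul.
Proof.
elim/u_ind=> r; rewrite !uE.
by apply/uclassP=> A v hv /=; rewrite scale1r mul1r.
Qed.
Fact u_mulr1 : right_id (uclass (TConst 1)) u_mul.
Proof.
elim/u_ind=> r; rewrite !uE.
by apply/uclassP=> A v hv /=; rewrite scale1r mulr1.
Qed.
Fact u_mulDl : left_distributive u_mul +%R.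
Proof.
elim/u_ind=> r; elim/u_ind=> s; elim/u_ind=> t; rewrite !(u_addrE, uE).
by apply/uclassP=> A v hv /=; rewrite mulrDl.
Qed.
Fact u_mulDr : right_distributive u_mul +%R.
Proof.
elim/u_ind=> r; elim/u_ind=> s; elim/u_ind=> t; rewrite !(u_addrE, uE).
by apply/uclassP=> A v hv /=; rewrite mulrDr.
Qed.

Definition qtriv (g : qgen) : K^o := if g is GK _ then 1 else 0.

Lemma qtriv_model : qmodel qtriv.
Proof.
have pow0 f l m : (forall i, f i = 0) -> ps_pow (A := K^o) f l.+1 m = 0.
  by move=> f0 /=; rewrite /ps_mul big1 // => i _; rewrite f0 mul0r.
have phiE e i m : phi (A := K^o) (fun a => qtriv (GK a))
    (fun i m => qtriv (GH i m)) e i m = (m == 0)%:R.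
  rewrite /phi; case: ifP => [_|/negbT]; last first.
    by case: eqP => // ->; rewrite mulr0 lexx.
  rewrite mul1r /ps_exp big_ord_recl big1 ?addr0 => [|l _]; last first.
    by rewrite pow0 ?scaler0 // => -[|a] //=; rewrite scaler0.
  by rewrite /= fact0 invr1 scale1r /ps_one absz_eq0.
split=> //.
- by move=> *; rewrite /= mulr1.
- by move=> *; rewrite /= !(mulr0, mul0r).
- by move=> *; rewrite /= !(mulr0, mul0r, subrr, scaler0).
- by move=> *; rewrite /= !(mulr0, mul0r, subrr, scaler0).
- by move=> i j r s; rewrite !phiE !mulr0 !subrr scaler0 if_same.
- by move=> *; rewrite /= !(mulr0, scaler0).
- move=> _ e i j _ s rr r; rewrite big1 // => pi _; rewrite big1 // => l _.
  by rewrite mulr0 mul0r scaler0.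
Qed.

Fact u_1_neq0 : uclass (TConst 1) != 0.
Proof.
apply/eqP => u10; have := (uclassP _ _).2 u10 _ _ qtriv_model.
by rewrite /= scale1r scale0r => /eqP; rewrite oner_eq0.
Qed.
HB.instance Definition _ := GRing.Zmodule_isNzRing.Build qaff
  u_mulA u_mul1 u_mulr1 u_mulDl u_mulDr u_1_neq0.

Fact u_scaleA a b x : u_scale a (u_scale b x) = u_scale (a * b) x.
Proof.
elim/u_ind: x => r; rewrite !uE; apply/uclassP=> A v hv /=.
by rewrite !mulr_algl scalerA.
Qed.
Fact u_scale1 : left_id 1 u_scale.
Proof.
elim/u_ind=> r; rewrite !uE; apply/uclassP=> A v hv /=.
by rewrite mulr_algl scale1r.
Qed.
Fact u_scaleDr : right_distributive u_scale +%R.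
Proof.
move=> c; elim/u_ind=> r; elim/u_ind=> s; rewrite !(u_addrE, uE).
by apply/uclassP=> A v hv /=; rewrite mulrDr.
Qed.
Fact u_scaleDl x : {morph u_scale^~ x : a b / a + b}.
Proof.
elim/u_ind: x => r a b; rewrite !(u_addrE, uE).
by apply/uclassP=> A v hv /=; rewrite scalerDl mulrDl.
Qed.
HB.instance Definition _ := GRing.Zmodule_isLmodule.Build K qaff
  u_scaleA u_scale1 u_scaleDr u_scaleDl.

Lemma u_mulrE s t : uclass s * uclass t = uclass (TMul s t).
Proof. exact: u_mulE. Qed.
Lemma u_scalerE c t : c *: uclass t = uclass (TMul (TConst c) t).
Proof. exact: u_scaleE. Qed.

Fact u_scaleAl c (a b : qaff) : c *: (a * b) = (c *: a) * b.
Proof.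
elim/u_ind: a => r; elim/u_ind: b => s; rewrite !(u_mulrE, u_scalerE).
by apply/uclassP=> A v hv /=; rewrite mulrA.
Qed.
HB.instance Definition _ := GRing.Lmodule_isLalgebra.Build K qaff u_scaleAl.
Fact u_scaleAr c (a b : qaff) : c *: (a * b) = a * (c *: b).
Proof.
elim/u_ind: a => r; elim/u_ind: b => s; rewrite !(u_mulrE, u_scalerE).
by apply/uclassP=> A v hv /=; rewrite !mulr_algl scalerAr.
Qed.
HB.instance Definition _ := GRing.Lalgebra_isAlgebra.Build K qaff u_scaleAr.

Definition ugen (g : qgen) : qaff := uclass (TGen g).
Definition ux e i r : qaff := ugen (GX e i r).
Definition uk a : qaff := ugen (GK a).
Definition uh i m : qaff := ugen (GH i m).
Definition uphi e i m : qaff := phi uk uh e i m.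

Lemma qeval_ugen t : qeval ugen t = uclass t.
Proof.
elim: t => [c|g|s IHs t IHt|s IHs t IHt] //=.
- rewrite u_scalerE; apply/uclassP=> A v hv /=.
  by rewrite scale1r mulr1.
- by rewrite IHs IHt u_addrE.
- by rewrite IHs IHt u_mulrE.
Qed.

Section Universal.
Variables (A : algType K) (v : qgen -> A) (hv : qmodel v).

Definition u_eval (a : qaff) : A := qeval v (urepr a).

Lemma u_eval_class t : u_eval (uclass t) = qeval v t.
Proof. exact: qeval_repr. Qed.

Fact u_eval_linear : linear u_eval.
Proof.
move=> c; elim/u_ind=> s; elim/u_ind=> t.
by rewrite u_scalerE u_addrE !u_eval_class /= mulr_algl.
Qed.
Fact u_eval_monoid : monoid_morphism u_eval.
Proof.
split; first by rewrite u_eval_class /= scale1r.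
by elim/u_ind=> s; elim/u_ind=> t; rewrite u_mulrE !u_eval_class.
Qed.

Definition u_lift of qmodel v : qaff -> A := u_eval.
HB.instance Definition _ := GRing.isLinear.Build K qaff A _ (u_lift hv) u_eval_linear.
HB.instance Definition _ := GRing.isMonoidMorphism.Build qaff A (u_lift hv) u_eval_monoid.

Lemma u_lift_gen g : u_lift hv (ugen g) = v g.
Proof. exact: u_eval_class. Qed.

Lemma u_lift_unique (f : {lrmorphism qaff -> A}) :
  (forall g, f (ugen g) = v g) -> f =1 u_lift hv.
Proof.
move=> fg; elim/u_ind; elim=> [c|g|s IHs t IHt|s IHs t IHt].
- rewrite (_ : uclass (TConst c) = c%:A) ?linearZ ?rmorph1 //.
  by rewrite u_scalerE; apply/uclassP=> B w hw /=; rewrite scale1r mulr1.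
- by rewrite fg u_lift_gen.
- by rewrite -u_addrE !rmorphD; congr (_ + _).
- by rewrite -u_mulrE !rmorphM; congr (_ * _).
Qed.
End Universal.

Lemma phi_morph (A A' : algType K) (f : {lrmorphism A -> A'}) k hh e i m :
  f (phi k hh e i m) = phi (f \o k) (fun i m => f (hh i m)) e i m.
Proof.
have powE l a : f (ps_pow (phi_log hh e i) l a) =
    ps_pow (phi_log (fun i m => f (hh i m)) e i) l a.
  elim: l a => [|l IHl] a /=; first by rewrite /ps_one rmorph_nat.
  rewrite /ps_mul rmorph_sum; apply: eq_bigr => b _.
  rewrite rmorphM; congr (_ * _); last exact: IHl.
  by case: (b : nat) => [|b'] /=; rewrite ?rmorph0 ?linearZ.
rewrite /phi; case: ifP => _; last by rewrite rmorph0.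
rewrite rmorphM /ps_exp rmorph_sum; congr (_ * _); apply: eq_bigr => l _.
by rewrite /= linearZ; congr (_ *: _); exact: powE.
Qed.

(* The generators of qaff satisfy the defining relations; with u_lift this is *)
(* the universal property of the presented algebra. *)
Lemma qaffP : qmodel ugen.
Proof.
have inj (a b : qaff) : (forall (A : algType K) (v : qgen -> A) (hv : qmodel v),
    u_lift hv a = u_lift hv b) -> a = b.
  by move=> ab; rewrite -[a]ureprK -[b]ureprK; apply/uclassP=> A v hv; apply: (ab A v hv).
have phiE A v (hv : qmodel (A := A) v) e i m :
    u_lift hv (phi (fun a => ugen (GK a)) (fun i m => ugen (GH i m)) e i m) =
    phi (fun a => v (GK a)) (fun i m => v (GH i m)) e i m.
  rewrite phi_morph; congr (phi _ _ e i m); apply/funext => a /=.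
    exact: u_lift_gen.
  by apply/funext=> b; exact: u_lift_gen.
split.
- by apply: inj => A v hv; rewrite rmorph1 u_lift_gen (rel_k0 hv).
- by move=> a b; apply: inj => A v hv; rewrite rmorphM /= !u_lift_gen (rel_kD hv).
- by move=> a i m; apply: inj => A v hv; rewrite !rmorphM /= !u_lift_gen (rel_kh hv).
- by move=> i m j m'; apply: inj => A v hv; rewrite !rmorphM /= !u_lift_gen (rel_hh hv).
- by move=> a e j r; apply: inj => A v hv;
    rewrite linearZ /= !rmorphM /= !u_lift_gen (rel_kx hv).
- by move=> i m e j r; apply: inj => A v hv;
    rewrite linearZ /= rmorphB !rmorphM /= !u_lift_gen (rel_hx hv).
- move=> i j r s; apply: inj => A v hv.
  rewrite rmorphB !rmorphM /= !u_lift_gen (rel_xpm hv); case: ifP => _.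
    by rewrite linearZ /= rmorphB; congr (_ *: (_ - _)); apply/esym/phiE.
  by rewrite raddf0.
- move=> e i j r s; apply: inj => A v hv.
  by rewrite !rmorphB /= !linearZ /= !rmorphM /= !u_lift_gen scalerN; exact: (rel_xx hv).
- move=> hC e i j ij s rr r; apply: inj => A v hv; rewrite rmorph0 rmorph_sum.
  rewrite -[RHS](rel_serre hv hC e ij rr r); apply: eq_bigr => pi _.
  rewrite rmorph_sum; apply: eq_bigr => l _; rewrite /= linearZ /= !rmorphM /= !rmorph_prod.
  congr (_ *: (_ * _ * _)); [|exact: u_lift_gen|];
    by apply: eq_bigr => a _; apply: u_lift_gen.
Qed.

End QuantumAffinization.

Record category := Category {
  obj :> Type;
  mor : obj -> obj -> Type;
  idm : forall a, mor a a;
  compm : forall a b c, mor b c -> mor a b -> mor a c;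
  comp1m : forall a b (f : mor a b), compm (idm b) f = f;
  compm1 : forall a b (f : mor a b), compm f (idm a) = f;
  compmA : forall a b c d (f : mor c d) (g : mor b c) (k : mor a b),
    compm f (compm g k) = compm (compm f g) k
}.

Section ProductCategory.
Variables X Y : category.
Definition prod_mor (a b : X * Y) : Type := (mor a.1 b.1 * mor a.2 b.2)%type.
Definition prod_id (a : X * Y) : prod_mor a a := (idm a.1, idm a.2).
Definition prod_comp (a b c : X * Y) (f : prod_mor b c) (g : prod_mor a b) :
  prod_mor a c := (compm f.1 g.1, compm f.2 g.2).
Fact prod_comp1m a b (f : prod_mor a b) : prod_comp (prod_id b) f = f.
Proof. by case: f => f g; rewrite /prod_comp /= !comp1m. Qed.
Fact prod_compm1 a b (f : prod_mor a b) : prod_comp f (prod_id a) = f.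
Proof. by case: f => f g; rewrite /prod_comp /= !compm1. Qed.
Fact prod_compmA a b c d (f : prod_mor c d) (g : prod_mor b c) (k : prod_mor a b) :
  prod_comp f (prod_comp g k) = prod_comp (prod_comp f g) k.
Proof. by rewrite /prod_comp /= !compmA. Qed.
Definition prod_category : category :=
  Category prod_comp1m prod_compm1 prod_compmA.
End ProductCategory.

Definition is_functor (X Y : category) (F : X -> Y)
    (Fm : forall a b : X, mor a b -> mor (F a) (F b)) : Prop :=
  (forall a, Fm a a (idm a) = idm (F a)) /\
  (forall a b c (f : mor b c) (g : mor a b),
    Fm a c (compm f g) = compm (Fm b c f) (Fm a b g)).

Definition findim (K : comNzRingType) (V : lmodType K) (P : V -> Prop) : Prop :=
  exists s : seq V, (forall v, v \in s -> P v) /\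
    (forall v, P v -> v \in linspan (fun w => w \in s)).

Section Modules.
Variables (K : fieldType) (n : nat) (C : cartan_datum n) (h : realization C)
  (qp : quantum_parameter K).
Local Notation U := (qaff h qp).
Local Notation weight := 'Hom(h, rat^o).

Record prerep := PreRep {
  rep_space :> lmodType K;
  rep_act : U -> rep_space -> rep_space
}.
Local Notation act V := (@rep_act V).

Definition is_rep (V : prerep) : Prop :=
  [/\ bilin (act V), forall v, act V 1 v = v
    & forall a b v, act V (a * b) v = act V a (act V b v)].

Definition weight_space (V : prerep) (om : weight) (v : V) : Prop :=
  forall a : h, act V (uk qp a) v = qpow qp (om a) *: v.

Definition in_cone (la mu : weight) : Prop :=
  exists c : 'I_n -> nat, mu = la - \sum_i root h i *+ c i.

Definition in_Mod (V : prerep) : Prop :=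
  [/\ is_rep V,
      (* V is the direct sum of its weight spaces *)
      (forall v : V, exists (s : seq weight) (f : weight -> V),
         (forall om, weight_space om (f om)) /\ v = \sum_(om <- s) f om) /\
      (forall (s : seq weight) (f : weight -> V), uniq s ->
         (forall om, weight_space om (f om)) -> \sum_(om <- s) f om = 0 ->
         forall om, om \in s -> f om = 0),
      forall om, findim (@weight_space V om),
      exists las : seq weight, forall om,
        (exists2 v : V, weight_space om v & v != 0) ->
        exists2 la, la \in las & in_cone la om
    & forall om i, exists r0 : nat, forall r : nat, (r0 <= r)%N ->
        forall v : V,
          weight_space (om + root h i *+ r) v \/ weight_space (om - root h i *+ r) v ->
          v = 0].

Definition in_Modf (V : prerep) : Prop := in_Mod V /\ findim (fun _ : V => True).

Record modf := Modf { modf_rep :> prerep; modfP : in_Modf modf_rep }.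

Definition is_rep_hom (V W : prerep) (f : V -> W) : Prop :=
  linear f /\ forall a v, f (act V a v) = act W a (f v).

Record rep_hom (V W : prerep) := RepHom {
  hom_fun :> V -> W;
  rep_homP : is_rep_hom hom_fun
}.

Lemma rep_hom_eq (V W : prerep) (f g : rep_hom V W) : f =1 g -> f = g.
Proof.
case: f g => f fP [g gP] /= /funext fg; move: fP; rewrite fg => fP.
by congr RepHom; apply: Prop_irrelevance.
Qed.

Fact rep_id_hom (V : prerep) : is_rep_hom (@id V).
Proof. by []. Qed.
Definition rep_id (V : prerep) : rep_hom V V := RepHom (rep_id_hom V).

Fact rep_comp_hom (V W X : prerep) (f : rep_hom W X) (g : rep_hom V W) :
  is_rep_hom (f \o g).
Proof.
case: f g => f [f1 f2] [g [g1 g2]]; split=> [c u v|a v] /=.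
  by rewrite g1 f1.
by rewrite g2 f2.
Qed.
Definition rep_comp (V W X : prerep) (f : rep_hom W X) (g : rep_hom V W) :
  rep_hom V X := RepHom (rep_comp_hom f g).

Fact rep_comp1m (V W : prerep) (f : rep_hom V W) : rep_comp (rep_id W) f = f.
Proof. exact: rep_hom_eq. Qed.
Fact rep_compm1 (V W : prerep) (f : rep_hom V W) : rep_comp f (rep_id V) = f.
Proof. exact: rep_hom_eq. Qed.
Fact rep_compmA (V W X Y : prerep) (f : rep_hom X Y) (g : rep_hom W X) (k : rep_hom V W) :
  rep_comp f (rep_comp g k) = rep_comp (rep_comp f g) k.
Proof. exact: rep_hom_eq. Qed.

Definition Modf_category : category :=
  @Category modf rep_hom rep_id rep_comp
    (fun V W => @rep_comp1m V W) (fun V W => @rep_compm1 V W)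
    (fun V W X Y => @rep_compmA V W X Y).

(* U' = U (x) C(u) *)
Local Notation Ku := (ratfun K).
Definition qaff_u : Type := tens U Ku.
HB.instance Definition _ := GRing.Lmodule.on qaff_u.
Local Notation UU := (tens U U).
Local Notation x := (ux h qp).
Local Notation phi := (uphi h qp).

(* Values of Delta are elements of (U (x) U)((u)), given by coefficients. *)
(* Where Delta_u is written as a sum over s >= 0, the coefficient of u^k is *)
(* the term of index s = k - r for x^+_(i,r), s = k for x^-_(i,r) and *)
(* phi^+_(i,m), and s = - k for phi^-_(i,-m). *)
Record drinfeld_coproduct (Delta : qaff_u -> int -> UU) : Prop :=
  DrinfeldCoproduct {
  Delta_laurent : forall g, is_laurent (Delta g);
  Delta_add : forall a b k, Delta (a + b) k = Delta a k + Delta b k;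
  Delta_ratscale : forall f c g, is_expansion f c ->
    Delta (ratscale f g) = conv *:%R c (Delta g);
  Delta_one : Delta (tens_in 1 1) = mono 0 (tens_in 1 1);
  Delta_mul : forall a b, Delta (tens_mul a b) = conv (@tens_mul _ U U) (Delta a) (Delta b);
  Delta_xp : forall i r k, Delta (tens_in (x true i r) 1) k =
    mono 0 (tens_in (x true i r) 1) k +
    (if r <= k then tens_in (phi false i (r - k)) (x true i k) else 0);
  Delta_xm : forall i r k, Delta (tens_in (x false i r) 1) k =
    mono r (tens_in 1 (x false i r)) k +
    (if 0 <= k then tens_in (x false i (r - k)) (phi true i k) else 0);
  Delta_phip : forall i (m : nat) k, Delta (tens_in (phi true i m%:Z) 1) k =
    if 0 <= k <= m%:Z then tens_in (phi true i (m%:Z - k)) (phi true i k) else 0;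
  Delta_phim : forall i (m : nat) k, Delta (tens_in (phi false i (- m%:Z)) 1) k =
    if - m%:Z <= k <= 0 then tens_in (phi false i (- m%:Z - k)) (phi false i k) else 0;
  Delta_k : forall a,
    Delta (tens_in (uk qp a) 1) = mono 0 (tens_in (uk qp a) (uk qp a))
}.

Section Fusion.
Variable Delta : qaff_u -> int -> UU.

Section Objects.
Variables V1 V2 : prerep.

Definition tens_act (t : UU) (w : tens V1 V2) : tens V1 V2 :=
  tens_lift (fun a b => tens_map (act V1 a) (act V2 b) w) t.

Definition fusion_space : Type := tens (tens V1 V2) Ku.
HB.instance Definition _ := GRing.Lmodule.on fusion_space.

(* m' = g.m, that is m' expands to Delta_u(g) applied to the expansion of m *)
Definition fusion_rel (g : qaff_u) (m m' : fusion_space) : Prop :=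
  exists2 L, is_tens_expansion m L & is_tens_expansion m' (conv tens_act (Delta g) L).

(* the action of U' on i(V1) (x)_f i(V2) *)
Definition fusion_act (g : qaff_u) (m : fusion_space) : fusion_space :=
  xget 0 [set m' | fusion_rel g m m'].

(* U^u = U (x) A inside U (x) C(u) *)
Definition in_Uu (g : qaff_u) : Prop :=
  exists (l : nat) (a : 'I_l -> U) (f : 'I_l -> Ku),
    (forall i, in_A (f i)) /\ g = \sum_i tens_in (a i) (f i).

(* N(V1, V2) = U^u . (V1 (x) V2) *)
Definition lattice : Type := span_type (fun m : fusion_space =>
  exists (g : qaff_u) (w : tens V1 V2), in_Uu g /\ m = fusion_act g (tens_in w 1)).
HB.instance Definition _ := GRing.Lmodule.on lattice.

Definition lattice_val (m : lattice) : fusion_space := sval m.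
Definition to_lattice (m : fusion_space) : lattice := insubd (0 : lattice) m.

(* N / (u - 1) N *)
Definition otimes_d_space : Type := quotmod (fun m : lattice =>
  exists m0 : lattice, lattice_val m = ratscale (ratu K - 1) (lattice_val m0)).
HB.instance Definition _ := GRing.Lmodule.on otimes_d_space.

Definition otimes_d_class (m : lattice) : otimes_d_space := qclass _ m.

Definition otimes_d_act (a : U) (y : otimes_d_space) : otimes_d_space :=
  otimes_d_class (to_lattice (fusion_act (tens_in a 1) (lattice_val (qrepr y)))).

Definition otimes_d : prerep := PreRep otimes_d_act.

(* The choices made in fusion_act, to_lattice and otimes_d_act are immaterial: *)
(* Delta_u(g) m is always the expansion of an element of (V1 (x) V2) (x) C(u), *)
(* N is stable under U, and the action of U descends to N / (u - 1) N. *)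
Definition otimes_d_wf : Prop :=
  [/\ forall g m, fusion_rel g m (fusion_act g m),
      forall a m, lattice_val (to_lattice (fusion_act (tens_in a 1) (lattice_val m))) =
                  fusion_act (tens_in a 1) (lattice_val m)
    & forall a m, otimes_d_act a (otimes_d_class m) =
                  otimes_d_class (to_lattice (fusion_act (tens_in a 1) (lattice_val m)))].
End Objects.

Section Morphisms.
Variables (V1 V2 W1 W2 : prerep) (f1 : V1 -> W1) (f2 : V2 -> W2).

(* the C(u)-linear extension of f1 (x) f2 *)
Definition fusion_map : fusion_space V1 V2 -> fusion_space W1 W2 :=
  tens_map (tens_map f1 f2) id.

Definition otimes_d_map (y : otimes_d V1 V2) : otimes_d W1 W2 :=
  otimes_d_class (to_lattice (fusion_map (lattice_val (qrepr y)))).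

Definition otimes_d_map_wf : Prop :=
  (forall m, lattice_val (to_lattice (fusion_map (lattice_val m)) : lattice W1 W2) =
             fusion_map (lattice_val m)) /\
  (forall m, otimes_d_map (otimes_d_class m) =
             otimes_d_class (to_lattice (fusion_map (lattice_val m)))).
End Morphisms.

Definition otimes_d_bifunctor : Prop :=
  exists (Hob : forall V1 V2 : modf, in_Modf (otimes_d V1 V2))
    (Hmor : forall (V1 V2 W1 W2 : modf) (f1 : rep_hom V1 W1) (f2 : rep_hom V2 W2),
       is_rep_hom (otimes_d_map f1 f2)),
    [/\ forall V1 V2 : modf, otimes_d_wf V1 V2,
        forall (V1 V2 W1 W2 : modf) (f1 : rep_hom V1 W1) (f2 : rep_hom V2 W2),
          otimes_d_map_wf f1 f2
      & @is_functor (prod_category Modf_category Modf_category) Modf_category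
          (fun V => Modf (Hob V.1 V.2))
          (fun V W f => RepHom (Hmor V.1 V.2 W.1 W.2 f.1 f.2))].

End Fusion.
End Modules.

(* Main.v *)
Require Import Defs.
From mathcomp Require Import all_boot all_order all_algebra generic_quotient.
From mathcomp Require Import all_classical reals complex zify.

Set Implicit Arguments.
Unset Strict Implicit.
Unset Printing Implicit Defensive.

Import Order.TTheory GRing.Theory Num.Theory.
Local Open Scope ring_scope.

(** Fix finite dimensional V1 and V2, and let W = V1 (x) V2. A basis of W identifies
    W (x) K(u) with column vectors over K(u), and the argument has three parts.

    Rationality. The coefficients of Delta_u(g) act on W by a Laurent series of
    matrices, and one must see that this is the expansion of a matrix over K(u)
    ([is_fusion_mx_exists]). Such g form a subalgebra, so g may be a generator. For
    k_a and phi_(i,m) the series is a Laurent polynomial, and the h_(i,m) are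
    polynomials in these. For x_(i,r), the commutators with h_(i,1) and h_(i,-1) shift
    the index r; as the operators on W form a finite dimensional space, the sequence
    of the x_(i,r), and those that occur in Delta_u(x_(i,r)), satisfy linear
    recurrences over all the integers ([recurrence_exists]), and recurrent sequences
    are expansions of rational functions. Hence the fusion action is given by
    matrices ([fusion_relP]); it is K(u)-linear and N is a module, and so the action
    descends to N / (u - 1) N.

    Finite generation of N over A. The operators x_(i,r) on the fusion module may have
    poles at u = 1, so N is in general larger than W (x) A. But the sequence of
    their matrices in r satisfies a recurrence whose extreme coefficients are units of
    A; so over A finitely many r suffice ([window_x]). The Cartan part preserves
    W (x) A. By the commutation relations U^- U^+ (W (x) A) is stable under U, hence
    contains N ([lattice_in_full]). Each x^+ raises, and each x^- lowers, the height of
    weights by one, and only the finitely many weights of W occur; so it is generated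
    over A by finitely many words applied to a basis of weight vectors
    ([finite_generators], [lattice_generators]). Since A = K + (u - 1) A, the classes
    of these weight vectors span N / (u - 1) N over K ([otimes_d_spanned]), and a
    module spanned by finitely many weight vectors is in Modf ([spanned_in_Modf]).

    Morphisms. For morphisms f1 and f2 the K(u)-linear extension of f1 (x) f2 commutes
    with the fusion action, because it does so on series ([fusion_map_act]). Thus it
    maps N to N, commutes with u - 1, and induces a morphism of the quotients,
    functorially in f1 and f2. *)

(** * Polynomials acting on sequences indexed by the integers *)

Section ShiftAction.
Context {S : comNzRingType} {M : lmodType S}.
Implicit Types (p q : {poly S}) (a b : int -> M).

(** The polynomial ring acts on all sequences indexed by the integers, X being
    the shift a k |-> a (k - 1). Laurent series and two-sided recurrent
    sequences both live in this module: f = p / d expands to a when d acting on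
    a gives the finite sequence of the coefficients of p, and a sequence is
    recurrent when a nonzero polynomial kills it. *)
Definition shift_act p a : int -> M := fun k => \sum_(i < size p) p`_i *: a (k - i%:Z).

Lemma shift_act_widen N p a k : (size p <= N)%N ->
  shift_act p a k = \sum_(i < N) p`_i *: a (k - i%:Z).
Proof.
move=> pN; rewrite /shift_act (big_ord_widen N (fun i : nat => p`_i *: a (k - i%:Z)) pN).
rewrite big_mkcond; apply: eq_bigr => i _; case: ltnP => // ip.
by rewrite nth_default // scale0r.
Qed.

Lemma shift_act_comb c p q a k : shift_act (c *: p + q) a k = c *: shift_act p a k + shift_act q a k.
Proof.
pose N := maxn (size (c *: p + q)) (maxn (size p) (size q)).
rewrite (@shift_act_widen N (c *: p + q)) ?(@shift_act_widen N p) ?(@shift_act_widen N q);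
  rewrite ?leq_max ?leqnn ?orbT //.
rewrite scaler_sumr -big_split; apply: eq_bigr => i _ /=.
by rewrite coefD coefZ scalerDl scalerA.
Qed.

Lemma shift_act0 a k : shift_act 0 a k = 0.
Proof. by rewrite /shift_act size_poly0 big_ord0. Qed.

Lemma shift_act_seq0 p k : shift_act p (fun=> 0) k = 0.
Proof. by rewrite /shift_act big1 // => i _; rewrite scaler0. Qed.

Lemma shift_act_sum (N : nat) (c : 'I_N -> S) (p : 'I_N -> {poly S}) a k :
  shift_act (\sum_i c i *: p i) a k = \sum_i c i *: shift_act (p i) a k.
Proof.
elim: N c p => [|N IH] c p; first by rewrite !big_ord0 shift_act0.
by rewrite !big_ord_recl shift_act_comb IH.
Qed.

Lemma shift_actXnM i p a k : shift_act ('X^i * p) a k = shift_act p a (k - i%:Z).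
Proof.
rewrite mulrC (@shift_act_widen (i + size p)); last first.
  by apply: leq_trans (size_polyMleq _ _) _; rewrite size_polyXn addnS /= addnC.
rewrite big_split_ord /= big1 ?add0r => [|j _]; last first.
  by rewrite coefMXn ltn_ord scale0r.
apply: eq_bigr => j _; rewrite coefMXn ltnNge leq_addr /= addKn.
by rewrite PoszD opprD addrA.
Qed.

Lemma shift_actC c a k : shift_act c%:P a k = c *: a k.
Proof.
rewrite (@shift_act_widen 1) ?size_polyC ?leq_b1 //.
by rewrite big_ord_recl big_ord0 addr0 coefC subr0.
Qed.

Lemma shift_actM p q a k : shift_act (p * q) a k = shift_act p (shift_act q a) k.
Proof.
rewrite -[p in LHS]coefK poly_def mulr_suml.
under eq_bigr do rewrite -scalerAl.
by rewrite shift_act_sum; apply: eq_bigr => i _; rewrite shift_actXnM.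
Qed.

Lemma shift_actXn i a k : shift_act 'X^i a k = a (k - i%:Z).
Proof. by rewrite -[X in shift_act X]mulr1 shift_actXnM -[1]/(1%:P) shift_actC scale1r. Qed.

Lemma shift_act_combr p c a b k :
  shift_act p (fun j => c *: a j + b j) k = c *: shift_act p a k + shift_act p b k.
Proof.
rewrite /shift_act scaler_sumr -big_split; apply: eq_bigr => i _ /=.
by rewrite scalerDr !scalerA mulrC.
Qed.

Lemma shift_act_below p a k0 : (forall k, k < k0 -> a k = 0) ->
  forall k, k < k0 -> shift_act p a k = 0.
Proof.
move=> ak k kk; rewrite /shift_act big1 // => i _.
by rewrite ak ?scaler0 // (le_lt_trans _ kk) // gerDl oppr_le0.
Qed.

Lemma is_laurent_shift_act p a : is_laurent a -> is_laurent (shift_act p a).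
Proof. by case=> k0 ak; exists k0; exact: shift_act_below. Qed.

Lemma is_laurent_comb c a b : is_laurent a -> is_laurent b ->
  is_laurent (fun k => c *: a k + b k).
Proof.
case=> k0 ak [k1 bk]; exists (Num.min k0 k1) => k.
by rewrite lt_min => /andP[/ak-> /bk->]; rewrite scaler0 addr0.
Qed.

Lemma eq_shift_act p a b : a =1 b -> shift_act p a =1 shift_act p b.
Proof. by move=> ab k; apply: eq_bigr => i _; rewrite ab. Qed.

End ShiftAction.

(** On two-sided sequences X acts invertibly, so factors X of a polynomial can
    be discarded; this is how annihilators with nonzero constant term are
    obtained. *)
Lemma poly_factorX (K : fieldType) (p : {poly K}) : p != 0 ->
  exists m (q : {poly K}), q`_0 != 0 /\ p = 'X^m * q.
Proof.
move=> p0; have [m [q]] := multiplicity_XsubC p 0; rewrite p0 /= subr0 => rq ->.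
by exists m, q; rewrite mulrC -horner_coef0.
Qed.

(** * Rational functions as Laurent series *)

Section RationalFunctions.
Variable K : fieldType.
Local Notation F := (ratfun K).
Implicit Types (p d : {poly K}) (f g : F) (a b : int -> K).

Lemma ratpolyM p d : ratpoly (p * d) = ratpoly p * ratpoly d :> F.
Proof. exact: tofracM. Qed.
Lemma ratpolyD p d : ratpoly (p + d) = ratpoly p + ratpoly d :> F.
Proof. exact: tofracD. Qed.
Lemma ratpolyB p d : ratpoly (p - d) = ratpoly p - ratpoly d :> F.
Proof. exact: tofracB. Qed.
Lemma ratpoly0 : ratpoly 0 = 0 :> F. Proof. exact: tofrac0. Qed.
Lemma ratpoly1 : ratpoly 1 = 1 :> F. Proof. exact: tofrac1. Qed.
Lemma ratpolyXn i : ratpoly 'X^i = ratu K ^+ i :> F. Proof. exact: tofracXn. Qed.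
Lemma ratpoly_eq0 p : (ratpoly p == 0 :> F) = (p == 0).
Proof. exact: tofrac_eq0. Qed.
Lemma ratpoly_inj : injective (@ratpoly K).
Proof. by move=> p q /eqP; rewrite tofrac_eq => /eqP. Qed.
Lemma ratscaleE (c : K) f : c *: f = ratpoly c%:P * f.
Proof. by []. Qed.

Lemma ratfunP f : exists p d, d != 0 /\ f = ratpoly p / ratpoly d.
Proof.
have [r ->] : exists r : {ratio {poly K}}, f = \pi_({fraction {poly K}})%qT r.
  by exists (repr (f : {fraction {poly K}})); rewrite reprK.
exists (frac r).1, (frac r).2; split; first exact: denom_ratioP.
apply: (@mulIf F (ratpoly (frac r).2)); first by rewrite ratpoly_eq0 denom_ratioP.
rewrite divfK ?ratpoly_eq0 ?denom_ratioP // /ratpoly; unlock FracField.tofrac.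
rewrite -[LHS]FracField.pi_mul; apply/eqmodP.
by rewrite /= /FracField.equivf /FracField.mulf !numden_Ratio ?mulr1 ?denom_ratioP ?oner_eq0 // mulrC.
Qed.

(** The Laurent series 1, as an element of the module of sequences. *)
Definition delta0 : int -> K^o := mono 0 1.
Local Notation kact := (@shift_act K K^o).

Lemma delta0_laurent : is_laurent delta0.
Proof. by exists 0 => k k0; rewrite /delta0 /mono lt_eqF. Qed.

Lemma kact_delta0 p k : kact p delta0 k = if 0 <= k then p`_`|k|%N else 0.
Proof.
have E (i : nat) : delta0 (k - i%:Z) = (k == i%:Z)%:R.
  by rewrite /delta0 /mono subr_eq0; case: eqP.
case: ifP => [k0|k0].
  rewrite (@shift_act_widen _ _ (maxn (size p) `|k|.+1)) ?leq_maxl //.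
  have kN : (`|k| < maxn (size p) `|k|.+1)%N by rewrite leq_max ltnSn orbT.
  rewrite (bigD1 (Ordinal kN)) //= big1 ?addr0 => [|i]; last first.
    rewrite E -val_eqE /= => ik; case: eqP => [ki|]; rewrite ?scaler0 //.
    by case/eqP: ik; rewrite -[LHS]absz_nat -ki.
  by rewrite E gez0_abs // eqxx /GRing.scale /= mulr1.
rewrite /shift_act big1 // => i _; rewrite E; case: eqP => [ki|_]; last by rewrite scaler0.
by rewrite ki in k0.
Qed.

Lemma is_expansionP f a : is_expansion f a <-> is_laurent a /\ exists p d,
  [/\ d != 0, f = ratpoly p / ratpoly d & forall k, kact d a k = kact p delta0 k].
Proof.
by split=> -[La [p [d [d0 fE H]]]]; split=> //; exists p, d; split=> // k;
  move: (H k); rewrite kact_delta0.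
Qed.

Lemma kact_delta0_eq0 p : (forall k, kact p delta0 k = 0) -> p = 0.
Proof. by move=> H; apply/polyP=> i; have := H i%:Z; rewrite kact_delta0 coef0. Qed.

Lemma frac_eq p d p' d' : d != 0 -> d' != 0 ->
  ratpoly p / ratpoly d = ratpoly p' / ratpoly d' :> F <-> p * d' = p' * d.
Proof.
move=> d0 d0'; split=> [/eqP|H].
  rewrite eqr_div ?ratpoly_eq0 // -!ratpolyM => /eqP/ratpoly_inj->.
  by [].
by apply/eqP; rewrite eqr_div ?ratpoly_eq0 // -!ratpolyM H.
Qed.

(** Clearing denominators, two fractions with the same expansion give
    polynomials p d' and p' d with the same action on the series 1. *)
Lemma is_expansion_inj f g a : is_expansion f a -> is_expansion g a -> f = g.
Proof.
move=> /is_expansionP[La [p [d [d0 fE Ha]]]] /is_expansionP[Lb [p' [d' [d0' gE Hb]]]].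
rewrite fE gE; apply/frac_eq => //; apply/eqP; rewrite -subr_eq0; apply/eqP.
apply: kact_delta0_eq0 => k; rewrite -[_ - _]addrC -scaleN1r shift_act_comb.
rewrite [p' * d]mulrC [p * d']mulrC !shift_actM -(eq_shift_act _ Ha) -(eq_shift_act _ Hb) -!shift_actM.
by rewrite [d * d']mulrC scaleN1r addNr.
Qed.

Lemma is_expansion_comb (c : K) f g a b : is_expansion f a -> is_expansion g b ->
  is_expansion (c *: f + g) (fun k => c * a k + b k).
Proof.
move=> /is_expansionP[La [p [d [d0 fE Ha]]]] /is_expansionP[Lb [p' [d' [d0' gE Hb]]]].
apply/is_expansionP; split; first exact: (@is_laurent_comb K K^o).
exists (c *: p * d' + p' * d), (d * d'); split; first by rewrite mulf_neq0.
  rewrite fE gE ratscaleE mulrA -ratpolyM mul_polyC addf_div ?ratpoly_eq0 //.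
  by rewrite -!ratpolyM -ratpolyD.
move=> k; rewrite [LHS](@shift_act_combr K K^o) -scalerAl shift_act_comb.
congr (_ *: _ + _).
  by rewrite mulrC shift_actM (eq_shift_act _ Ha) -shift_actM mulrC.
by rewrite shift_actM (eq_shift_act _ Hb) -shift_actM mulrC.
Qed.

Lemma is_expansion_poly p : is_expansion (ratpoly p) (kact p delta0).
Proof.
apply/is_expansionP; split; first exact: is_laurent_shift_act delta0_laurent.
exists p, 1; split; rewrite ?oner_neq0 ?ratpoly1 ?divr1 // => k.
by rewrite -shift_actM mul1r.
Qed.

Lemma is_expansion0 : is_expansion (0 : F) (fun=> 0).
Proof.
have -> : (fun=> 0) = kact 0 delta0 by apply/funext=> k; rewrite shift_act0.
by rewrite -ratpoly0; apply: is_expansion_poly.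
Qed.

Lemma is_expansion_polymul p f a : is_expansion f a ->
  is_expansion (ratpoly p * f) (kact p a).
Proof.
move=> /is_expansionP[La [p' [d [d0 fE Ha]]]]; apply/is_expansionP; split.
  exact: (@is_laurent_shift_act K K^o).
exists (p * p'), d; split=> //; first by rewrite fE ratpolyM mulrA.
by move=> k; rewrite -shift_actM mulrC shift_actM (eq_shift_act _ Ha) -shift_actM.
Qed.

Lemma is_expansionZ (c : K) f a : is_expansion f a ->
  is_expansion (c *: f) (fun k => c * a k).
Proof.
move=> fa; have := is_expansion_comb c fa is_expansion0; rewrite addr0.
by congr is_expansion; apply/funext=> k; rewrite addr0.
Qed.

Lemma is_expansion_sum (I : Type) (s : seq I) (f : I -> F) (a : I -> int -> K) :
  (forall i, is_expansion (f i) (a i)) ->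
  is_expansion (\sum_(i <- s) f i) (fun k => \sum_(i <- s) a i k).
Proof.
move=> fa; elim: s => [|i s IHs].
  rewrite big_nil; have := is_expansion0; congr is_expansion.
  by apply/funext=> k; rewrite big_nil.
rewrite big_cons; have := is_expansion_comb 1 (fa i) IHs; rewrite scale1r.
by congr is_expansion; apply/funext=> k; rewrite big_cons mul1r.
Qed.

(** If d acting on a Laurent series a gives a finite sequence, multiplying by a
    power of X makes the result a polynomial, which exhibits a as a fraction.
    The denominator is recorded because it is a power of u when d = 1. *)
Lemma is_expansion_finite d a : d != 0 -> is_laurent a ->
  (exists k1, forall k, k1 < k -> kact d a k = 0) -> exists2 f, is_expansion f a &
  exists p m, f = ratpoly p / ratpoly ('X^m * d).
Proof.
move=> d0 La [k1 dak1]; have [k0 dak0] : is_laurent (kact d a) by apply: (@is_laurent_shift_act K K^o).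
pose m := `|k0|%N; pose p := \poly_(i < `|k1 + m%:Z|.+1) kact d a (i%:Z - m%:Z).
have Xmd0 : 'X^m * d != 0 by rewrite mulf_neq0 // expf_neq0 ?polyX_eq0.
exists (ratpoly p / ratpoly ('X^m * d)); last by exists p, m.
apply/is_expansionP; split=> //; exists p, ('X^m * d); split=> // k.
rewrite shift_actXnM kact_delta0 coef_poly; case: ifPn => [k_ge0|]; last first.
  rewrite -ltNge => k_lt0; apply: dak0; rewrite ltrBlDr (lt_le_trans k_lt0) //.
  by rewrite -lerBlDl sub0r /m abszE ler_normr lexx orbT.
rewrite gez0_abs //; case: ltnP => // kk; apply: dak1.
rewrite ltrBrDr; apply: le_lt_trans (ler_norm _) _.
by rewrite -abszE -[k]gez0_abs // ltz_nat.
Qed.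

(** A nonzero polynomial is X^m q with q(0) != 0, and q / q(0) = 1 - e with e
    divisible by X, so that the geometric series in e converges coefficientwise.
    Its coefficient of degree k is read on the partial sum up to e^k. *)
Lemma invpoly_expansion d : d != 0 -> exists2 a, is_laurent a &
  forall k, kact d a k = delta0 k.
Proof.
move=> /poly_factorX[m [q [q0 ->]]].
pose e : {poly K} := 1 - (q`_0)^-1 *: q.
have e0 : e`_0 = 0 by rewrite coefB coefZ coef1 mulVf // subrr.
have eS k i : (i < k)%N -> (e ^+ k)`_i = 0.
  have /factor_theorem[e'] : root e 0 by rewrite /root horner_coef0 e0.
  rewrite polyC0 subr0 => ->; by rewrite exprMn coefMXn => ->.
pose s N : {poly K} := \sum_(j < N) e ^+ j.
have sE N i : (i < N)%N -> (s N)`_i = (s i.+1)`_i.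
  move=> iN; rewrite /s !coef_sum [RHS](big_ord_widen N (fun j : nat => (e ^+ j)`_i)) //.
  rewrite [RHS]big_mkcond /=; apply: eq_bigr => j _; case: ltnP => // ij.
  exact: eS.
have qE : q = q`_0 *: (1 - e).
  by rewrite subKr scalerA mulfV // scale1r.
pose b (k : int) : K := if 0 <= k then (q`_0)^-1 * (s `|k|.+1)`_`|k| else 0.
have Lb : is_laurent (b : int -> K^o) by exists 0 => k; rewrite /b leNgt => ->.
have qb k : kact q b k = delta0 k.
  have [k0|k0] := ltP k 0.
    rewrite (@shift_act_below _ _ _ _ 0) // /delta0 /mono ?lt_eqF // => j j0.
    by rewrite /b leNgt j0.
  rewrite -[k]gez0_abs //; move: `|k|%N => {k0}k.
  have sN : (q * ((q`_0)^-1 *: s k.+1))`_k = (k == 0%N)%:R.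
    rewrite {1}qE -scalerAl -scalerAr scalerA mulfV // scale1r /s.
    have -> : (1 - e) * \sum_(j < k.+1) e ^+ j = 1 - e ^+ k.+1.
      by rewrite -[RHS]opprB subrX1 -mulNr [in RHS]opprB.
    by rewrite coefB coef1 eS // subr0.
  transitivity ((q * ((q`_0)^-1 *: s k.+1))`_k); last first.
    by rewrite sN /delta0 /mono; case: k {sN}.
  pose N := maxn (size q) k.+1; have kN : (k < N)%N by rewrite leq_max leqnn orbT.
  rewrite coefM (big_ord_widen N
    (fun i : nat => q`_i * ((q`_0)^-1 *: s k.+1)`_(k - i)) kN) big_mkcond.
  rewrite (@shift_act_widen _ _ N) ?leq_maxl //; apply: eq_bigr => i _.
  rewrite ltnS /b subr_ge0 lez_nat; case: leqP => ik; last by rewrite scaler0.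
  by rewrite subzn // absz_nat coefZ [in RHS]sE // ltnS leq_subr.
exists (fun k => b (k + m%:Z)).
  by case: Lb => k0 b0; exists (k0 - m%:Z) => k; rewrite ltrBrDr => /b0.
move=> k; rewrite shift_actXnM -qb; apply: eq_bigr => i _.
by rewrite addrAC subrK.
Qed.

Lemma is_expansion_exists f : exists a, is_expansion f a.
Proof.
have [p [d [d0 fE]]] := ratfunP f; have [a La da] := invpoly_expansion d0.
exists (kact p a); apply/is_expansionP; split; first exact: (@is_laurent_shift_act K K^o).
exists p, d; split=> // k; rewrite -shift_actM mulrC shift_actM; exact: eq_shift_act.
Qed.

(** Rationality criterion used for the generators x: only the tail of the series
    matters, so it suffices that it agrees from some rank on with a recurrent
    sequence. *)
Lemma is_expansion_recurrent d (b a : int -> K) k1 : d != 0 ->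
  (forall k, kact d b k = 0) -> is_laurent a -> (forall k, k1 < k -> a k = b k) ->
  exists f, is_expansion f a.
Proof.
move=> d0 db La ab; suff : exists2 f, is_expansion f a &
  exists p m, f = ratpoly p / ratpoly ('X^m * d) by case=> f; exists f.
apply: is_expansion_finite => //; exists (k1 + (size d)%:Z) => k kk.
rewrite -[RHS](db k); apply: eq_bigr => i _; rewrite ab // ltrBrDr.
by apply: lt_trans kk; rewrite ltrD2l ltz_nat.
Qed.

(** A Laurent polynomial has no pole at u = 1; this is what makes the Cartan
    part preserve the extension of V1 (x) V2 to A. *)
Lemma is_expansion_laurentpoly (a : int -> K) k1 : is_laurent a ->
  (forall k, k1 < k -> a k = 0) -> exists2 f, is_expansion f a & in_A f.
Proof.
move=> La a0; have [|f fa [p [m fE]]] := is_expansion_finite (oner_neq0 _) La.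
  by exists k1 => k /a0 ak; rewrite -[1]/(1%:P) shift_actC scale1r.
exists f => //; exists p, 1, m, 0%N; rewrite hornerC oner_neq0 fE mulr1.
by rewrite ratpoly1 expr0 !divr1 ratpolyXn.
Qed.

End RationalFunctions.

(** * Products of Laurent series *)

Section Convolution.
Context {W1 W2 W : zmodType} {op : W1 -> W2 -> W}.
Hypotheses (op0l : forall y, op 0 y = 0) (op0r : forall x, op x 0 = 0).
Implicit Types (a : int -> W1) (b : int -> W2).

(** The convolution is a sum over all integers, of finite support by the lower
    bounds k1 and k2; this replaces it by an ordinary finite sum, of any length
    N that is large enough. *)
Lemma convE a b k1 k2 k N :
  (forall j, j < k1 -> a j = 0) -> (forall j, j < k2 -> b j = 0) ->
  k - k1 - k2 < N%:Z ->
  conv op a b k = \sum_(j < N) op (a (k1 + j%:Z)) (b (k - k1 - j%:Z)).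
Proof.
move=> a0 b0 kN; rewrite /conv.
pose r := [seq k1 + j%:Z | j <- iota 0 N].
have uniqr : uniq r by rewrite map_inj_uniq ?iota_uniq // => i j /addrI[].
rewrite (@fsbigE _ _ _ _ _ r _ uniqr) //; last first.
  move=> j _ jr; have [/a0->//|k1j] := ltP j k1.
  have [/b0->//|k2j] := ltP (k - j) k2.
  case/negP: jr; apply/mapP; exists `|j - k1|%N; last first.
    by rewrite gez0_abs ?subr_ge0 // subrKC.
  rewrite mem_iota /= add0n -ltz_nat gez0_abs ?subr_ge0 //.
  apply: le_lt_trans kN; rewrite lerBrDr addrAC lerD2r.
  by rewrite -lerBrDl.
rewrite big_mkcond /= big_map -(big_mkord xpredT
  (fun j : nat => op (a (k1 + j%:Z)) (b (k - k1 - j%:Z)))) /index_iota subn0.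
by apply: eq_bigr => j _; rewrite in_setT opprD addrA.
Qed.

Lemma is_laurent_conv a b : is_laurent a -> is_laurent b -> is_laurent (conv op a b).
Proof.
move=> [k1 a0] [k2 b0]; exists (k1 + k2) => k kk.
by rewrite (@convE _ _ k1 k2 _ 0 a0 b0) ?big_ord0 // -addrA -opprD subr_lt0.
Qed.

End Convolution.

Lemma conv_map (W1 W2 W W2' W' : zmodType) (op : W1 -> W2 -> W) (op' : W1 -> W2' -> W')
    (f : W -> W') (f2 : W2 -> W2') a b k :
  (forall y, op 0 y = 0) -> (forall x, op x 0 = 0) ->
  (forall y, op' 0 y = 0) -> (forall x, op' x 0 = 0) ->
  (forall x y, f (op x y) = op' x (f2 y)) -> f2 0 = 0 ->
  f 0 = 0 -> {morph f : x y / x + y} -> is_laurent a -> is_laurent b ->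
  f (conv op a b k) = conv op' a (f2 \o b) k.
Proof.
move=> opl opr opl' opr' fop f20 f0 fD [k1 a0] [k2 b0].
pose N := (absz (k - k1 - k2)%R).+1.
have kN : k - k1 - k2 < N%:Z.
  by apply: le_lt_trans (ler_norm _) _; rewrite -abszE ltz_nat.
rewrite (convE opl opr a0 b0 kN) (convE (b := f2 \o b) (k2 := k2) opl' opr' a0 _ kN); last first.
  by move=> j /b0 /= ->.
by rewrite (big_morph f fD f0); apply: eq_bigr => j _; rewrite fop.
Qed.

(** Taking matrix entries turns a convolution of operators into sums of
    convolutions of scalar series, to which the multiplicativity of expansions
    applies. *)
Lemma conv_matrix (K : fieldType) (W1 W2 W : zmodType) (op : W1 -> W2 -> W)
    (f : W -> K) d (f1 : 'I_d -> W1 -> K) (f2 : 'I_d -> W2 -> K) a b k :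
  (forall y, op 0 y = 0) -> (forall x, op x 0 = 0) ->
  f 0 = 0 -> {morph f : x y / x + y} ->
  (forall l, f1 l 0 = 0) -> (forall l, f2 l 0 = 0) ->
  (forall x y, f (op x y) = \sum_l f1 l x * f2 l y) ->
  is_laurent a -> is_laurent b ->
  f (conv op a b k) = \sum_l conv *%R (f1 l \o a) (f2 l \o b) k.
Proof.
move=> opl opr f0 fD f10 f20 fop [k1 a0] [k2 b0].
pose N := (absz (k - k1 - k2)%R).+1.
have kN : k - k1 - k2 < N%:Z.
  by apply: le_lt_trans (ler_norm _) _; rewrite -abszE ltz_nat.
rewrite (convE opl opr a0 b0 kN) (big_morph f fD f0).
under eq_bigr do rewrite fop.
rewrite exchange_big; apply: eq_bigr => l _.
rewrite (@convE _ _ _ _ _ _ _ _ k1 k2 k N) // => [y|x|j /a0|j /b0] /=.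
- by rewrite mul0r.
- by rewrite mulr0.
- by move->.
- by move->.
Qed.

Section RationalProduct.
Variable K : fieldType.
Local Notation F := (ratfun K).
Local Notation kact := (@shift_act K K^o).
Local Notation kconv := (@conv K K K *%R).
Implicit Types (p d : {poly K}) (f g : F) (a b : int -> K).

(** The action of polynomials is linear over the product of series;
    multiplicativity of expansions follows by acting with both denominators. *)
Lemma kact_convr p a b k : is_laurent a -> is_laurent b ->
  kact p (kconv a b) k = kconv a (kact p b) k.
Proof.
move=> La Lb; have Lpb : is_laurent (kact p b) by apply: (@is_laurent_shift_act K K^o).
have m0l := @mul0r K; have m0r := @mulr0 K.
have [k1 [a0 [k2 b0]]] : exists k1, (forall j, j < k1 -> a j = 0) /\
    exists k2, forall j, j < k2 -> b j = 0.
  by case: La Lb => k1 a0 [k2 b0]; exists k1; split=> //; exists k2.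
have pb0 j : j < k2 -> kact p b j = 0 by apply: (@shift_act_below K K^o).
pose N := (absz (k - k1 - k2)%R).+1.
have kN : k - k1 - k2 < N%:Z.
  by apply: le_lt_trans (ler_norm _) _; rewrite -abszE ltz_nat.
rewrite (convE m0l m0r a0 pb0 kN) /shift_act.
transitivity (\sum_(i < size p) \sum_(j < N)
    p`_i * (a (k1 + j%:Z) * b (k - i%:Z - k1 - j%:Z))).
  apply: eq_bigr => i _; rewrite (convE m0l m0r a0 b0 (N := N)) ?[LHS]mulr_sumr //.
  apply: le_lt_trans kN; rewrite !lerD2r gerDl oppr_le0 //.
rewrite exchange_big; apply: eq_bigr => j _ /=; rewrite mulr_sumr.
by apply: eq_bigr => i _; rewrite mulrCA; congr (_ * (_ * b _)); rewrite [k - _ - k1]addrAC [RHS]addrAC.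
Qed.

Lemma kconvC a b : kconv a b = kconv b a.
Proof.
apply/funext=> k; rewrite /conv (@reindex_fsbigT _ _ _ _ _ (fun i : int => k - i)) //=.
  by apply: eq_fsbigr => i _; rewrite subKr mulrC.
by exists (fun i => k - i) => i; rewrite subKr.
Qed.

Lemma kconv_delta0 k : kconv (@delta0 K) (@delta0 K) k = @delta0 K k.
Proof.
have d0 (j : int) : j < 0 -> @delta0 K j = 0 by move=> j0; rewrite /delta0 /mono lt_eqF.
pose N := (absz (k - 0 - 0)%R).+1.
have kN : k - 0 - 0 < N%:Z.
  by apply: le_lt_trans (ler_norm _) _; rewrite -abszE ltz_nat.
rewrite (convE (@mul0r K) (@mulr0 K) d0 d0 kN) big_ord_recl big1 => [|i _].
  rewrite addr0 /=; have -> : k - 0 - Posz 0 = k by rewrite !subr0.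
  by rewrite /delta0 {1}/mono /= mul1r.
by rewrite /delta0 {1}/mono add0r /= mul0r.
Qed.

Lemma is_expansion_mul f g a b : is_expansion f a -> is_expansion g b ->
  is_expansion (f * g) (kconv a b).
Proof.
move=> /is_expansionP[La [p [d [d0 fE Ha]]]] /is_expansionP[Lb [p' [d' [d0' gE Hb]]]].
have Ld : is_laurent (@delta0 K : int -> K) := delta0_laurent K.
apply/is_expansionP; split; first exact: (is_laurent_conv (@mul0r K) (@mulr0 K) La Lb).
exists (p * p'), (d * d'); split; first by rewrite mulf_neq0.
  by rewrite fE gE mulf_div !ratpolyM.
have Ha' : kact d a = kact p (@delta0 K) by apply/funext.
have Hb' : kact d' b = kact p' (@delta0 K) by apply/funext.
have E1 : kact d' (kconv a b) = kact p' (kconv a (@delta0 K)).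
  by apply/funext=> k; rewrite !kact_convr // Hb'.
have E2 : kact d (kconv (@delta0 K) a) = kact p (kconv (@delta0 K) (@delta0 K)).
  by apply/funext=> k; rewrite !kact_convr // Ha'.
move=> k; rewrite shift_actM E1 -shift_actM mulrC shift_actM kconvC E2 -shift_actM mulrC.
by apply: eq_shift_act => j; exact: kconv_delta0.
Qed.

End RationalProduct.

(** * Linear maps and tensor products *)

Section LinearFunctions.
Context {K : comNzRingType} {V W : lmodType K} {f : V -> W}.
Hypothesis fL : linear f.

Lemma lin0 : f 0 = 0.
Proof. by have := fL (-1) 0 0; rewrite addr0 scaler0 scaleN1r addNr. Qed.
Lemma linD : {morph f : u v / u + v}.
Proof. by move=> u v; have := fL 1 u v; rewrite !scale1r. Qed.
Lemma linZ a : {morph f : u / a *: u}.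
Proof. by move=> u; have := fL a u 0; rewrite lin0 !addr0. Qed.
Lemma linB : {morph f : u v / u - v}.
Proof. by move=> u v; rewrite -scaleN1r linD linZ scaleN1r. Qed.
Lemma lin_sum (I : Type) (s : seq I) (g : I -> V) :
  f (\sum_(i <- s) g i) = \sum_(i <- s) f (g i).
Proof. exact: (big_morph f linD lin0). Qed.
Lemma lin_comb N (c : 'I_N -> K) (g : 'I_N -> V) :
  f (\sum_i c i *: g i) = \sum_i c i *: f (g i).
Proof. by rewrite lin_sum; apply: eq_bigr => i _; rewrite linZ. Qed.
Lemma lin_shift_act p (a : int -> V) k : f (shift_act p a k) = shift_act p (f \o a) k.
Proof. by rewrite /shift_act lin_comb. Qed.
End LinearFunctions.

Section TensorLemmas.
Context {K : comNzRingType}.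
Implicit Types V W X : lmodType K.

(** Every tensor is a sum of pure tensors. *)
Lemma tens_linear_ext V W X (f g : tens V W -> X) : linear f -> linear g ->
  (forall v w, f (tens_in v w) = g (tens_in v w)) -> f =1 g.
Proof.
by move=> fL gL fg t; rewrite [t]tens_sum (lin_sum fL) (lin_sum gL); apply: eq_bigr.
Qed.

Lemma tens_inDl V W (v v' : V) (w : W) : tens_in (v + v') w = tens_in v w + tens_in v' w.
Proof. by have := (@tens_in_bilin _ V W).1 w 1 v v'; rewrite !scale1r. Qed.
Lemma tens_inDr V W (v : V) (w w' : W) : tens_in v (w + w') = tens_in v w + tens_in v w'.
Proof. by have := (@tens_in_bilin _ V W).2 v 1 w w'; rewrite !scale1r. Qed.
Lemma tens_in0l V W (w : W) : tens_in (0 : V) w = 0.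
Proof. exact: (lin0 ((@tens_in_bilin _ V W).1 w)). Qed.
Lemma tens_in0r V W (v : V) : tens_in v (0 : W) = 0.
Proof. exact: (lin0 ((@tens_in_bilin _ V W).2 v)). Qed.
Lemma tens_inZl V W a (v : V) (w : W) : tens_in (a *: v) w = a *: tens_in v w.
Proof. exact: (linZ ((@tens_in_bilin _ V W).1 w)). Qed.
Lemma tens_inZr V W a (v : V) (w : W) : tens_in v (a *: w) = a *: tens_in v w.
Proof. exact: (linZ ((@tens_in_bilin _ V W).2 v)). Qed.
Lemma tens_in_suml V W (I : Type) (s : seq I) (v : I -> V) (w : W) :
  tens_in (\sum_(i <- s) v i) w = \sum_(i <- s) tens_in (v i) w.
Proof. exact: (lin_sum ((@tens_in_bilin _ V W).1 w)). Qed.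
Lemma tens_in_sumr V W (I : Type) (s : seq I) (v : V) (w : I -> W) :
  tens_in v (\sum_(i <- s) w i) = \sum_(i <- s) tens_in v (w i).
Proof. exact: (lin_sum ((@tens_in_bilin _ V W).2 v)). Qed.

Lemma tens_map_bilin V V' W W' (f : V -> V') (g : W -> W') : linear f -> linear g ->
  bilin (fun v w => tens_in (f v) (g w)).
Proof.
move=> fL gL; split=> [w|v] a u u'.
  by rewrite fL tens_inDl tens_inZl.
by rewrite gL tens_inDr tens_inZr.
Qed.

Lemma tens_map_in V V' W W' (f : V -> V') (g : W -> W') v w : linear f -> linear g ->
  tens_map f g (tens_in v w) = tens_in (f v) (g w).
Proof. by move=> fL gL; rewrite /tens_map tens_lift_in //; exact: tens_map_bilin. Qed.

Lemma tens_map_linear V V' W W' (f : V -> V') (g : W -> W') : linear f -> linear g ->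
  linear (tens_map f g).
Proof. by move=> fL gL; apply/tens_lift_linear/tens_map_bilin. Qed.

Lemma id_linear V : linear (@id V). Proof. by []. Qed.
Lemma comp_linear V W X (f : W -> X) (g : V -> W) :
  linear f -> linear g -> linear (f \o g).
Proof. by move=> fL gL a u v /=; rewrite gL fL. Qed.

Lemma tens_map_id V W : tens_map (@id V) (@id W) =1 id.
Proof.
apply: tens_linear_ext => [||v w]; rewrite ?tens_map_in //.
exact: tens_map_linear.
Qed.

Lemma tens_map_comp V V' V'' W W' W'' (f' : V' -> V'') (g' : W' -> W'')
    (f : V -> V') (g : W -> W') : linear f -> linear g -> linear f' -> linear g' ->
  tens_map (f' \o f) (g' \o g) =1 tens_map f' g' \o tens_map f g.
Proof.
move=> fL gL fL' gL'; apply: tens_linear_ext => [||v w].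
- by apply: tens_map_linear; apply: comp_linear.
- by apply: comp_linear; apply: tens_map_linear.
- by rewrite /= !tens_map_in //; apply: comp_linear.
Qed.

Lemma mull_linear (A : algType K) (a : A) : linear ( *%R a).
Proof. by move=> c u v; rewrite mulrDr scalerAr. Qed.

Lemma mulr_linear (A : algType K) (b : A) : linear ( *%R^~ b).
Proof. by move=> z u v; rewrite mulrDl scalerAl. Qed.

Lemma scale_sub_linear V W (f g : V -> W) c :
  linear f -> linear g -> linear (fun v => c *: (f v - g v)).
Proof.
move=> fL gL z u v; rewrite fL gL opprD addrACA -scalerBr scalerDr.
by congr (_ + _); rewrite !scalerA mulrC.
Qed.

Section TensorProductAlgebra.
Variables A B : algType K.
Local Notation AB := (tens A B).

Lemma tens_mul_bilin (t : AB) : bilin (fun (a : A) (b : B) => tens_map ( *%R a) ( *%R b) t).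
Proof.
have L := @mull_linear A; have L' := @mull_linear B.
split=> [b|a] z u v; rewrite [t]tens_sum !(lin_sum (tens_map_linear (L _) (L' _)));
  rewrite scaler_sumr -big_split; apply: eq_bigr => p _; rewrite !tens_map_in //.
  by rewrite mulr_linear tens_inDl tens_inZl.
by rewrite mulr_linear tens_inDr tens_inZr.
Qed.

Lemma tens_mul_linearl (t : AB) : linear (fun s => tens_mul s t).
Proof. exact/tens_lift_linear/tens_mul_bilin. Qed.

Lemma tens_mul_in a b (t : AB) : tens_mul (tens_in a b) t = tens_map ( *%R a) ( *%R b) t.
Proof. exact/tens_lift_in/tens_mul_bilin. Qed.

Lemma tens_mul_linear (s : AB) : linear (tens_mul s).
Proof.
move=> z u v; rewrite [s]tens_sum !(lin_sum (tens_mul_linearl _)).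
rewrite scaler_sumr -big_split; apply: eq_bigr => p _ /=.
by rewrite !tens_mul_in; apply: tens_map_linear; apply: mull_linear.
Qed.

Lemma tens_mul_pure (a a' : A) (b b' : B) :
  tens_mul (tens_in a b) (tens_in a' b') = tens_in (a * a') (b * b').
Proof. by rewrite tens_mul_in tens_map_in //; apply: mull_linear. Qed.
End TensorProductAlgebra.

End TensorLemmas.

Section RatScale.
Context {K : fieldType} {W : lmodType K}.
Local Notation F := (ratfun K).
Implicit Types (f g : F) (m : tens W F).

Lemma ratscale_linear f : linear (@ratscale K W f).
Proof. by apply: tens_map_linear => //; apply: mull_linear. Qed.
Lemma ratscale_in f w g : ratscale f (tens_in w g) = tens_in w (f * g) :> tens W F.
Proof. by apply: tens_map_in => //; apply: mull_linear. Qed.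
Lemma ratscaleZ a m : ratscale (ratpoly a%:P) m = a *: m.
Proof.
rewrite [in LHS](tens_sum m) [in RHS](tens_sum m) (lin_sum (ratscale_linear _)) scaler_sumr.
by apply: eq_bigr => p _; rewrite ratscale_in -ratscaleE tens_inZr.
Qed.
End RatScale.

(** * The local ring A of the point u = 1 *)

Section LocalRing.
Context {K : fieldType}.
Local Notation F := (ratfun K).
Implicit Types (f g : F).

Lemma in_AP f : in_A f <-> exists p d : {poly K}, d.[1] != 0 /\ f = ratpoly p / ratpoly d.
Proof.
split=> [[p [d [k [l [d1 ->]]]]]|[p [d [d1 ->]]]]; last first.
  by exists p, d, 0%N, 0%N; rewrite !expr0 !divr1.
exists (p * 'X^l), ('X^k * d).
rewrite hornerM hornerXn expr1n mul1r; split=> //.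
by rewrite -!ratpolyXn invf_div mulf_div !ratpolyM.
Qed.

Lemma in_A_comb f g h : in_A f -> in_A g -> in_A h -> in_A (f * g + h).
Proof.
move=> /in_AP[p [d [d1 ->]]] /in_AP[p' [d' [d1' ->]]] /in_AP[p'' [d'' [d1'' ->]]].
have H (e : {poly K}) : e.[1] != 0 -> ratpoly e != 0 :> F.
  by rewrite ratpoly_eq0; apply: contraNneq => ->; rewrite horner0.
apply/in_AP; exists (p * p' * d'' + p'' * (d * d')), (d * d' * d''); split.
  by rewrite !hornerM !mulf_neq0.
by rewrite mulf_div addf_div ?mulf_neq0 ?H // -!ratpolyM -ratpolyD.
Qed.

Lemma in_A_poly (p : {poly K}) : in_A (ratpoly p).
Proof. by apply/in_AP; exists p, 1; rewrite hornerC oner_neq0 ratpoly1 divr1. Qed.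
Lemma in_A0 : @in_A K 0. Proof. by rewrite -ratpoly0; apply: in_A_poly. Qed.
Lemma in_A1 : @in_A K 1. Proof. by rewrite -ratpoly1; apply: in_A_poly. Qed.
Lemma in_AM f g : in_A f -> in_A g -> in_A (f * g).
Proof. by move=> Af Ag; rewrite -[_ * _]addr0; apply: in_A_comb => //; apply: in_A0. Qed.
Lemma in_AD f g : in_A f -> in_A g -> in_A (f + g).
Proof. by move=> Af Ag; rewrite -[f]mulr1; apply: in_A_comb => //; apply: in_A1. Qed.
Lemma in_A_sum (I : Type) (s : seq I) (P : pred I) (f : I -> F) :
  (forall i, in_A (f i)) -> in_A (\sum_(i <- s | P i) f i).
Proof. by move=> Af; elim/big_ind: _ => //; [exact: in_A0|move=> *; exact: in_AD]. Qed.

Lemma in_A_polyV (d : {poly K}) : d.[1] != 0 -> in_A (ratpoly d)^-1.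
Proof. by move=> d1; apply/in_AP; exists 1, d; rewrite ratpoly1 div1r. Qed.

(** A has residue field K at u = 1. Hence an A-module generated by finitely many
    elements is spanned over K by their classes modulo u - 1. *)
Lemma in_A_residue f : in_A f -> exists (c : K) g,
  in_A g /\ f = ratpoly c%:P + (ratu K - 1) * g.
Proof.
move=> /in_AP[p [d [d1 ->]]]; pose c := p.[1] / d.[1]; exists c.
have /factor_theorem[r rE] : root (p - c *: d) 1.
  by rewrite /root hornerD hornerN hornerZ -mulrA mulVf // mulr1 subrr.
exists (ratpoly r / ratpoly d); split; first by apply/in_AP; exists r, d.
have d0 : ratpoly d != 0 :> F.
  by rewrite ratpoly_eq0; apply: contraNneq d1 => ->; rewrite horner0.
apply: (mulIf d0); rewrite mulrDl -[X in _ + X]mulrA !divfK // -ratpoly1 -ratpolyB -!ratpolyM -ratpolyD.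
by congr ratpoly; rewrite mul_polyC mulrC -polyC1 -rE addrC subrK.
Qed.
End LocalRing.

(** * Coordinates *)

Section Basis.
Context {K : fieldType} {W : lmodType K}.

(** A basis e together with its coordinate functions c. The functions are kept
    as data so that series with values in W can be studied coordinatewise. *)
Record coordinates d (e : 'I_d -> W) (c : W -> 'I_d -> K) : Prop := Coordinates {
  coordinates_linear : forall i, linear (fun w => c w i : K^o);
  coordinates_sum : forall w, w = \sum_i c w i *: e i;
  coordinates_basis : forall i j, c (e j) i = (i == j)%:R
}.

Definition combination d (e : 'I_d -> W) (w : W) : Prop :=
  exists c : 'I_d -> K, w = \sum_i c i *: e i.

Lemma combination_comb d (e : 'I_d -> W) a w w' :
  combination e w -> combination e w' -> combination e (a *: w + w').
Proof.
move=> [c ->] [c' ->]; exists (fun i => a * c i + c' i).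
rewrite scaler_sumr -big_split; apply: eq_bigr => i _ /=.
by rewrite scalerDl scalerA.
Qed.

Lemma combination0 d (e : 'I_d -> W) : combination e 0.
Proof. by exists (fun=> 0); rewrite big1 // => i _; rewrite scale0r. Qed.

Lemma combination_sum d (e : 'I_d -> W) N (a : 'I_N -> K) (w : 'I_N -> W) :
  (forall i, a i != 0 -> combination e (w i)) -> combination e (\sum_i a i *: w i).
Proof.
move=> ew; elim/big_ind: _ => [|w1 w2 h1 h2|i _].
- exact: combination0.
- by rewrite -[w1]scale1r; apply: combination_comb.
have [->|ai] := eqVneq (a i) 0; first by rewrite scale0r; apply: combination0.
by rewrite -[_ *: _]addr0; apply: combination_comb (ew _ ai) (combination0 _).
Qed.

Lemma combination_gen d (e : 'I_d -> W) i : combination e (e i).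
Proof.
exists (fun j => (j == i)%:R); rewrite (bigD1 i) //= eqxx scale1r big1 ?addr0 // => j /negPf->.
by rewrite scale0r.
Qed.

(** A spanning family of minimal size, among those with property P, is free:
    from a linear relation one vector could be removed. *)
Lemma basis_exists (P : W -> Prop) (s : seq W) : (forall v, v \in s -> P v) ->
  (forall w, w \in linspan (fun v => v \in s)) ->
  exists d (e : 'I_d -> W) c, coordinates e c /\ forall i, P (e i).
Proof.
move=> sP sW; pose Q d := `[< exists e : 'I_d -> W, (forall i, P (e i)) /\
  forall w, combination e w >].
have exQ : exists d, Q d.
  exists (size s); apply/asboolP; exists (fun i => s`_i); split.
    by move=> i; apply/sP/mem_nth.
  move=> w; have /asboolP[l [a [v [vs ->]]]] := sW w.
  apply: combination_sum => i _; have := vs i; rewrite -index_mem => lt.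
  by rewrite -(nth_index 0 (vs i)); apply: (combination_gen (fun i => s`_i) (Ordinal lt)).
case: (ex_minnP exQ) => d /asboolP[e [eP eW]] dmin.
have indep (a : 'I_d -> K) : \sum_i a i *: e i = 0 -> forall i, a i = 0.
  move=> a0 j; apply/eqP; apply: contraT => aj.
  case: d => [|d] in e eP eW dmin a a0 j aj *; first by case: j {aj}.
  have /dmin : Q d; last by rewrite ltnn.
  apply/asboolP; exists (e \o lift j); split=> [i|w]; first exact: eP.
  have ee i : combination (e \o lift j) (e i).
    have [->|] := eqVneq i j; last first.
      rewrite eq_sym => ji; have [i' -> _] := unlift_some ji.
      exact: (combination_gen (e \o lift j)).
    have -> : e j = \sum_(i < d) (- (a j)^-1 * a (lift j i)) *: e (lift j i).
      apply: (scalerI aj); rewrite scaler_sumr.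
      move/eqP: a0; rewrite (bigD1_ord j) //= addr_eq0 => /eqP->; rewrite -sumrN.
      by apply: eq_bigr => i' _; rewrite scalerA mulrA mulrN mulfV // mulN1r scaleNr.
    by apply: combination_sum => i' _; apply: (combination_gen (e \o lift j)).
  by have [b ->] := eW w; apply: combination_sum => i _; apply: ee.
have [c cE] := choice eW.
exists d, e, c; split=> //; split=> //.
- move=> i a u v; apply/eqP; rewrite -subr_eq0; apply/eqP.
  apply: (indep (fun i => c (a *: u + v) i - (a * c u i + c v i))).
  under eq_bigr do rewrite scalerBl scalerDl -scalerA.
  by rewrite sumrB big_split -scaler_sumr -!cE subrr.
- move=> i j; apply/eqP; rewrite -subr_eq0; apply/eqP.
  apply: (indep (fun i => c (e j) i - (i == j)%:R)).
  under eq_bigr do rewrite scalerBl.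
  rewrite sumrB -cE (bigD1 j) //= eqxx scale1r big1 ?addr0 ?subrr // => k /negPf->.
  by rewrite scale0r.
Qed.
End Basis.

Section TensorCoordinates.
Context {K : fieldType} {W : lmodType K} {d : nat} {e : 'I_d -> W} {c : W -> 'I_d -> K}.
Hypothesis ec : coordinates e c.
Local Notation F := (ratfun K).

(** Coordinates identify W (x) K(u) with column vectors over K(u). *)
Definition tcoord (m : tens W F) : 'cV[F]_d :=
  \col_i tens_lift (fun w (f : F) => c w i *: f) m.

Lemma tcoord_bilin i : bilin (fun w (f : F) => c w i *: f).
Proof.
split=> [f|w] a u v; last by rewrite scalerDr !scalerA mulrC.
by rewrite (coordinates_linear ec) scalerDl scalerA.
Qed.

Lemma tcoord_in w f : tcoord (tens_in w f) = \col_i (c w i *: f).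
Proof. by apply/colP=> i; rewrite !mxE tens_lift_in //; exact: tcoord_bilin. Qed.

Lemma tcoord_entry_linear i : linear (fun m => tcoord m i 0).
Proof. by move=> a u v; rewrite !mxE; apply: tens_lift_linear; exact: tcoord_bilin. Qed.

Lemma tcoordD m m' : tcoord (m + m') = tcoord m + tcoord m'.
Proof. by apply/colP=> i; rewrite [RHS]mxE; apply: (linD (tcoord_entry_linear i)). Qed.

Lemma tcoord0 : tcoord 0 = 0.
Proof. by apply/colP=> i; rewrite [RHS]mxE; apply: (lin0 (tcoord_entry_linear i)). Qed.

Lemma tcoord_sumr (I : Type) (s : seq I) (m : I -> tens W F) :
  tcoord (\sum_(i <- s) m i) = \sum_(i <- s) tcoord (m i).
Proof. exact: (big_morph tcoord tcoordD tcoord0). Qed.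

Lemma tcoordZ f m : tcoord (ratscale f m) = f *: tcoord m.
Proof.
rewrite [m]tens_sum (lin_sum (ratscale_linear f)) !tcoord_sumr scaler_sumr.
apply: eq_bigr => p _; rewrite ratscale_in !tcoord_in.
by apply/colP=> i; rewrite !mxE scalerAr.
Qed.

Definition untcoord (v : 'cV[F]_d) : tens W F := \sum_i tens_in (e i) (v i 0).

Lemma untcoordK v : tcoord (untcoord v) = v.
Proof.
rewrite tcoord_sumr; apply/colP=> i; rewrite summxE (bigD1 i) //= tcoord_in mxE.
rewrite (coordinates_basis ec) eqxx scale1r big1 ?addr0 // => j ji.
by rewrite tcoord_in mxE (coordinates_basis ec) eq_sym (negPf ji) scale0r.
Qed.

Lemma tcoordK m : untcoord (tcoord m) = m.
Proof.
rewrite [m in RHS]tens_sum [m in LHS]tens_sum tcoord_sumr /untcoord.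
under eq_bigr do rewrite summxE tens_in_sumr.
rewrite exchange_big; apply: eq_bigr => p _ /=.
rewrite [in RHS](coordinates_sum ec p.1) tens_in_suml; apply: eq_bigr => i _.
by rewrite tcoord_in mxE tens_inZr tens_inZl.
Qed.

Lemma tcoord_inj : injective tcoord.
Proof. exact: can_inj tcoordK. Qed.

(** Expansions of tensors can be tested coordinatewise, so that the results on
    scalar series apply. *)
Lemma tens_expansionP m L : is_tens_expansion m L <->
  forall i, is_expansion (tcoord m i 0) (fun k => c (L k) i).
Proof.
split=> [[l [w [f [a [fa -> LE]]]]] i|H].
  rewrite tcoord_sumr summxE.
  have := is_expansion_sum (index_enum 'I_l) (fun j => is_expansionZ (c (w j) i) (fa j)).
  congr is_expansion.
    by apply: eq_bigr => j _; rewrite tcoord_in mxE.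
  apply/funext=> k; rewrite LE (lin_comb (coordinates_linear ec i)).
  by apply: eq_bigr => j _; rewrite mulrC.
exists d, e, (fun i => tcoord m i 0), (fun i k => c (L k) i); split=> //.
  by rewrite -[LHS]tcoordK.
by move=> k; rewrite -(coordinates_sum ec).
Qed.

Lemma tens_expansion_exists (m : tens W F) : exists L, is_tens_expansion m L.
Proof.
have /choice[a aE] i := is_expansion_exists (tcoord m i 0).
exists (fun k => \sum_i a i k *: e i); apply/tens_expansionP => i.
have := aE i; congr is_expansion; apply/funext => k.
rewrite (lin_comb (coordinates_linear ec i)) (bigD1 i) //= (coordinates_basis ec) eqxx.
rewrite big1 => [|j ji]; first by rewrite addr0 /GRing.scale /= mulr1.
by rewrite (coordinates_basis ec) eq_sym (negPf ji) scaler0.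
Qed.

Lemma tens_expansion_laurent (m : tens W F) L : is_tens_expansion m L -> is_laurent L.
Proof.
move=> /tens_expansionP mL; have /choice[k0 H] i : exists k0 : int, forall k, k < k0 -> c (L k) i = 0.
  by have [] := mL i.
pose k1 : int := - (\sum_i absz (k0 i))%N%:Z; exists k1 => k kk.
rewrite [L k](coordinates_sum ec) big1 // => i _; rewrite H ?scale0r //.
apply: lt_le_trans kk _; rewrite /k1 lerNl (bigD1 i) //= PoszD abszE.
by rewrite (le_trans (ler_norm _)) // normrN lerDl.
Qed.
End TensorCoordinates.

(** * Linear recurrences *)

Section Recurrence.
Context {K : fieldType}.

Lemma linear_dependence m N (v : 'I_m -> 'rV[K]_N) : (N < m)%N ->
  exists u : 'I_m -> K, (exists i, u i != 0) /\ \sum_i u i *: v i = 0.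
Proof.
move=> Nm; pose A := \matrix_i v i.
have : kermx A != 0.
  rewrite kermx_eq0 /row_free; apply: contraL Nm => /eqP <-.
  by rewrite -leqNgt rank_leq_col.
move=> /rowV0Pn[u /sub_kermxP uA u0]; exists (fun i => u 0 i); split.
  apply/existsP; apply: contraNT u0; rewrite negb_exists => /forallP u0.
  by apply/eqP/rowP=> i; rewrite mxE; apply/eqP; have := u0 i; rewrite negbK.
by move: uA; rewrite mulmx_sum_row; under eq_bigr do rewrite rowK.
Qed.

(** The shifts of tau in both directions are induced by operators D and D' that
    preserve the kernel of ev. The image of ev being finite-dimensional,
    finitely many terms of tau satisfy a linear relation there, and the shifts
    propagate it along the whole sequence. *)
Lemma recurrence_exists (E : lmodType K) d (ev : E -> 'M[K]_d) (D D' : E -> E)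
    (tau : int -> E) : linear ev -> linear D -> linear D' ->
  (forall t, ev t = 0 -> ev (D t) = 0) -> (forall t, ev t = 0 -> ev (D' t) = 0) ->
  (forall k, tau (k + 1) = D (tau k)) -> (forall k, tau (k - 1) = D' (tau k)) ->
  exists2 p : {poly K}, p`_0 != 0 & forall k, ev (shift_act p tau k) = 0.
Proof.
move=> evL DL DL' evD evD' tauD tauD'.
(* One more vector than the dimension of the matrix space forces a relation. *)
have [|u [[i0 ui0] u0]] := @linear_dependence (d * d).+1 (d * d)
  (fun i => mxvec (ev (tau (0 - i%:Z)))).
  by [].
pose p := \poly_(i < (d * d).+1) u (inord i).
have p_neq0 : p != 0.
  apply/eqP=> p0; have := coef_poly (d * d).+1 (fun i => u (inord i)) i0.
  by rewrite -/p p0 coef0 ltn_ord inord_val => /eqP; rewrite eq_sym (negPf ui0).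
have pk k : ev (shift_act p tau k) = 0.
  elim/int_ind: k => [|k IH|k IH].
  - apply: (can_inj mxvecK); rewrite linear0 -u0 (@shift_act_widen _ _ (d * d).+1).
      rewrite (lin_sum evL) linear_sum; apply: eq_bigr => i _ /=.
      by rewrite (linZ evL) linearZ /= coef_poly ltn_ord inord_val.
    exact: size_poly.
  - rewrite -addn1 PoszD; have -> : shift_act p tau (k%:Z + 1) = D (shift_act p tau k%:Z).
      by rewrite (lin_shift_act DL); apply: eq_bigr => i _; rewrite addrAC tauD.
    exact: evD.
  - rewrite -addn1 PoszD opprD; have -> : shift_act p tau (- k%:Z - 1) = D' (shift_act p tau (- k%:Z)).
      by rewrite (lin_shift_act DL'); apply: eq_bigr => i _; rewrite addrAC tauD'.
    exact: evD'.
have [m [q [q0 pE]]] := poly_factorX p_neq0; exists q => // k.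
by have := pk (k + m%:Z); rewrite pE shift_actXnM addrK.
Qed.

End Recurrence.

Section Window.
Context {F : fieldType} {X : lmodType F} (A : F -> Prop) (Z : X -> Prop).
Hypotheses (A_comb : forall f g h, A f -> A g -> A h -> A (f * g + h)) (A0 : A 0)
  (A1 : A (-1)) (Z0 : Z 0)
  (Z_comb : forall a x y, A a -> Z x -> Z y -> Z (a *: x + y)).

Lemma window_sum N (P : pred 'I_N) (a : 'I_N -> F) (x : 'I_N -> X) :
  (forall i, A (a i)) -> (forall i, P i -> Z (x i)) -> Z (\sum_(i | P i) a i *: x i).
Proof.
by move=> Aa Zx; elim/big_rec: _ => // i y Pi Zy; apply: Z_comb (Zx _ Pi) Zy.
Qed.

(** A recurrence whose first and last coefficients are units of A can be solved
    for its newest and for its oldest term, hence run in both directions from a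
    finite window. *)
Lemma recurrence_window (Q : {poly F}) (Y : int -> X) :
  (forall i, A Q`_i) -> Q`_0 != 0 -> A (Q`_0)^-1 -> A (lead_coef Q)^-1 ->
  (forall k, shift_act Q Y k = 0) ->
  (forall r : nat, (r <= size Q)%N -> Z (Y r%:Z)) -> forall r, Z (Y r).
Proof.
move=> AQ Q0 AQ0 AQl QY ZY.
have AN a : A a -> A (- a) by move=> Aa; rewrite -mulN1r -[_ * _]addr0; apply: A_comb.
have AM a b : A a -> A b -> A (a * b) by move=> Aa Ab; rewrite -[_ * _]addr0; apply: A_comb.
have [D DE] : exists D, size Q = D.+1.
  by exists (size Q).-1; rewrite prednK // size_poly_gt0; apply: contraNneq Q0 => ->; rewrite coef0.
have QD0 : lead_coef Q != 0 by rewrite lead_coef_eq0 -size_poly_eq0 DE.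
have up k : (forall i, (0 < i <= D)%N -> Z (Y (k - i%:Z))) -> Z (Y k).
  move=> Zi; have := QY k; rewrite /shift_act DE big_ord_recl /= => /eqP.
  rewrite addr_eq0 -[k - _]/(k - 0) subr0 => /eqP QYk.
  rewrite -[Y k](scalerK Q0) QYk -sumrN scaler_sumr.
  have -> : \sum_(i < D) (Q`_0)^-1 *: - (Q`_(bump 0 i) *: Y (k - (bump 0 i)%:Z)) =
     \sum_(i < D) (- ((Q`_0)^-1 * Q`_(bump 0 i))) *: Y (k - (bump 0 i)%:Z).
    by apply: eq_bigr => i _; rewrite scalerN scalerA scaleNr.
  by apply: window_sum => i; [apply/AN/AM|move=> _; apply: Zi; rewrite /bump /=].
have down k : (forall i, (i < D)%N -> Z (Y (k - i%:Z))) -> Z (Y (k - D%:Z)).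
  move=> Zi; have := QY k; rewrite /shift_act DE big_ord_recr /= => /eqP.
  rewrite addrC addr_eq0 => /eqP QYk.
  have lE : Q`_D = lead_coef Q by rewrite lead_coefE DE.
  rewrite lE in QYk; rewrite -[Y _](scalerK QD0) QYk -sumrN scaler_sumr.
  have -> : \sum_(i < D) (lead_coef Q)^-1 *: - (Q`_i *: Y (k - i%:Z)) =
     \sum_(i < D) (- ((lead_coef Q)^-1 * Q`_i)) *: Y (k - i%:Z).
    by apply: eq_bigr => i _; rewrite scalerN scalerA scaleNr.
  by apply: window_sum => i; [apply/AN/AM|move=> _; apply: Zi].
have win r : forall i : nat, (i <= D)%N -> Z (Y (r + i%:Z)).
  elim/int_ind: r => [i iD|r IH i iD|r IH i iD].
  - by rewrite add0r; apply: ZY; rewrite DE leqW.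
  - rewrite -addn1 PoszD -addrA -PoszD.
    have [iD'|] := ltnP i D; first by rewrite add1n; apply: IH.
    move=> Di; have {iD Di}-> : i = D by apply/eqP; rewrite eqn_leq iD.
    apply: up => j /andP[j0 jD]; rewrite PoszD -addrA subzn ?(leq_trans jD) ?leq_addl //.
    by apply: IH; rewrite leq_subLR leq_add2r.
  - case: i iD => [|i] iD; last first.
      have -> : - r.+1%:Z + i.+1%:Z = - r%:Z + i%:Z by lia.
      by apply: IH; apply: ltnW.
    have -> : - r.+1%:Z + 0%:Z = (- r.+1%:Z + D%:Z) - D%:Z by lia.
    apply: down => i iD'.
    have -> : - r.+1%:Z + D%:Z - i%:Z = - r%:Z + (D - i).-1%:Z by lia.
    by apply: IH; lia.
by move=> r; rewrite -[r]addr0; apply: win.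
Qed.
End Window.

Section Twist.
Context {K : fieldType}.
Local Notation F := (ratfun K).

(** The polynomial p (u^eps X): multiplying the r-th term of a sequence of
    series by u^(eps r) turns a recurrence of polynomial p into one of this
    polynomial. *)
Definition twist (p : {poly K}) (eps : nat) : {poly F} :=
  \poly_(i < size p) (ratpoly (p`_i *: 'X^(eps * i))).

Lemma coef_twist p eps i : (twist p eps)`_i = ratpoly (p`_i *: 'X^(eps * i)).
Proof.
rewrite coef_poly; case: ltnP => // ip.
by rewrite nth_default // scale0r ratpoly0.
Qed.

Lemma size_twist p eps : size (twist p eps) = size p.
Proof.
have [->|p0] := eqVneq p 0; first by rewrite /twist poly_def !size_poly0 big_ord0 size_poly0.
rewrite size_poly_eq // ratpoly_eq0 scaler_eq0 expf_eq0 polyX_eq0 andbF orbF.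
by rewrite -lead_coefE lead_coef_eq0.
Qed.

Lemma lead_coef_twist p eps :
  lead_coef (twist p eps) = ratpoly (lead_coef p *: 'X^(eps * (size p).-1)).
Proof. by rewrite lead_coefE size_twist coef_twist. Qed.

(** A recurrence in r between coefficients is a recurrence between rational
    functions, as expansions are injective; a shift of the exponent k by eps t
    amounts to the factor u^(eps t). *)
Lemma twist_kills (p : {poly K}) eps (f : int -> F^o) (a : int -> int -> K) :
  (forall r, is_expansion (f r) (a r)) ->
  (forall r k, \sum_(t < size p) p`_t * a (r - t%:Z) (k - (eps * t)%:Z) = 0) ->
  forall r, shift_act (twist p eps) f r = 0.
Proof.
move=> fa pa r; apply: is_expansion_inj (is_expansion0 K); rewrite /shift_act size_twist.
have := is_expansion_sum (index_enum 'I_(size p)) (fun t : 'I_(size p) =>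
  is_expansion_polymul (p`_t *: 'X^(eps * t)) (fa (r - t%:Z))).
congr is_expansion; first by apply: eq_bigr => t _; rewrite coef_twist.
apply/funext=> k; rewrite -[RHS](pa r k); apply: eq_bigr => t _.
by rewrite -[_ *: _]addr0 shift_act_comb shift_act0 addr0 shift_actXn.
Qed.
End Twist.

(** * The quantum parameter *)

Section QuantumParameter.
Context {K : fieldType} (qp : quantum_parameter K).
Local Notation q := (qpar qp).

Lemma qparX_eq1 (l : int) : q ^ l = 1 -> l = 0.
Proof.
move=> ql; have {ql} : q ^+ `|l|%N = 1.
  case: l ql => l //= /(congr1 GRing.inv).
  by rewrite NegzE -exprnN invrK invr1.
case E : `|l|%N => [|m] qm; first by apply/eqP; rewrite -absz_eq0 E.
by have := qpar_not_root qp (ltn0Sn m); rewrite qm eqxx.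
Qed.

Lemma qparX_inj : injective (exprz q).
Proof.
move=> l m lm; apply/eqP; rewrite -subr_eq0; apply/eqP/qparX_eq1.
by rewrite expfzDr ?qpar_neq0 // lm -expfzDr ?qpar_neq0 // subrr.
Qed.

Lemma qint_neq0 (l : int) : l != 0 -> qint q l != 0.
Proof.
move=> l0; rewrite /qint mulf_neq0 ?invr_eq0 // subr_eq0.
  apply: contraNneq l0 => /qparX_inj H; lia.
by apply/eqP => /(@qparX_inj 1 (-1)).
Qed.

Lemma qparB_neq0 : q - q^-1 != 0.
Proof. by rewrite subr_eq0; apply/eqP => /(@qparX_inj 1 (-1)). Qed.

Lemma qpow0 : qpow qp 0 = 1.
Proof.
have q0 : qpow qp 0 != 0.
  apply: contraTneq (qpar_neq0 qp) => q0.
  by rewrite -(qpow1 qp) -[1]addr0 qpowD q0 mulr0 eqxx.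
by apply: (mulfI q0); rewrite -qpowD addr0 mulr1.
Qed.

Lemma qpowMn s m : qpow qp (s *+ m) = qpow qp s ^+ m.
Proof.
by elim: m => [|m IH]; rewrite ?mulr0n ?qpow0 // mulrS qpowD IH exprS.
Qed.

(** Raising to the denominator of s reduces to the fact that q is not a root of
    unity. *)
Lemma qpow_eq1 s : qpow qp s = 1 -> s = 0.
Proof.
wlog s0 : s / 0 <= s => [H|].
  have [/H//|s0] := leP 0 s; move=> qs; apply/eqP; rewrite -oppr_eq0; apply/eqP/H.
    by rewrite oppr_ge0 ltW.
  by have := qpowD qp s (- s); rewrite subrr qpow0 qs mul1r.
move=> qs; have := qpowMn s `|denq s|; rewrite qs expr1n => H.
have : qpow qp 1 ^+ `|numq s| = 1.
  rewrite -qpowMn -H; congr (qpow qp _).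
  rewrite -[in RHS]mulr_natr pmulrn [in RHS]pmulrn !gez0_abs ?denq_ge0 ?numq_ge0 //.
  by rewrite numqE.
rewrite qpow1; case E : `|numq s|%N => [|m] qm.
  by apply/eqP; rewrite -numq_eq0 -absz_eq0 E.
by have := qpar_not_root qp (ltn0Sn m); rewrite qm eqxx.
Qed.

Lemma qpow_inj : injective (qpow qp).
Proof.
move=> s t st; apply/eqP; rewrite -subr_eq0; apply/eqP/qpow_eq1.
by rewrite qpowD st -qpowD subrr qpow0.
Qed.
End QuantumParameter.

(** * Generators and relations of the quantum affinization *)

Section Subalgebras.
Context {K : fieldType} {n : nat} {C : cartan_datum n} (h : realization C)
  (qp : quantum_parameter K).
Local Notation U := (qaff h qp).
Local Notation q := (qpar qp).
Local Notation x := (ux h qp).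
Local Notation k := (@uk K n C h qp).
Local Notation hh := (@uh K n C h qp).
Local Notation phi := (uphi h qp).

Record is_subalgebra (Z : U -> Prop) : Prop := IsSubalgebra {
  subalgebra_comb : forall c a b, Z a -> Z b -> Z (c *: a + b);
  subalgebra_mul : forall a b, Z a -> Z b -> Z (a * b);
  subalgebra1 : Z 1
}.

Section OneSubalgebra.
Variable Z : U -> Prop.
Hypothesis Zalg : is_subalgebra Z.

Lemma subalgebra0 : Z 0.
Proof.
by have := subalgebra_comb Zalg (-1) (subalgebra1 Zalg) (subalgebra1 Zalg);
  rewrite scaleN1r addNr.
Qed.
Lemma subalgebraZ c a : Z a -> Z (c *: a).
Proof.
by move=> Za; rewrite -[_ *: _]addr0; apply: (subalgebra_comb Zalg) => //; apply: subalgebra0.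
Qed.
Lemma subalgebraD a b : Z a -> Z b -> Z (a + b).
Proof. by move=> Za Zb; rewrite -[a]scale1r; apply: (subalgebra_comb Zalg). Qed.
Lemma subalgebra_sum (I : Type) (s : seq I) (P : pred I) (a : I -> U) :
  (forall i, P i -> Z (a i)) -> Z (\sum_(i <- s | P i) a i).
Proof. by move=> Za; elim/big_ind: _ => //; [exact: subalgebra0|exact: subalgebraD]. Qed.

Lemma qaff_generated : (forall g, Z (ugen qp g)) -> forall a, Z a.
Proof.
move=> Zg; elim/u_ind; elim=> [c|g|s IHs t IHt|s IHs t IHt].
- rewrite (_ : uclass _ _ = c%:A); first exact: subalgebraZ (subalgebra1 Zalg).
  by rewrite u_scalerE; apply/uclassP=> B w hw /=; rewrite scale1r mulr1.
- exact: Zg.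
- by rewrite -u_addrE; apply: subalgebraD.
- by rewrite -u_mulrE; apply: (subalgebra_mul Zalg).
Qed.

Lemma subalgebra_ps_pow (f : nat -> U) N : (forall j, (j < N)%N -> Z (f j)) ->
  forall l j, (j < N)%N -> Z (ps_pow f l j).
Proof.
move=> Zf; elim=> [|l IH] j jN; rewrite /ps_pow /=.
  by rewrite /ps_one; case: eqP => _; [exact: (subalgebra1 Zalg)|exact: subalgebra0].
apply: subalgebra_sum => i _; apply: (subalgebra_mul Zalg).
  by apply: Zf; apply: leq_ltn_trans jN; rewrite -ltnS.
by apply: IH; apply: leq_ltn_trans jN; rewrite leq_subr.
Qed.

Lemma subalgebra_ps_exp (f : nat -> U) : (forall j, Z (f j)) -> forall j, Z (ps_exp f j).
Proof.
move=> Zf j; apply: subalgebra_sum => l _; apply: subalgebraZ.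
by apply: (@subalgebra_ps_pow f j.+1).
Qed.

(** Up to the term of index 1 of the exponential, which is f_m, the coefficient
    of degree m of exp(f) involves the f_j with j < m only. *)
Lemma subalgebra_ps_log (f : nat -> U) : f 0%N = 0 ->
  (forall j, Z (ps_exp f j)) -> forall j, Z (f j).
Proof.
move=> f0 Ze; have pow0 l : ps_pow f l.+1 0 = 0.
  by rewrite /ps_pow /= /ps_mul big_ord_recl big_ord0 f0 mul0r addr0.
elim/ltn_ind=> -[|m] IH; first by rewrite f0; apply: subalgebra0.
have := Ze m.+1; rewrite /ps_exp big_ord_recl big_ord_recl.
set r := \sum_(_ < _) _.
have Zr : Z r.
  apply: subalgebra_sum => -[l lm] _; apply: subalgebraZ.
  rewrite -[ps_pow _ _ _]/(ps_mul f (ps_pow f l.+1) m.+1).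
  rewrite /ps_mul; apply: subalgebra_sum => -[[|i] im] _ /=.
    by rewrite f0 mul0r; apply: subalgebra0.
  have [im'|] := ltnP i m; last first.
    move=> mi; have -> : i = m by apply/eqP; rewrite eqn_leq mi andbT.
    by rewrite subnn -[ps_mul _ _ _]/(ps_pow f l.+1 0) pow0 mulr0; exact: subalgebra0.
  apply: (subalgebra_mul Zalg); first exact: IH.
  apply: (@subalgebra_ps_pow f m.+1 IH l.+1).
  by rewrite subSS ltnS leq_subr.
rewrite -[ps_pow _ ord0 _]/(0 : U) scaler0 add0r.
rewrite -[ps_pow _ _ _]/(ps_mul f (@ps_one K U) m.+1) -[X in X%:R]/1%N invr1 scale1r.
have -> : ps_mul f (@ps_one K U) m.+1 = f m.+1.
  rewrite /ps_mul big_ord_recr /= subnn mulr1 big1 ?add0r // => i _.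
  by rewrite /ps_one subn_eq0 leqNgt ltn_ord mulr0.
by move=> Zfr; rewrite -[f _](addrK r) -scaleN1r addrC; apply: (subalgebra_comb Zalg).
Qed.

Lemma subalgebra_phi : (forall a, Z (k a)) -> (forall i m, Z (hh i m)) ->
  forall e i m, Z (phi e i m).
Proof.
move=> Zk Zh e i m; rewrite /uphi /Defs.phi; case: ifP => _; last exact: subalgebra0.
apply: (subalgebra_mul Zalg) => //; apply: subalgebra_ps_exp => -[|j] /=.
  exact: subalgebra0.
exact: subalgebraZ.
Qed.

Lemma nzintE (m : nzint) : exists e j, m = signed_nz e j.
Proof.
case: m => -[[|j] m0 //|j m0].
  by exists true, j; apply: val_inj; rewrite /= mul1r.
by exists false, j; apply: val_inj; rewrite /= NegzE mulN1r.
Qed.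

(** The h_(i,m) are recovered from the phi_(i,m) by taking a logarithm; the
    coproduct is only known on the latter. *)
Lemma subalgebra_h : (forall a, Z (k a)) -> (forall e i m, Z (phi e i m)) ->
  forall i m, Z (hh i m).
Proof.
move=> Zk Zphi i m; have [e [j ->]] := nzintE m.
pose f : nat -> U := phi_log qp hh e i.
have Zf : Z (f j.+1).
  apply: subalgebra_ps_log => // {}j.
  pose a := ((sg e * (symm C i)%:Z)%:~R *: coroot h i).
  have := subalgebra_mul Zalg (Zk (- a)) (Zphi e i (sg e * j%:Z)).
  rewrite /uphi /Defs.phi mulrA ifT; last by case: e {f a}.
  rewrite mulrA -(rel_kD (qaffP h qp)) addNr (rel_k0 (qaffP h qp)) mul1r.
  by have -> : absz (sg e * j%:Z) = j by case: e {f a} => /=; lia.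
have c0 : (sg e)%:~R * (q - q^-1) != 0.
  by rewrite mulf_neq0 ?qparB_neq0 //; case: e {f Zf}; rewrite ?oppr_eq0 oner_eq0.
by rewrite -[hh _ _](scalerK c0); apply: subalgebraZ.
Qed.
End OneSubalgebra.

(** This relation and the next two let elements of the Cartan part, or an x^+,
    move past an x from the left. *)
Lemma uk_ux a e j r : k a * x e j r = qpow qp ((sg e)%:~R * Defs.root h j a) *: (x e j r * k a).
Proof.
have := rel_kx (qaffP h qp) a e j r; rewrite -/(x e j r) -!/(k _) => H.
rewrite scalerAl -H -!mulrA -(rel_kD (qaffP h qp)) addNr (rel_k0 (qaffP h qp)).
by rewrite mulr1.
Qed.

Lemma uh_ux i (m : nzint) e j r : hh i m * x e j r = x e j r * hh i m +
  ((sg e)%:~R * ((val m)%:~R)^-1 * qint q (val m * symB C i j)) *: x e j (val m + r).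
Proof. by have /eqP := rel_hx (qaffP h qp) i m e j r; rewrite subr_eq addrC => /eqP. Qed.

Lemma ux_commute i j r s : x true i r * x false j s = x false j s * x true i r +
  (if i == j then (qi C qp i - (qi C qp i)^-1)^-1 *: (phi true i (r + s) - phi false i (r + s))
   else 0).
Proof. by have /eqP := rel_xpm (qaffP h qp) i j r s; rewrite subr_eq addrC => /eqP. Qed.

Lemma qi_neq0 i : qi C qp i - (qi C qp i)^-1 != 0.
Proof.
rewrite subr_eq0 /qi; apply/eqP => H.
have /qparX_inj : q ^ (symm C i)%:Z = q ^ (- (symm C i)%:Z) by rewrite -exprnN.
have := symm_gt0 C i; lia.
Qed.

Lemma symB_diag_neq0 i : symB C i i != 0.
Proof. by rewrite /symB gcm_diag; have := symm_gt0 C i; lia. Qed.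

Lemma intr_sg_neq0 e : (sg e)%:~R != 0 :> K.
Proof. by case: e; rewrite ?oppr_eq0 oner_eq0. Qed.

(** The Cartan generator whose commutator with x_(i,r) is proportional to
    x_(i,r+1), or x_(i,r-1), with the factor that normalizes this commutator. *)
Definition ux_shift (e s : bool) (i : 'I_n) : nzint * K :=
  (signed_nz s 0, ((sg e)%:~R * ((sg s)%:~R)^-1 * qint q (sg s * symB C i i))^-1).

(** Scaled commutators: they shift the index of the x_(i,r) and produce the
    phi_(i,m), and they preserve two-sided ideals. *)
Definition ad (c : K) (a b : U) : U := c *: (a * b - b * a).

Lemma ad_linear c a : linear (ad c a).
Proof.
move=> z u v; rewrite /ad mulrDr mulrDl scalerA mulrC -scalerA -scalerDr; congr (_ *: _).
by rewrite scalerBr scalerAr scalerAl opprD addrACA.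
Qed.

Lemma ux_shiftE e s i r :
  ad (ux_shift e s i).2 (hh i (ux_shift e s i).1) (x e i r) = x e i (sg s + r).
Proof.
rewrite /ad uh_ux addrAC subrr add0r /= mulr1 scalerA mulVf ?scale1r //.
have s0 : sg s != 0 by case: s.
rewrite mulf_neq0 ?qint_neq0 ?(mulf_neq0 s0) ?symB_diag_neq0 //.
rewrite mulf_neq0 ?invr_eq0 /= ?mulr1 ?intr_sg_neq0 //.
Qed.

(** Being a commutator with a fixed x, phi_(i,s) inherits the recurrence of
    x_(i,s) in s, except for the value at s = 0. *)
Lemma phi_plus i s : 0 < s -> phi true i s =
  ad (qi C qp i - (qi C qp i)^-1) (x true i 0) (x false i s).
Proof.
move=> s0; rewrite /ad ux_commute eqxx addrAC subrr !add0r scalerA mulfV ?qi_neq0 // scale1r.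
by rewrite [phi false i s]/uphi /Defs.phi /= mulN1r oppr_ge0 leNgt s0 subr0.
Qed.

Lemma phi_minus i s : s < 0 -> phi false i s =
  ad (- (qi C qp i - (qi C qp i)^-1)) (x true i 0) (x false i s).
Proof.
move=> s0; rewrite /ad ux_commute eqxx addrAC subrr !add0r scalerA mulNr mulfV ?qi_neq0 //.
by rewrite [phi true i s]/uphi /Defs.phi /= mul1r leNgt s0 sub0r scaleN1r opprK.
Qed.
End Subalgebras.

(** * The action of U (x) U on V1 (x) V2 *)

Section TensorAction.
Context {K : fieldType} {n : nat} {C : cartan_datum n} {h : realization C}
  {qp : quantum_parameter K} {V1 V2 : prerep h qp}.
Hypotheses (rep1 : is_rep V1) (rep2 : is_rep V2).
Local Notation U := (qaff h qp).
Local Notation UU := (tens U U).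
Local Notation W := (tens V1 V2).
Local Notation act1 := (@rep_act _ _ _ _ _ V1).
Local Notation act2 := (@rep_act _ _ _ _ _ V2).

Lemma rep_act_linear (V : prerep h qp) a : is_rep V -> linear (@rep_act _ _ _ _ _ V a).
Proof. by case=> -[_]. Qed.
Lemma rep_act_linearl (V : prerep h qp) v : is_rep V -> linear (fun a => @rep_act _ _ _ _ _ V a v).
Proof. by case=> -[]. Qed.
Lemma rep_actM (V : prerep h qp) a b v : is_rep V ->
  @rep_act _ _ _ _ _ V (a * b) v = rep_act a (rep_act b v).
Proof. by case. Qed.
Lemma rep_act1 (V : prerep h qp) v : is_rep V -> @rep_act _ _ _ _ _ V 1 v = v.
Proof. by case. Qed.

Let L1 a := rep_act_linear a rep1.
Let L2 a := rep_act_linear a rep2.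

Lemma tens_act_bilin w : bilin (fun a b => tens_map (act1 a) (act2 b) w).
Proof.
split=> [b|a] z u v.
  rewrite [w]tens_sum !(lin_sum (tens_map_linear (L1 _) (L2 _))) scaler_sumr -big_split.
  apply: eq_bigr => p _; rewrite !tens_map_in //.
  by rewrite (rep_act_linearl _ rep1) tens_inDl tens_inZl.
rewrite [w]tens_sum !(lin_sum (tens_map_linear (L1 _) (L2 _))) scaler_sumr -big_split.
apply: eq_bigr => p _; rewrite !tens_map_in //.
by rewrite (rep_act_linearl _ rep2) tens_inDr tens_inZr.
Qed.

Lemma tens_act_linearl w : linear (fun t => @tens_act _ _ _ _ _ V1 V2 t w).
Proof. exact/tens_lift_linear/tens_act_bilin. Qed.

Lemma tens_act_in a b w : tens_act (tens_in a b) w = tens_map (act1 a) (act2 b) w.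
Proof. exact/tens_lift_in/tens_act_bilin. Qed.

Lemma tens_act_pure a b v1 v2 :
  tens_act (tens_in a b) (tens_in v1 v2) = tens_in (act1 a v1) (act2 b v2).
Proof. by rewrite tens_act_in tens_map_in. Qed.

Lemma tens_act_linear t : linear (@tens_act _ _ _ _ _ V1 V2 t).
Proof.
move=> z u v; rewrite [t]tens_sum !(lin_sum (tens_act_linearl _)).
rewrite scaler_sumr -big_split; apply: eq_bigr => p _ /=.
by rewrite !tens_act_in; apply: tens_map_linear.
Qed.

Lemma tens_act0 w : tens_act 0 w = 0 :> W. Proof. exact: (lin0 (tens_act_linearl w)). Qed.
Lemma tens_act0r t : tens_act t 0 = 0 :> W. Proof. exact: (lin0 (tens_act_linear t)). Qed.

Lemma tens_actM s t w : tens_act (tens_mul s t) w = tens_act s (tens_act t w) :> W.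
Proof.
apply: (tens_linear_ext (f := fun s => tens_act (tens_mul s t) w)
  (g := fun s => tens_act s (tens_act t w))).
- by apply: (comp_linear (f := fun s => tens_act s w)); [exact: tens_act_linearl|exact: tens_mul_linearl].
- exact: tens_act_linearl.
move=> a b; move: t; apply: (tens_linear_ext (f := fun t => tens_act (tens_mul (tens_in a b) t) w)
  (g := fun t => tens_act (tens_in a b) (tens_act t w))).
- by apply: (comp_linear (f := fun s => tens_act s w)); [exact: tens_act_linearl|exact: tens_mul_linear].
- by apply: (comp_linear (f := @tens_act _ _ _ _ _ V1 V2 _));
    [exact: tens_act_linear|exact: tens_act_linearl].
move=> a' b'; move: w; apply: tens_linear_ext.
- exact: tens_act_linear.
- by apply: (comp_linear (f := tens_act _)); exact: tens_act_linear.
by move=> v1 v2; rewrite tens_mul_pure !tens_act_pure !rep_actM.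
Qed.

Lemma tens_act1 w : tens_act (tens_in 1 1) w = w :> W.
Proof.
move: w; apply: tens_linear_ext; [exact: tens_act_linear|exact: id_linear|].
by move=> v1 v2; rewrite tens_act_pure !rep_act1.
Qed.

(** The kernel of the action on V1 (x) V2. It is a two-sided ideal of finite
    codimension, and the recurrences hold modulo it. *)
Definition acts_by0 (t : UU) : Prop := forall w : W, tens_act t w = 0.

Lemma acts_by0_adl c a t : acts_by0 t -> acts_by0 (tens_map (ad c a) id t).
Proof.
move=> t0; suff E (w : W) : tens_act (tens_map (ad c a) id t) w =
    c *: (tens_act (tens_in a 1) (tens_act t w) - tens_act t (tens_act (tens_in a 1) w)).
  by move=> w; rewrite E !t0 tens_act0r subrr scaler0.
rewrite -!tens_actM; move: {t0}t; apply: tens_linear_ext => [||b b'].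
- apply: (comp_linear (f := fun s => tens_act s w)); first exact: tens_act_linearl.
  by apply: tens_map_linear => //; exact: ad_linear.
- apply: scale_sub_linear; apply: (comp_linear (f := fun s => tens_act s w));
    do ?exact: tens_act_linearl; [exact: tens_mul_linear|exact: tens_mul_linearl].
- rewrite tens_map_in //; last exact: ad_linear.
  rewrite !tens_mul_pure mul1r mulr1 /ad tens_inZl (linZ (tens_act_linearl w)).
  by rewrite (linB ((@tens_in_bilin _ U U).1 b')) (linB (tens_act_linearl w)).
Qed.

Lemma acts_by0_adr c a t : acts_by0 t -> acts_by0 (tens_map id (ad c a) t).
Proof.
move=> t0; suff E (w : W) : tens_act (tens_map id (ad c a) t) w =
    c *: (tens_act (tens_in 1 a) (tens_act t w) - tens_act t (tens_act (tens_in 1 a) w)).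
  by move=> w; rewrite E !t0 tens_act0r subrr scaler0.
rewrite -!tens_actM; move: {t0}t; apply: tens_linear_ext => [||b b'].
- apply: (comp_linear (f := fun s => tens_act s w)); first exact: tens_act_linearl.
  by apply: tens_map_linear => //; exact: ad_linear.
- apply: scale_sub_linear; apply: (comp_linear (f := fun s => tens_act s w));
    do ?exact: tens_act_linearl; [exact: tens_mul_linear|exact: tens_mul_linearl].
- rewrite tens_map_in //; last exact: ad_linear.
  rewrite !tens_mul_pure mul1r mulr1 /ad tens_inZr (linZ (tens_act_linearl w)).
  by rewrite (linB ((@tens_in_bilin _ U U).2 b)) (linB (tens_act_linearl w)).
Qed.

Lemma acts_by0_mul s t : acts_by0 t -> acts_by0 (tens_mul s t).
Proof. by move=> t0 w; rewrite tens_actM t0 tens_act0r. Qed.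

End TensorAction.

(** * Rationality of the fusion action *)

Section FusionMatrix.
Context {K : fieldType} {n : nat} {C : cartan_datum n} {h : realization C}
  {qp : quantum_parameter K} {V1 V2 : prerep h qp}.
Hypotheses (rep1 : is_rep V1) (rep2 : is_rep V2).
Local Notation U := (qaff h qp).
Local Notation UU := (tens U U).
Local Notation W := (tens V1 V2).
Local Notation F := (ratfun K).
Local Notation x := (ux h qp).
Local Notation phi := (uphi h qp).
Context {d : nat} {e : 'I_d -> W} {c : W -> 'I_d -> K}.
Hypothesis ec : coordinates e c.
Variable Delta : qaff_u h qp -> int -> UU.
Hypothesis hD : drinfeld_coproduct Delta.

(** The matrix of a tensor of U (x) U in the basis e; it has scalar entries, and
    Delta_u(g) is studied through the series of these matrices. *)
Definition opmx (t : UU) : 'M[K]_d := \matrix_(i, j) c (tens_act t (e j)) i.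

Lemma opmx_linear : linear opmx.
Proof.
move=> a s t; apply/matrixP=> i j; rewrite !mxE (tens_act_linearl rep1 rep2).
exact: (coordinates_linear ec).
Qed.

Lemma opmx_entry_linear i j : linear (fun t => opmx t i j : K^o).
Proof. by move=> a s t; rewrite opmx_linear !mxE. Qed.

Lemma opmx_act t w i : c (tens_act t w) i = \sum_j opmx t i j * c w j.
Proof.
rewrite [w in LHS](coordinates_sum ec) (lin_comb (tens_act_linear rep1 rep2 t)).
rewrite (lin_comb (coordinates_linear ec i)); apply: eq_bigr => j _.
by rewrite mxE mulrC.
Qed.

Lemma opmx_eq0 t : opmx t = 0 <-> acts_by0 (V1 := V1) (V2 := V2) t.
Proof.
split=> [t0 w|t0]; last first.
  by apply/matrixP=> i j; rewrite !mxE t0 (lin0 (coordinates_linear ec i)).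
rewrite [LHS](coordinates_sum ec) big1 // => i _; rewrite opmx_act big1 ?scale0r // => j _.
by rewrite t0 mxE mul0r.
Qed.

Lemma opmxM s t : opmx (tens_mul s t) = opmx s *m opmx t.
Proof.
apply/matrixP=> i j; rewrite !mxE (tens_actM rep1 rep2) opmx_act.
by apply: eq_bigr => l _; rewrite [opmx t _ _]mxE.
Qed.

Lemma opmx1 : opmx (tens_in 1 1) = 1%:M.
Proof.
by apply/matrixP=> i j; rewrite !mxE (tens_act1 rep1 rep2) (coordinates_basis ec).
Qed.

(** The commutator with h_(i,1) or h_(i,-1) shifts r and preserves the kernel of
    the action, so recurrence_exists applies. The same polynomial serves all b
    since the kernel is an ideal. *)
Lemma recurrence_left ep i : exists2 p : {poly K}, p`_0 != 0 &
  forall b k, acts_by0 (V1 := V1) (V2 := V2) (shift_act p (fun k => tens_in (x ep i k) b) k).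
Proof.
pose D s := tens_map (ad (@ux_shift K n C qp ep s i).2 (uh h qp i (@ux_shift K n C qp ep s i).1)) (@id U).
have DL s : linear (D s) by apply: tens_map_linear => //; apply: ad_linear.
have DE s k : D s (tens_in (x ep i k) 1) = tens_in (x ep i (sg s + k)) 1.
  by rewrite /D tens_map_in ?ux_shiftE //; apply: ad_linear.
have [||||p p0 pE] := @recurrence_exists _ UU d opmx (D true) (D false)
  (fun k => tens_in (x ep i k) 1) opmx_linear (DL _) (DL _).
- by move=> t /opmx_eq0 t0; apply/opmx_eq0/acts_by0_adl.
- by move=> t /opmx_eq0 t0; apply/opmx_eq0/acts_by0_adl.
- by move=> k; rewrite DE addrC.
- by move=> k; rewrite DE addrC.
exists p => // b k.
have -> : shift_act p (fun k => tens_in (x ep i k) b) k =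
    tens_mul (tens_in 1 b) (shift_act p (fun k => tens_in (x ep i k) 1) k).
  rewrite (lin_shift_act (tens_mul_linear _)); apply: eq_shift_act => j /=.
  by rewrite tens_mul_pure mul1r mulr1.
by apply: acts_by0_mul => //; apply/opmx_eq0.
Qed.

Lemma recurrence_right ep i : exists2 p : {poly K}, p`_0 != 0 &
  forall a k, acts_by0 (V1 := V1) (V2 := V2) (shift_act p (fun k => tens_in a (x ep i k)) k).
Proof.
pose D s := tens_map (@id U) (ad (@ux_shift K n C qp ep s i).2 (uh h qp i (@ux_shift K n C qp ep s i).1)).
have DL s : linear (D s) by apply: tens_map_linear => //; apply: ad_linear.
have DE s k : D s (tens_in 1 (x ep i k)) = tens_in 1 (x ep i (sg s + k)).
  by rewrite /D tens_map_in ?ux_shiftE //; apply: ad_linear.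
have [||||p p0 pE] := @recurrence_exists _ UU d opmx (D true) (D false)
  (fun k => tens_in 1 (x ep i k)) opmx_linear (DL _) (DL _).
- by move=> t /opmx_eq0 t0; apply/opmx_eq0/acts_by0_adr.
- by move=> t /opmx_eq0 t0; apply/opmx_eq0/acts_by0_adr.
- by move=> k; rewrite DE addrC.
- by move=> k; rewrite DE addrC.
exists p => // a k.
have -> : shift_act p (fun k => tens_in a (x ep i k)) k =
    tens_mul (tens_in a 1) (shift_act p (fun k => tens_in 1 (x ep i k)) k).
  rewrite (lin_shift_act (tens_mul_linear _)); apply: eq_shift_act => j /=.
  by rewrite tens_mul_pure mul1r mulr1.
by apply: acts_by0_mul => //; apply/opmx_eq0.
Qed.

(** Here the two factors are shifted in opposite directions by two commuting
    commutators; the coefficients of the coproduct of x_(i,r) are obtained from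
    this sequence by writing phi as a commutator. *)
Lemma recurrence_both ep ep' i r : exists2 p : {poly K}, p`_0 != 0 &
  forall k, acts_by0 (V1 := V1) (V2 := V2)
    (shift_act p (fun k => tens_in (x ep i (r - k)) (x ep' i k)) k).
Proof.
pose A ep s := ad (@ux_shift K n C qp ep s i).2 (uh h qp i (@ux_shift K n C qp ep s i).1).
have AL ep0 s : linear (A ep0 s) by apply: ad_linear.
pose D s : UU -> UU := tens_map (A ep (~~ s)) id \o tens_map id (A ep' s).
have DL s : linear (D s) by apply: comp_linear; apply: tens_map_linear.
have DE s k : D s (tens_in (x ep i (r - k)) (x ep' i k)) =
    tens_in (x ep i (r - (sg s + k))) (x ep' i (sg s + k)).
  rewrite /D /= !tens_map_in // /A !ux_shiftE; congr (tens_in (x _ _ _) _).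
  by case: s => /=; lia.
have Dker s t : opmx t = 0 -> opmx (D s t) = 0.
  by move=> /opmx_eq0 t0; apply/opmx_eq0/acts_by0_adl => //; apply/acts_by0_adr.
have [||p p0 pE] := @recurrence_exists _ UU d opmx (D true) (D false)
  (fun k => tens_in (x ep i (r - k)) (x ep' i k)) opmx_linear (DL _) (DL _) (Dker _) (Dker _).
- by move=> k; rewrite DE [sg _ + _]addrC.
- by move=> k; rewrite DE [sg _ + _]addrC.
by exists p => // k; apply/opmx_eq0.
Qed.

(** M is the matrix by which g acts, if its entries expand to those of
    Delta_u(g). *)
Definition is_fusion_mx (g : qaff_u h qp) (M : 'M[F]_d) : Prop :=
  forall i j, is_expansion (M i j) (fun k => opmx (Delta g k) i j).

Lemma is_fusion_mx_uniq g M M' : is_fusion_mx g M -> is_fusion_mx g M' -> M = M'.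
Proof. by move=> gM gM'; apply/matrixP=> i j; apply: is_expansion_inj (gM i j) (gM' i j). Qed.

Lemma is_fusion_mxD g g' M M' : is_fusion_mx g M -> is_fusion_mx g' M' -> is_fusion_mx (g + g') (M + M').
Proof.
move=> gM gM' i j; have := is_expansion_comb 1 (gM i j) (gM' i j).
rewrite scale1r mxE; congr is_expansion; apply/funext=> k.
by rewrite (Delta_add hD) (linD opmx_linear) [RHS]mxE mul1r.
Qed.

Lemma is_fusion_mxZ f g M : is_fusion_mx g M -> is_fusion_mx (ratscale f g) (f *: M).
Proof.
move=> gM i j; have [a fa] := is_expansion_exists f.
have := is_expansion_mul fa (gM i j); rewrite mxE; congr is_expansion.
apply/funext=> k; rewrite (Delta_ratscale hD _ fa); apply/esym.
apply: (conv_map (op := *:%R) (f := fun t => opmx t i j) (f2 := fun t => opmx t i j)).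
- by move=> y; rewrite scale0r.
- by move=> y; rewrite scaler0.
- by move=> y; rewrite mul0r.
- by move=> y; rewrite mulr0.
- by move=> y t; rewrite (linZ (opmx_entry_linear i j)).
- exact: (lin0 (opmx_entry_linear i j)).
- exact: (lin0 (opmx_entry_linear i j)).
- exact: (linD (opmx_entry_linear i j)).
- by case: fa.
- exact: Delta_laurent.
Qed.

Lemma is_fusion_mxM g g' M M' : is_fusion_mx g M -> is_fusion_mx g' M' ->
  is_fusion_mx (tens_mul g g') (M *m M').
Proof.
move=> gM gM' i j.
have := is_expansion_sum (index_enum 'I_d) (fun l => is_expansion_mul (gM i l) (gM' l j)).
rewrite mxE; congr is_expansion; apply/funext=> k; rewrite (Delta_mul hD); apply/esym.
apply: (conv_matrix (op := @tens_mul _ U U) (f := fun t => opmx t i j)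
  (f1 := fun l t => opmx t i l) (f2 := fun l t => opmx t l j)).
- by move=> t; apply: (lin0 (tens_mul_linearl t)).
- by move=> t; apply: (lin0 (tens_mul_linear t)).
- exact: (lin0 (opmx_entry_linear i j)).
- exact: (linD (opmx_entry_linear i j)).
- by move=> l; apply: (lin0 (opmx_entry_linear i l)).
- by move=> l; apply: (lin0 (opmx_entry_linear l j)).
- by move=> s t; rewrite opmxM mxE.
- exact: Delta_laurent.
- exact: Delta_laurent.
Qed.

Lemma opmx_Delta_laurent g i j : is_laurent (fun k => opmx (Delta g k) i j).
Proof.
have [k0 D0] := Delta_laurent hD g; exists k0 => k /D0 ->.
exact: (lin0 (opmx_entry_linear i j)).
Qed.

Lemma is_fusion_mx_laurentpoly g k1 : (forall k, k1 < k -> Delta g k = 0) ->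
  exists2 M, is_fusion_mx g M & forall i j, in_A (M i j).
Proof.
move=> D0; have H i j : exists f, is_expansion f (fun k => opmx (Delta g k) i j) /\ in_A f.
  have [|f fa Af] := is_expansion_laurentpoly (k1 := k1) (opmx_Delta_laurent g i j).
    by move=> k /D0 ->; apply: (lin0 (opmx_entry_linear i j)).
  by exists f.
have /choice[M ME] : forall ij : 'I_d * 'I_d, exists f,
    is_expansion f (fun k => opmx (Delta g k) ij.1 ij.2) /\ in_A f by case.
exists (\matrix_(i, j) M (i, j)) => i j; rewrite mxE; first exact: (ME (i, j)).1.
exact: (ME (i, j)).2.
Qed.

Lemma is_fusion_mx1 : is_fusion_mx (tens_in 1 1) 1%:M.
Proof.
move=> i j; rewrite (Delta_one hD).
have := is_expansion_poly ((i == j)%:R%:P : {poly K}); congr is_expansion.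
  by rewrite mxE; case: (i == j); rewrite ?polyC1 ?ratpoly1 ?polyC0 ?ratpoly0.
apply/funext=> k; rewrite shift_actC /delta0 /mono; case: (k =P 0) => _.
  by rewrite opmx1 mxE /GRing.scale /= mulr1.
by rewrite scaler0 (lin0 (opmx_entry_linear i j)).
Qed.

(** It is enough to prove rationality, and integrality over A, for generators.
    The condition P on entries is trivial for the former and is membership in A
    for the latter. *)
Lemma rational_subalgebra (P : F -> Prop) : P 0 -> P 1 ->
  (forall f g, P f -> P g -> P (f + g)) -> (forall f g, P f -> P g -> P (f * g)) ->
  (forall a : K, P (ratpoly a%:P)) ->
  is_subalgebra (fun a : U => exists2 M, is_fusion_mx (tens_in a 1) M & forall i j, P (M i j)).
Proof.
move=> P0 P1 PD PM Pc; split.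
- move=> z a b [M aM PaM] [M' bM' PbM']; exists (ratpoly z%:P *: M + M') => [|i j].
    by rewrite tens_inDl tens_inZl; apply: is_fusion_mxD => //; rewrite -ratscaleZ; apply: is_fusion_mxZ.
  by rewrite !mxE; apply: PD => //; apply: PM.
- move=> a b [M aM PaM] [M' bM' PbM']; exists (M *m M') => [|i j].
    rewrite -[1 in X in is_fusion_mx X]mulr1.
    have -> : tens_in (a * b) (1 * 1 : F) = tens_mul (tens_in a 1) (tens_in b 1).
      by rewrite tens_mul_pure.
    exact: is_fusion_mxM.
  by rewrite mxE; elim/big_ind: _ => // l _; apply: PM.
- exists 1%:M => [|i j]; first exact: is_fusion_mx1.
  by rewrite mxE; case: eqP.
Qed.

Lemma phi_truncated ep i m : sg ep * m < 0 -> phi ep i m = 0.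
Proof. by rewrite /uphi /Defs.phi leNgt => ->. Qed.

Lemma is_fusion_mx_k a : exists2 M, is_fusion_mx (tens_in (uk qp a) 1) M & forall i j, in_A (M i j).
Proof.
apply: (@is_fusion_mx_laurentpoly _ 0) => k k0.
by rewrite (Delta_k hD) /mono gt_eqF.
Qed.

Lemma is_fusion_mx_phi ep i m :
  exists2 M, is_fusion_mx (tens_in (phi ep i m) 1) M & forall i j, in_A (M i j).
Proof.
have [m0|] := ltP (sg ep * m) 0.
  have -> : tens_in (phi ep i m) 1 = ratscale 0 (tens_in 1 1) :> qaff_u h qp.
    by rewrite phi_truncated // tens_in0l ratscale_in mul0r tens_in0r.
  exists (0 *: 1%:M) => [|j l]; first exact: is_fusion_mxZ is_fusion_mx1.
  by rewrite !mxE mul0r; apply: in_A0.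
case: ep => m0.
  have -> : m = `|m|%N by move: m0 => /=; lia.
  apply: (@is_fusion_mx_laurentpoly _ `|m|%N) => k mk; rewrite (Delta_phip hD) ifF //.
  by apply/negP => /andP[_]; rewrite leNgt mk.
have -> : m = - (`|m|%N)%:Z by move: m0 => /=; lia.
apply: (@is_fusion_mx_laurentpoly _ 0) => k mk; rewrite (Delta_phim hD) ifF //.
by apply/negP => /andP[_]; rewrite leNgt mk.
Qed.

Lemma opmx_shift_act0 p (tau : int -> UU) : (forall k, acts_by0 (V1 := V1) (V2 := V2) (shift_act p tau k)) ->
  forall D : UU -> UU, linear D ->
  (forall t, acts_by0 (V1 := V1) (V2 := V2) t -> acts_by0 (V1 := V1) (V2 := V2) (D t)) ->
  forall i j k, @shift_act K K^o p (fun k => opmx (D (tau k)) i j) k = 0.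
Proof.
move=> tau0 D DL D0 i j k.
rewrite -[LHS](lin_shift_act (comp_linear (opmx_entry_linear i j) DL)) /=.
by have /opmx_eq0-> := D0 _ (tau0 k); rewrite mxE.
Qed.

(** In the coproduct of x_(i,r) the factor phi is a commutator, so up to
    finitely many terms the coefficients are the image of the sequence of
    recurrence_both under a map that preserves the kernel of the action. *)
Lemma is_fusion_mx_x ep i r : exists M, is_fusion_mx (tens_in (x ep i r) 1) M.
Proof.
suff H j l : exists f, is_expansion f (fun k => opmx (Delta (tens_in (x ep i r) 1) k) j l).
  have /choice[M ME] : forall jl : 'I_d * 'I_d, exists f,
    is_expansion f (fun k => opmx (Delta (tens_in (x ep i r) 1) k) jl.1 jl.2) by case.
  by exists (\matrix_(j, l) M (j, l)) => j l; rewrite mxE; exact: (ME (j, l)).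
have La := opmx_Delta_laurent (tens_in (x ep i r) 1) j l.
have [p p0 rec] := recurrence_both false ep i r.
have pn0 : p != 0 by apply: contraNneq p0 => ->; rewrite coef0.
case: ep La rec => La rec.
  pose D := tens_map (ad (- (qi C qp i - (qi C qp i)^-1)) (x true i 0)) (@id U).
  have DL : linear D by apply: tens_map_linear => //; apply: ad_linear.
  have D0 t : acts_by0 (V1 := V1) (V2 := V2) t -> acts_by0 (V1 := V1) (V2 := V2) (D t).
    exact: acts_by0_adl.
  have := opmx_shift_act0 rec DL D0 j l => pD.
  apply: (is_expansion_recurrent (k1 := Num.max r 0) pn0 pD La) => k.
  rewrite gt_max => /andP[rk k0]; rewrite (Delta_xp hD) /mono gt_eqF // add0r ltW //.
  rewrite /D tens_map_in //; last exact: ad_linear.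
  by rewrite -phi_minus // subr_lt0.
pose D := tens_map (@id U) (ad (qi C qp i - (qi C qp i)^-1) (x true i 0)).
have DL : linear D by apply: tens_map_linear => //; apply: ad_linear.
have D0 t : acts_by0 (V1 := V1) (V2 := V2) t -> acts_by0 (V1 := V1) (V2 := V2) (D t).
  exact: acts_by0_adr.
have := opmx_shift_act0 rec DL D0 j l => pD.
(* Beyond r and 0 only the terms where phi is a commutator remain. *)
apply: (is_expansion_recurrent (k1 := Num.max r 0) pn0 pD La) => k.
rewrite gt_max => /andP[rk k0]; rewrite (Delta_xm hD) /mono gt_eqF // add0r ltW //.
rewrite /D tens_map_in //; last exact: ad_linear.
by rewrite -phi_plus.
Qed.

Lemma is_fusion_mx_exists g : exists M, is_fusion_mx g M.
Proof.
have Q : is_subalgebra (fun a : U => exists2 M, is_fusion_mx (tens_in a 1) M &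
    forall i j, (fun=> True) (M i j)) by exact: (@rational_subalgebra (fun=> True)).
have Ua (a : U) : exists2 M, is_fusion_mx (tens_in a 1) M & forall i j, (fun=> True) (M i j).
  have Qk a' : exists2 M, is_fusion_mx (tens_in (uk qp a') 1) M & forall i j, (fun=> True) (M i j).
    by have [M aM _] := is_fusion_mx_k a'; exists M.
  apply: (qaff_generated Q) => -[ep i r|a'|i m]; last first.
  - apply: (subalgebra_h Q) => // ep i' m'.
    by have [M aM _] := is_fusion_mx_phi ep i' m'; exists M.
  - exact: Qk.
  - by have [M aM] := is_fusion_mx_x ep i r; exists M.
rewrite [g]tens_sum; elim: (trepr g) => [|[a f] s [M sM]].
  rewrite big_nil; have := is_fusion_mxZ 0 is_fusion_mx1.
  by rewrite ratscale_in mul0r tens_in0r; eexists; eassumption.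
have [M' aM' _] := Ua a; rewrite big_cons /=; exists (f *: M' + M).
apply: is_fusion_mxD => //; have := is_fusion_mxZ f aM'; rewrite ratscale_in mulr1.
by [].
Qed.

Definition fusion_mx (g : qaff_u h qp) : 'M[F]_d := sval (cid (is_fusion_mx_exists g)).
Lemma fusion_mxP g : is_fusion_mx g (fusion_mx g). Proof. exact: (svalP (cid (is_fusion_mx_exists g))). Qed.
Lemma fusion_mx_eq g M : is_fusion_mx g M -> fusion_mx g = M. Proof. exact/is_fusion_mx_uniq/fusion_mxP. Qed.

Lemma fusion_mxD g g' : fusion_mx (g + g') = fusion_mx g + fusion_mx g'.
Proof. by apply/fusion_mx_eq/is_fusion_mxD; apply: fusion_mxP. Qed.
Lemma fusion_mx_ratscale f g : fusion_mx (ratscale f g) = f *: fusion_mx g.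
Proof. by apply/fusion_mx_eq/is_fusion_mxZ/fusion_mxP. Qed.
Lemma fusion_mxZ z g : fusion_mx (z *: g) = ratpoly z%:P *: fusion_mx g.
Proof. by rewrite -fusion_mx_ratscale ratscaleZ. Qed.
Lemma fusion_mxM g g' : fusion_mx (tens_mul g g') = fusion_mx g *m fusion_mx g'.
Proof. by apply/fusion_mx_eq/is_fusion_mxM; apply: fusion_mxP. Qed.
Lemma fusion_mx1 : fusion_mx (tens_in 1 1) = 1%:M.
Proof. exact/fusion_mx_eq/is_fusion_mx1. Qed.

(** The relation that defines the fusion action is the action of a matrix over
    K(u). In particular it is the graph of a map, and this map is linear. *)
Lemma fusion_relP g m m' : fusion_rel (V1 := V1) (V2 := V2) Delta g m m' <->
  tcoord (c := c) m' = fusion_mx g *m tcoord (c := c) m.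
Proof.
have key L : is_tens_expansion m L -> forall i,
    is_expansion ((fusion_mx g *m tcoord (c := c) m) i 0)
      (fun k => c (conv (@tens_act _ _ _ _ _ V1 V2) (Delta g) L k) i).
  move=> mL i; have mL' := (tens_expansionP ec m L).1 mL.
  have := is_expansion_sum (index_enum 'I_d) (fun l => is_expansion_mul (fusion_mxP g i l) (mL' l)).
  rewrite mxE; congr is_expansion; apply/funext=> k; apply/esym.
  apply: (conv_matrix (f := fun w => c w i) (f1 := fun l t => opmx t i l) (f2 := fun l w => c w l)).
  - exact: tens_act0.
  - exact: tens_act0r.
  - exact: (lin0 (coordinates_linear ec i)).
  - exact: (linD (coordinates_linear ec i)).
  - by move=> l; apply: (lin0 (opmx_entry_linear i l)).
  - by move=> l; apply: (lin0 (coordinates_linear ec l)).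
  - by move=> t w; rewrite opmx_act.
  - exact: Delta_laurent.
  - exact: (tens_expansion_laurent ec mL).
split=> [[L mL mL']|mE].
  apply/colP=> i; apply: is_expansion_inj (key L mL i).
  exact: (tens_expansionP ec _ _).1 mL' i.
have [L mL] := tens_expansion_exists ec m; exists L => //.
by apply/(tens_expansionP ec) => i; rewrite mE; apply: key.
Qed.

Lemma tcoord_fusion_act g m :
  tcoord (c := c) (fusion_act (V1 := V1) (V2 := V2) Delta g m) = fusion_mx g *m tcoord (c := c) m.
Proof.
apply/fusion_relP; rewrite /fusion_act; case: xgetP => [m' -> //|none].
have := none (untcoord (e := e) (fusion_mx g *m tcoord (c := c) m)); case.
by apply/fusion_relP; rewrite (untcoordK ec).
Qed.

End FusionMatrix.

(** * The lattice N and its reduction at u = 1 *)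

Section FusionAction.
Context {K : fieldType} {n : nat} {C : cartan_datum n} {h : realization C}
  {qp : quantum_parameter K} {V1 V2 : prerep h qp}.
Hypotheses (rep1 : is_rep V1) (rep2 : is_rep V2).
Local Notation U := (qaff h qp).
Local Notation UU := (tens U U).
Local Notation W := (tens V1 V2).
Local Notation F := (ratfun K).
Context {d : nat} {e : 'I_d -> W} {c : W -> 'I_d -> K}.
Hypothesis ec : coordinates e c.
Context {Delta : qaff_u h qp -> int -> UU}.
Hypothesis hD : drinfeld_coproduct Delta.
Local Notation M := (fusion_space V1 V2).
Local Notation fact := (fusion_act (V1 := V1) (V2 := V2) Delta).
Local Notation fusion_mx := (fusion_mx rep1 rep2 ec hD).
Local Notation tc := (tcoord (c := c)).
Local Notation tcE := (tcoord_fusion_act rep1 rep2 ec hD).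
Implicit Types (g : qaff_u h qp) (m : M).

Lemma fusion_rel_act g m : fusion_rel Delta g m (fact g m).
Proof. by apply/(fusion_relP rep1 rep2 ec hD); rewrite tcE. Qed.

Lemma fusion_rel_eq g m m' : fusion_rel Delta g m m' -> fact g m = m'.
Proof.
by move=> /(fusion_relP rep1 rep2 ec hD) H; apply: (tcoord_inj ec); rewrite tcE H.
Qed.

Lemma tcoord_scale z m : tc (z *: m) = ratpoly z%:P *: tc m.
Proof. by rewrite -ratscaleZ (tcoordZ ec). Qed.

Lemma fusion_act_linear g : linear (fact g).
Proof.
move=> z m m'; apply: (tcoord_inj ec).
by rewrite tcE !(tcoordD ec) !tcoord_scale !tcE mulmxDr scalemxAr.
Qed.

Lemma fusion_act_linearl m : linear (fun g => fact g m).
Proof.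
move=> z g g'; apply: (tcoord_inj ec).
by rewrite tcE (tcoordD ec) tcoord_scale !tcE fusion_mxD fusion_mxZ mulmxDl scalemxAl.
Qed.

Lemma fusion_act_ratscale f g m : fact g (ratscale f m) = ratscale f (fact g m).
Proof. by apply: (tcoord_inj ec); rewrite tcE !(tcoordZ ec) tcE scalemxAr. Qed.

Lemma fusion_act_ratscalel f g m : fact (ratscale f g) m = ratscale f (fact g m).
Proof. by apply: (tcoord_inj ec); rewrite tcE (tcoordZ ec) tcE fusion_mx_ratscale scalemxAl. Qed.

Lemma fusion_actM g g' m : fact (tens_mul g g') m = fact g (fact g' m).
Proof. by apply: (tcoord_inj ec); rewrite !tcE fusion_mxM mulmxA. Qed.

Lemma fusion_act1 m : fact (tens_in 1 1) m = m.
Proof. by apply: (tcoord_inj ec); rewrite tcE fusion_mx1 mul1mx. Qed.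

Lemma in_Uu_pure (a : U) f : in_A f -> in_Uu (tens_in a f : qaff_u h qp).
Proof. by move=> Af; exists 1%N, (fun=> a), (fun=> f); rewrite big_ord1. Qed.

Lemma in_Uu_mul (a : U) g : in_Uu g -> in_Uu (tens_mul (tens_in a 1) g : qaff_u h qp).
Proof.
move=> [l [b [f [Af ->]]]]; exists l, (fun i => a * b i), f; split=> //.
rewrite (lin_sum (tens_mul_linear _)); apply: eq_bigr => i _.
by rewrite tens_mul_pure mul1r.
Qed.

Lemma in_Uu_ratscale f g : in_A f -> in_Uu g -> in_Uu (ratscale f g : qaff_u h qp).
Proof.
move=> Af [l [b [f' [Af' ->]]]]; exists l, b, (fun i => f * f' i); split=> [i|].
  exact: in_AM.
rewrite (lin_sum (ratscale_linear _)); apply: eq_bigr => i _.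
by rewrite ratscale_in.
Qed.

Local Notation tolat := (to_lattice Delta (V1 := V1) (V2 := V2)).
Local Notation N := (lattice Delta V1 V2).
Local Notation "m '\inN'" := (m \in linspan (fun m0 : M => exists g w, in_Uu g /\ m0 = fact g (tens_in w 1)))
  (at level 70).

Lemma linspan_linear (V V' : lmodType K) (P : V -> Prop) (P' : V' -> Prop) (f : V -> V') :
  linear f -> (forall v, P v -> f v \in linspan P') ->
  forall v, v \in linspan P -> f v \in linspan P'.
Proof.
move=> fL fP v /asboolP[l [a [s [Ps ->]]]]; rewrite (lin_comb fL).
by apply: rpred_sum => i _; apply: rpredZ; apply: fP.
Qed.

Lemma lattice_act (a : U) m : m \inN -> fact (tens_in a 1) m \inN.
Proof.
apply: linspan_linear => [|_ [g [w [gU ->]]]]; first exact: fusion_act_linear.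
apply: mem_linspan; exists (tens_mul (tens_in a 1) g), w; split.
  exact: in_Uu_mul.
by rewrite fusion_actM.
Qed.

Lemma lattice_ratscale f m : in_A f -> m \inN -> ratscale f m \inN.
Proof.
move=> Af; apply: linspan_linear => [|_ [g [w [gU ->]]]]; first exact: ratscale_linear.
apply: mem_linspan; exists (ratscale f g), w; split.
  exact: in_Uu_ratscale.
by rewrite fusion_act_ratscalel.
Qed.

Lemma lattice_pure w : tens_in w 1 \inN.
Proof.
apply: mem_linspan; exists (tens_in 1 1), w; rewrite fusion_act1; split=> //.
exact/in_Uu_pure/in_A1.
Qed.

Lemma to_latticeK m : m \inN -> lattice_val (tolat m : N) = m.
Proof. by move=> mN; rewrite /lattice_val /to_lattice; apply: insubdK. Qed.

Lemma lattice_valP (x : N) : lattice_val x \inN.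
Proof. exact: valP x. Qed.

Lemma lattice_val_inj : injective (@lattice_val _ _ _ _ _ Delta V1 V2).
Proof. exact: val_inj. Qed.

Lemma lattice_val_linear : linear (@lattice_val _ _ _ _ _ Delta V1 V2).
Proof. by move=> z x y. Qed.

Lemma to_lattice_comb z m m' : m \inN -> m' \inN ->
  tolat (z *: m + m') = z *: tolat m + tolat m' :> N.
Proof.
move=> mN m'N; apply: lattice_val_inj; rewrite lattice_val_linear !to_latticeK //.
by rewrite rpredD ?rpredZ.
Qed.

Local Notation cls := (@otimes_d_class _ _ _ _ _ Delta V1 V2).

Lemma otimes_d_class_linear : linear cls.
Proof. exact: qclass_linear. Qed.

(** The class of m in N / (u - 1) N, written on the fusion space itself; it is
    meaningful for m in N. *)
Definition lattice_class (m : M) : otimes_d_space Delta V1 V2 := cls (tolat m).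

Lemma lattice_class_comb z m m' : m \inN -> m' \inN ->
  lattice_class (z *: m + m') = z *: lattice_class m + lattice_class m'.
Proof. by move=> mN m'N; rewrite /lattice_class to_lattice_comb // otimes_d_class_linear. Qed.

Lemma lattice_class0 : lattice_class 0 = 0.
Proof.
by have := lattice_class_comb (-1) (rpred0 _) (rpred0 _); rewrite scaler0 addr0 scaleN1r addNr.
Qed.

Lemma lattice_classD m m' : m \inN -> m' \inN -> lattice_class (m + m') = lattice_class m + lattice_class m'.
Proof. by move=> mN m'N; rewrite -[m in LHS]scale1r lattice_class_comb // scale1r. Qed.

Lemma lattice_classZ z m : m \inN -> lattice_class (z *: m) = z *: lattice_class m.
Proof. by move=> mN; rewrite -[_ *: m]addr0 lattice_class_comb ?rpred0 // lattice_class0 addr0. Qed.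

Lemma lattice_class_kill m : m \inN -> lattice_class (ratscale (ratu K - 1) m) = 0.
Proof.
move=> mN; rewrite -(lin0 otimes_d_class_linear); apply/qclassP; rewrite subr0.
apply: mem_linspan; exists (tolat m); rewrite !to_latticeK //.
apply: lattice_ratscale => //; rewrite -ratpoly1 -ratpolyB; exact: in_A_poly.
Qed.

(** (u - 1) N is already a submodule, so the span of its elements in the
    definition of the quotient adds nothing. *)
Lemma lattice_class_eq m m' : m \inN -> m' \inN -> lattice_class m = lattice_class m' ->
  exists2 m0, m0 \inN & m - m' = ratscale (ratu K - 1) m0.
Proof.
move=> mN m'N /qclassP/asboolP[l [a [s [sP /(congr1 (@lattice_val _ _ _ _ _ _ _ _))]]]].
rewrite (linB lattice_val_linear) !to_latticeK // => ->.
have /choice[s0 s0E] := sP.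
exists (lattice_val (\sum_i a i *: s0 i)); first exact: lattice_valP.
rewrite !(lin_comb lattice_val_linear) (lin_comb (ratscale_linear _)).
by apply: eq_bigr => i _; rewrite s0E.
Qed.

Lemma lattice_class_surj (y : otimes_d_space Delta V1 V2) :
  exists2 m, m \inN & y = lattice_class m.
Proof.
exists (lattice_val (qrepr y)); first exact: lattice_valP.
rewrite /lattice_class -[LHS](qreprK y); congr (qclass _ _); apply: lattice_val_inj.
by rewrite to_latticeK //; exact: lattice_valP.
Qed.

(** The action commutes with the multiplication by u - 1, so it descends to N /
    (u - 1) N, whatever representative is chosen. *)
Lemma otimes_d_act_class a m : m \inN ->
  otimes_d_act a (lattice_class m) = lattice_class (fact (tens_in a 1) m).
Proof.
move=> mN; rewrite /otimes_d_act.
set m' := lattice_val _.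
have m'N : m' \inN by exact: lattice_valP.
have : lattice_class m' = lattice_class m.
  rewrite -[RHS](qreprK (lattice_class m)); congr (qclass _ _); apply: lattice_val_inj.
  by rewrite to_latticeK.
move=> /(lattice_class_eq m'N mN)[m0 m0N m0E].
have -> : m' = 1 *: ratscale (ratu K - 1) m0 + m by rewrite scale1r -m0E subrK.
rewrite -[cls _]/(lattice_class _) fusion_act_linear fusion_act_ratscale lattice_class_comb.
- by rewrite lattice_class_kill ?lattice_act // scaler0 add0r.
- apply: lattice_ratscale; last exact: lattice_act.
  by rewrite -ratpoly1 -ratpolyB; exact: in_A_poly.
- exact: lattice_act.
Qed.

Lemma otimes_d_wfP : otimes_d_wf Delta V1 V2.
Proof.
split=> [||a m].
- exact: fusion_rel_act.
- by move=> a m; apply/to_latticeK/lattice_act/lattice_valP.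
have -> : otimes_d_class m = lattice_class (lattice_val m).
  congr (qclass _ _); apply: lattice_val_inj; rewrite to_latticeK //.
  exact: lattice_valP.
by rewrite otimes_d_act_class //; exact: lattice_valP.
Qed.

Lemma otimes_d_rep : is_rep (otimes_d Delta V1 V2).
Proof.
have N1 (a : U) m := @lattice_act a m.
split.
- split=> [y|a] z u v /=.
    have [m mN ->] := lattice_class_surj y; rewrite !otimes_d_act_class //.
    by rewrite -lattice_class_comb ?N1 // tens_inDl tens_inZl fusion_act_linearl.
  have [m mN ->] := lattice_class_surj u; have [m' mN' ->] := lattice_class_surj v.
  rewrite -lattice_class_comb // !otimes_d_act_class ?rpredD ?rpredZ //.
  by rewrite -lattice_class_comb ?N1 // fusion_act_linear.
- by move=> y /=; have [m mN ->] := lattice_class_surj y; rewrite otimes_d_act_class // fusion_act1.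
- move=> a b y /=; have [m mN ->] := lattice_class_surj y; rewrite !otimes_d_act_class ?N1 //.
  by rewrite -fusion_actM tens_mul_pure mulr1.
Qed.
End FusionAction.

(** * Submodules over A *)

Section ASpan.
Context {K : fieldType} {X : lmodType (ratfun K)}.
Local Notation F := (ratfun K).
Implicit Types (G Z : X -> Prop).

Record is_Asubmod Z : Prop := IsAsubmod {
  Asubmod0 : Z 0;
  Asubmod_comb : forall a v w, in_A a -> Z v -> Z w -> Z (a *: v + w)
}.

(** Linear combinations with coefficients in A. The inductive form avoids
    carrying families of coefficients. *)
Inductive aspan G : X -> Prop :=
| aspan0 : aspan G 0
| aspan_comb a v w : in_A a -> G v -> aspan G w -> aspan G (a *: v + w).

Lemma AsubmodZ Z a v : is_Asubmod Z -> in_A a -> Z v -> Z (a *: v).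
Proof. by move=> ZA Aa Zv; rewrite -[_ *: _]addr0; apply: (Asubmod_comb ZA) => //; apply: Asubmod0. Qed.
Lemma AsubmodD Z v w : is_Asubmod Z -> Z v -> Z w -> Z (v + w).
Proof. by move=> ZA Zv Zw; rewrite -[v]scale1r; apply: (Asubmod_comb ZA) => //; apply: in_A1. Qed.
Lemma Asubmod_sum Z (I : Type) (s : seq I) (P : pred I) (v : I -> X) : is_Asubmod Z ->
  (forall i, P i -> Z (v i)) -> Z (\sum_(i <- s | P i) v i).
Proof.
by move=> ZA Zv; elim/big_ind: _ => //; [exact: Asubmod0|move=> *; exact: AsubmodD].
Qed.

Lemma aspan_gen G v : G v -> aspan G v.
Proof.
move=> Gv; rewrite -[v]addr0 -[v in v + _]scale1r.
by apply: aspan_comb => //; [exact: in_A1|exact: aspan0].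
Qed.

Lemma aspan_sub G Z : is_Asubmod Z -> (forall v, G v -> Z v) -> forall v, aspan G v -> Z v.
Proof.
move=> ZA GZ v; elim=> [|a {}v w Aa Gv _ Zw]; first exact: Asubmod0.
by apply: (Asubmod_comb ZA) => //; apply: GZ.
Qed.

Lemma aspan_Asubmod G : is_Asubmod (aspan G).
Proof.
have D v w : aspan G v -> aspan G w -> aspan G (v + w).
  elim=> [|a {}v v' Aa Gv _ IH] Gw; first by rewrite add0r.
  by rewrite -addrA; apply: aspan_comb => //; apply: IH.
have Zs a v : in_A a -> aspan G v -> aspan G (a *: v).
  move=> Aa; elim=> [|b {}v w Ab Gv _ IH]; first by rewrite scaler0; apply: aspan0.
  by rewrite scalerDr scalerA; apply: aspan_comb => //; apply: in_AM.
split; first exact: aspan0.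
by move=> a v w Aa Gv Gw; apply: D => //; apply: Zs.
Qed.
End ASpan.

(** * Heights of weights *)

Section Height.
Context {K : fieldType} {n : nat} {C : cartan_datum n} (h : realization C).
Local Notation weight := 'Hom(h, rat^o).

(** The sum of the coefficients on the simple roots. The simple roots are free
    but need not span the dual of h; off their span the value is that of some
    linear extension, and only linearity matters. *)
Definition height (om : weight) : rat := \sum_i coord [tuple Defs.root h i | i < n] i om.

Lemma height_linear : linear (height : weight -> rat^o).
Proof.
move=> z u v; rewrite /height scaler_sumr -big_split; apply: eq_bigr => i _.
by rewrite linearP.
Qed.

Lemma height_root i : height (Defs.root h i) = 1.
Proof.
have E j : coord [tuple Defs.root h i | i < n] j (Defs.root h i) = (i == j)%:R.
  rewrite -(coord_free _ _ (root_free h)); congr (coord _ _ _).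
  by rewrite -tnth_nth tnth_mktuple.
rewrite /height (bigD1 i) //= E eqxx big1 ?addr0 // => j ji.
by rewrite E eq_sym (negPf ji).
Qed.
End Height.

(** * Finite generation of the lattice *)

Section Lattice.
Context {K : fieldType} {n : nat} {C : cartan_datum n} {h : realization C}
  {qp : quantum_parameter K} {V1 V2 : prerep h qp}.
Hypotheses (rep1 : is_rep V1) (rep2 : is_rep V2).
Local Notation U := (qaff h qp).
Local Notation UU := (tens U U).
Local Notation W := (tens V1 V2).
Local Notation F := (ratfun K).
Local Notation weight := 'Hom(h, rat^o).
Local Notation x := (ux h qp).
Local Notation phi := (uphi h qp).
Context {d : nat} {e : 'I_d -> W} {c : W -> 'I_d -> K}.
Hypothesis ec : coordinates e c.
Context {Delta : qaff_u h qp -> int -> UU}.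
Hypothesis hD : drinfeld_coproduct Delta.
Local Notation X := 'cV[F]_d.
Local Notation tc := (tcoord (c := c)).

(** The matrix of an element of U. Since a |-> act_mx a is a morphism of
    algebras, questions on the fusion module become questions on matrices over
    K(u). *)
Definition act_mx (a : U) : 'M[F]_d := fusion_mx rep1 rep2 ec hD (tens_in a 1).

Lemma act_mx_comb z a b : act_mx (z *: a + b) = ratpoly z%:P *: act_mx a + act_mx b.
Proof. by rewrite /act_mx tens_inDl tens_inZl fusion_mxD fusion_mxZ. Qed.
Lemma act_mxM a b : act_mx (a * b) = act_mx a *m act_mx b.
Proof. by rewrite /act_mx -fusion_mxM tens_mul_pure mulr1. Qed.
Lemma act_mx1 : act_mx 1 = 1%:M. Proof. exact: fusion_mx1. Qed.
Lemma act_mxD a b : act_mx (a + b) = act_mx a + act_mx b.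
Proof. by rewrite -[a in LHS]scale1r act_mx_comb polyC1 ratpoly1 scale1r. Qed.
Lemma act_mx0 : act_mx 0 = 0.
Proof. by apply: (addrI (act_mx 0)); rewrite -act_mxD !addr0. Qed.
Lemma act_mxZ z a : act_mx (z *: a) = ratpoly z%:P *: act_mx a.
Proof. by rewrite -[_ *: a]addr0 act_mx_comb act_mx0 addr0. Qed.

Definition stabilizes (Z : X -> Prop) (a : U) : Prop := forall v, Z v -> Z (act_mx a *m v).

Lemma stabilizes_subalgebra Z : is_Asubmod Z -> is_subalgebra (stabilizes Z).
Proof.
move=> ZA; split=> [z a b Za Zb v Zv|a b Za Zb v Zv|v Zv].
- rewrite act_mx_comb mulmxDl -scalemxAl; apply: (Asubmod_comb ZA) => //.
  + exact: in_A_poly.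
  + exact: Za.
  + exact: Zb.
- by rewrite act_mxM -mulmxA; apply/Za/Zb.
- by rewrite act_mx1 mul1mx.
Qed.

(** What U^+, or U^-, generates from Z over A. Words are not written down: the
    induction on this predicate is the one that moves a Cartan element or an x^+
    past the letters. *)
Inductive xclosure (ep : bool) (Z : X -> Prop) : X -> Prop :=
| xclosure_base v : Z v -> xclosure ep Z v
| xclosure0 : xclosure ep Z 0
| xclosure_comb a v w : in_A a -> xclosure ep Z v -> xclosure ep Z w ->
    xclosure ep Z (a *: v + w)
| xclosure_act i r v : xclosure ep Z v -> xclosure ep Z (act_mx (x ep i r) *m v).

Lemma xclosure_Asubmod ep Z : is_Asubmod (xclosure ep Z).
Proof. by split; [exact: xclosure0|exact: xclosure_comb]. Qed.

Lemma xclosure_stab ep Z i r : stabilizes (xclosure ep Z) (x ep i r).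
Proof. by move=> v; apply: xclosure_act. Qed.

Lemma xclosure_sub ep Z Z' : is_Asubmod Z' -> (forall v, Z v -> Z' v) ->
  (forall i r, stabilizes Z' (x ep i r)) -> forall v, xclosure ep Z v -> Z' v.
Proof.
move=> ZA ZZ' sx v; elim=> [{}v /ZZ'//||a {}v w Aa _ Zv _ Zw|i r {}v _ Zv].
- exact: Asubmod0.
- exact: (Asubmod_comb ZA).
- exact: sx.
Qed.

(** Moving k_a past a letter only multiplies by a scalar. *)
Lemma xclosure_uk ep Z a : stabilizes Z (uk qp a) -> stabilizes (xclosure ep Z) (uk qp a).
Proof.
move=> Zk v; elim=> [{}v Zv||b {}v w Ab _ Zv _ Zw|i r {}v Zx Zv].
- exact/xclosure_base/Zk.
- by rewrite mulmx0; apply: xclosure0.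
- by rewrite mulmxDr -scalemxAr; apply: xclosure_comb.
- rewrite mulmxA -act_mxM uk_ux act_mxZ act_mxM -scalemxAl -mulmxA.
  apply: (AsubmodZ (xclosure_Asubmod _ _)); first exact: in_A_poly.
  exact: xclosure_act.
Qed.

(** Moving h_(i,m) past a letter adds a term where this letter has another
    index. *)
Lemma xclosure_uh ep Z i m : stabilizes Z (uh h qp i m) -> stabilizes (xclosure ep Z) (uh h qp i m).
Proof.
move=> Zk v; elim=> [{}v Zv||b {}v w Ab _ Zv _ Zw|j r {}v Zx Zv].
- exact/xclosure_base/Zk.
- by rewrite mulmx0; apply: xclosure0.
- by rewrite mulmxDr -scalemxAr; apply: xclosure_comb.
- rewrite mulmxA -act_mxM uh_ux act_mxD act_mxZ act_mxM mulmxDl -mulmxA.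
  apply: (AsubmodD (xclosure_Asubmod _ _)); first exact: xclosure_act.
  rewrite -scalemxAl; apply: (AsubmodZ (xclosure_Asubmod _ _)); first exact: in_A_poly.
  exact: xclosure_act.
Qed.

Definition std_vector (v : X) : Prop := exists j, v = delta_mx j 0.
Definition std_lattice : X -> Prop := aspan std_vector.
Definition plus_lattice := xclosure true std_lattice.
(** U^- U^+ (V1 (x) V2) over A. The order of the factors is the one in which the
    commutation relations give stability under U. *)
Definition full_lattice := xclosure false plus_lattice.

(** V1 (x) V2 extended to A has the standard vectors as generators, so matrices
    with entries in A preserve it. *)
Lemma stabilizes_std_lattice a : (exists2 M, is_fusion_mx (c := c) (e := e) Delta (tens_in a 1) M &
    forall i j, in_A (M i j)) ->
  stabilizes std_lattice a.
Proof.
move=> [M aM AM] v; have -> : act_mx a = M by apply: fusion_mx_eq.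
apply: (@aspan_sub K X std_vector (fun v => std_lattice (M *m v))).
  split=> [|b u w Ab Zu Zw]; first by rewrite mulmx0; apply: aspan0.
  by rewrite mulmxDr -scalemxAr; apply: (Asubmod_comb (aspan_Asubmod _)).
move=> _ [j ->]; rewrite -colE [col _ _]matrix_sum_delta.
apply: Asubmod_sum => [|i _]; first exact: aspan_Asubmod.
rewrite big_ord1; apply: AsubmodZ; first exact: aspan_Asubmod.
  by rewrite mxE.
by apply: aspan_gen; exists i.
Qed.

Lemma std_lattice_uk a : stabilizes std_lattice (uk qp a).
Proof. exact/stabilizes_std_lattice/is_fusion_mx_k. Qed.

Lemma std_lattice_uh i m : stabilizes std_lattice (uh h qp i m).
Proof.
apply: subalgebra_h (stabilizes_subalgebra (aspan_Asubmod _)) _ _ i m.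
  exact: std_lattice_uk.
by move=> ep i m; apply/stabilizes_std_lattice/is_fusion_mx_phi.
Qed.

Lemma full_lattice_uk a : stabilizes full_lattice (uk qp a).
Proof. exact/xclosure_uk/xclosure_uk/std_lattice_uk. Qed.
Lemma full_lattice_uh i m : stabilizes full_lattice (uh h qp i m).
Proof. exact/xclosure_uh/xclosure_uh/std_lattice_uh. Qed.
Lemma full_lattice_phi ep i m : stabilizes full_lattice (phi ep i m).
Proof.
apply: subalgebra_phi; first exact/stabilizes_subalgebra/xclosure_Asubmod.
  exact: full_lattice_uk.
exact: full_lattice_uh.
Qed.

(** An x^+ moves past the letters x^- at the price of Cartan elements phi, which
    preserve the lattice, until it meets U^+ (V1 (x) V2). *)
Lemma full_lattice_xplus i r : stabilizes full_lattice (x true i r).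
Proof.
move=> v; elim=> [{}v Zv||b {}v w Ab _ Zv _ Zw|j s {}v Zv Zxv].
- by apply: xclosure_base; apply: xclosure_act.
- by rewrite mulmx0; apply: xclosure0.
- by rewrite mulmxDr -scalemxAr; apply: xclosure_comb.
- rewrite mulmxA -act_mxM ux_commute act_mxD act_mxM mulmxDl -mulmxA.
  apply: (AsubmodD (xclosure_Asubmod _ _)); first exact: xclosure_act.
  case: eqP => _; last by rewrite act_mx0 mul0mx; apply: xclosure0.
  rewrite act_mxZ -scalemxAl; apply: (AsubmodZ (xclosure_Asubmod _ _)); first exact: in_A_poly.
  have Lalg := stabilizes_subalgebra (xclosure_Asubmod false plus_lattice).
  rewrite -scaleN1r addrC; apply: (subalgebra_comb Lalg) => //; exact: full_lattice_phi.
Qed.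

Lemma full_lattice_stable a : stabilizes full_lattice a.
Proof.
apply: qaff_generated a; first exact/stabilizes_subalgebra/xclosure_Asubmod.
move=> [[] i r|a|i m].
- exact: full_lattice_xplus.
- exact: xclosure_stab.
- exact: full_lattice_uk.
- exact: full_lattice_uh.
Qed.

Lemma lattice_in_full m : m \in linspan (fun m0 => exists g w, in_Uu g /\
  m0 = fusion_act (V1 := V1) (V2 := V2) Delta g (tens_in w 1)) -> full_lattice (tc m).
Proof.
move=> /asboolP[l [a [s [sP ->]]]]; rewrite (tcoord_sumr ec).
apply: Asubmod_sum => [|i _]; first exact: xclosure_Asubmod.
rewrite (tcoord_scale ec); apply: AsubmodZ; [exact: xclosure_Asubmod|exact: in_A_poly|].
have [g [w [[l' [b [f [Af ->]]]] ->]]] := sP i.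
rewrite (tcoord_fusion_act rep1 rep2 ec hD).
have -> : fusion_mx rep1 rep2 ec hD (\sum_i0 tens_in (b i0) (f i0)) = \sum_i0 f i0 *: act_mx (b i0).
  elim: l' b f {Af} => [|l' IH] b f.
    by rewrite !big_ord0; apply: (addrI (fusion_mx rep1 rep2 ec hD 0)); rewrite -fusion_mxD !addr0.
  rewrite !big_ord_recl fusion_mxD IH; congr (_ + _).
  by rewrite /act_mx -fusion_mx_ratscale ratscale_in mulr1.
rewrite mulmx_suml; apply: Asubmod_sum => [|i' _]; first exact: xclosure_Asubmod.
rewrite -scalemxAl; apply: AsubmodZ; [exact: xclosure_Asubmod|exact: Af|].
apply: full_lattice_stable; do 2!apply: xclosure_base.
rewrite (tcoord_in ec) [\col__ _]matrix_sum_delta.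
apply: Asubmod_sum => [|j _]; first exact: aspan_Asubmod.
rewrite big_ord1 mxE ratscaleE mulr1; apply: AsubmodZ.
- exact: aspan_Asubmod.
- exact: in_A_poly.
- by apply: aspan_gen; exists j.
Qed.

Lemma acts_by0_opmx t i j : acts_by0 (V1 := V1) (V2 := V2) t ->
  opmx (e := e) (c := c) t i j = 0.
Proof. by move=> /(opmx_eq0 rep1 rep2 ec)->; rewrite mxE. Qed.

Local Notation opm := (opmx (e := e) (c := c)).
Let opL := opmx_entry_linear rep1 rep2 ec.

(** Delta_u(x_r) is a sum of two terms al and be. Each satisfies in r its own
    recurrence, twisted by powers of u; the product of the two twisted
    polynomials kills the sum. Its extreme coefficients are nonzero scalars
    times powers of u, thus units of A. *)
Lemma window_of_split ep i (al be : int -> int -> UU) (k1 : int -> int) (p1 p2 : {poly K}) e1 e2 :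
  (forall r k, Delta (tens_in (x ep i r) 1) k = al r k + be r k) ->
  (forall r k, k != k1 r -> al r k = 0) -> p1`_0 != 0 -> p2`_0 != 0 ->
  (forall r k, acts_by0 (V1 := V1) (V2 := V2)
    (\sum_(t < size p1) p1`_t *: al (r - t%:Z) (k - (e1 * t)%:Z))) ->
  (forall r k, acts_by0 (V1 := V1) (V2 := V2)
    (\sum_(t < size p2) p2`_t *: be (r - t%:Z) (k - (e2 * t)%:Z))) ->
  exists D : nat, forall Z : 'M[F]_d -> Prop, is_Asubmod Z ->
    (forall r : nat, (r <= D)%N -> Z (act_mx (x ep i r%:Z))) -> forall r, Z (act_mx (x ep i r)).
Proof.
move=> DE al0 p10 p20 alp bep.
pose Y r := act_mx (x ep i r).
have YE r j l : is_expansion (Y r j l) (fun k => opm (Delta (tens_in (x ep i r) 1) k) j l).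
  exact: fusion_mxP.
have exA (rjl : int * ('I_d * 'I_d)) : exists f,
    is_expansion f (fun k => opm (al rjl.1 k) rjl.2.1 rjl.2.2).
  case: rjl => r [j l] /=.
  have [|k kk|f fa _] := @is_expansion_laurentpoly _ (fun k => opm (al r k) j l) (k1 r).
  - by exists (k1 r) => k kk; rewrite al0 ?lt_eqF // (lin0 (opL j l)).
  - by rewrite al0 ?gt_eqF // (lin0 (opL j l)).
  - by exists f.
have [fA fAE] := choice exA.
pose A r : 'M[F]_d := \matrix_(j, l) fA (r, (j, l)).
pose B r : 'M[F]_d := Y r - A r.
have AE r j l : is_expansion (A r j l) (fun k => opm (al r k) j l).
  by rewrite mxE; exact: (fAE (r, (j, l))).
have BE r j l : is_expansion (B r j l) (fun k => opm (be r k) j l).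
  have := is_expansion_comb (-1) (AE r j l) (YE r j l); congr is_expansion.
    by rewrite scaleN1r addrC [RHS]mxE [in RHS]mxE.
  apply/funext=> k; rewrite DE (linD (opL j l)) mulN1r.
  by rewrite addrA addNr add0r.
have twA k : shift_act (twist p1 e1) A k = 0.
  apply/matrixP=> j l; rewrite [RHS]mxE.
  have := @twist_kills _ p1 e1 (fun r => A r j l) _ (fun r => AE r j l).
  move=> H; rewrite -[RHS](H _ k); first by rewrite /shift_act summxE; apply: eq_bigr => t _; rewrite mxE.
  move=> r k'; rewrite -[RHS](acts_by0_opmx j l (alp r k')) (lin_comb (opL j l)).
  by apply: eq_bigr.
have twB k : shift_act (twist p2 e2) B k = 0.
  apply/matrixP=> j l; rewrite [RHS]mxE.
  have := @twist_kills _ p2 e2 (fun r => B r j l) _ (fun r => BE r j l).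
  move=> H; rewrite -[RHS](H _ k); first by rewrite /shift_act summxE; apply: eq_bigr => t _; rewrite mxE.
  move=> r k'; rewrite -[RHS](acts_by0_opmx j l (bep r k')) (lin_comb (opL j l)).
  by apply: eq_bigr.
(* The annihilators of the two parts commute, so their product kills the sum. *)
pose Q := twist p1 e1 * twist p2 e2.
have QY k : shift_act Q Y k = 0.
  transitivity (shift_act Q (fun r => 1 *: A r + B r) k).
    by apply: eq_shift_act => r; rewrite scale1r addrC subrK.
  rewrite shift_act_combr scale1r {1}/Q mulrC !shift_actM.
  by rewrite (eq_shift_act _ twA) (eq_shift_act _ twB) !shift_act_seq0 addr0.
have pne (p : {poly K}) : p`_0 != 0 -> p != 0 by apply: contraNneq => ->; rewrite coef0.
have tw0 (p : {poly K}) ee : (twist p ee)`_0 = ratpoly (p`_0)%:P.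
  by rewrite coef_twist muln0 expr0 -mul_polyC mulr1.
exists (size Q) => Z ZA ZY.
apply: (@recurrence_window F 'M[F]_d (@in_A K) Z _ _ _ (Asubmod0 ZA) (Asubmod_comb ZA) Q Y) => //.
- exact: in_A_comb.
- exact: in_A0.
- by rewrite -ratpoly1 -tofracN; apply: in_A_poly.
- move=> t; rewrite coefM; apply: in_A_sum => t'; rewrite !coef_twist.
  by apply: in_AM; apply: in_A_poly.
- by rewrite coef0M !tw0 mulf_neq0 // ratpoly_eq0 polyC_eq0.
- rewrite coef0M !tw0 -ratpolyM; apply: in_A_polyV.
  by rewrite hornerM !hornerC mulf_neq0.
- rewrite lead_coefM !lead_coef_twist -ratpolyM; apply: in_A_polyV.
  by rewrite hornerM !hornerZ !hornerXn !expr1n !mulr1 mulf_neq0 ?lead_coef_eq0 ?pne.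
Qed.

(** Over A, the infinitely many operators x_(i,r) on the fusion module are
    combinations of finitely many of them, even though they may have poles at u
    = 1. *)
Lemma window_x ep i : exists D : nat, forall Z : 'M[F]_d -> Prop, is_Asubmod Z ->
  (forall r : nat, (r <= D)%N -> Z (act_mx (x ep i r%:Z))) -> forall r, Z (act_mx (x ep i r)).
Proof.
have [pl pl0 recl] := recurrence_left rep1 rep2 ec ep i.
have [pr pr0 recr] := recurrence_right rep1 rep2 ec ep i.
have acts0 : acts_by0 (V1 := V1) (V2 := V2) 0 by move=> w; apply: tens_act0.
case: ep recl recr => recl recr.
  apply: (@window_of_split true i (fun r k => mono 0 (tens_in (x true i r) 1) k)
    (fun r k => if r <= k then tens_in (phi false i (r - k)) (x true i k) else 0)
    (fun=> 0) pl pr 0 1) => //.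
  - by move=> r k; rewrite (Delta_xp hD).
  - by move=> r k k0; rewrite /mono (negPf k0).
  - move=> r k; under eq_bigr do rewrite mul0n subr0.
    rewrite /mono; case: (k =P 0) => _; first exact: (recl 1 r).
    by rewrite big1 // => t _; rewrite scaler0.
  - move=> r k; under eq_bigr do rewrite mul1n lerD2r opprB addrA subrK.
    case: (r <= k); first exact: (recr (phi false i (r - k)) k).
    by rewrite big1 // => t _; rewrite scaler0.
apply: (@window_of_split false i (fun r k => mono r (tens_in 1 (x false i r)) k)
    (fun r k => if 0 <= k then tens_in (x false i (r - k)) (phi true i k) else 0)
    id pr pl 1 0) => //.
- by move=> r k; rewrite (Delta_xm hD).
- by move=> r k k0; rewrite /mono (negPf k0).
- move=> r k; under eq_bigr do rewrite mul1n /mono (inj_eq (addIr _)).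
  case: (k =P r) => _; first exact: (recr 1 r).
  by rewrite big1 // => t _; rewrite scaler0.
- move=> r k; under eq_bigr do rewrite mul0n subr0 addrAC.
  case: (0 <= k); first exact: (recl (phi true i k) (r - k)).
  by rewrite big1 // => t _; rewrite scaler0.
Qed.

Definition has_weight (om : weight) (v : X) : Prop :=
  forall a, act_mx (uk qp a) *m v = ratpoly (qpow qp (om a))%:P *: v.

Variable wt : 'I_d -> weight.
Hypothesis wtE : forall i a,
  tens_act (tens_in (uk qp a) (uk qp a)) (e i) = qpow qp (wt i a) *: e i.

Lemma act_mx_uk (a : h) (j l : 'I_d) : act_mx (uk qp a) j l = ratpoly ((j == l)%:R * qpow qp (wt l a))%:P.
Proof.
pose M : 'M[F]_d := \matrix_(j, l) ratpoly ((j == l)%:R * qpow qp (wt l a))%:P.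
suff -> : act_mx (uk qp a) = M by rewrite mxE.
apply: fusion_mx_eq => {}j {}l; rewrite mxE (Delta_k hD).
have := is_expansion_poly (((j == l)%:R * qpow qp (wt l a))%:P : {poly K}).
congr is_expansion; apply/funext=> k; rewrite shift_actC /delta0 /mono.
case: (k =P 0) => _; last by rewrite scaler0 (lin0 (opL j l)).
rewrite mxE wtE (linZ (coordinates_linear ec j)) (coordinates_basis ec).
by rewrite /GRing.scale /= mulr1 mulrC.
Qed.

Lemma act_mx_uk_entry (a : h) (v : X) (j : 'I_d) :
  (act_mx (uk qp a) *m v) j 0 = ratpoly (qpow qp (wt j a))%:P * v j 0.
Proof.
rewrite mxE (bigD1 j) //= act_mx_uk eqxx mul1r big1 ?addr0 // => l lj.
by rewrite act_mx_uk eq_sym (negPf lj) mul0r polyC0 ratpoly0 mul0r.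
Qed.

Lemma weight_basis j : has_weight (wt j) (delta_mx j 0).
Proof.
move=> a; apply/colP=> l; rewrite act_mx_uk_entry !mxE; case: (l =P j) => [->//|_].
by rewrite !mulr0.
Qed.

(** In a basis of weight vectors the torus acts diagonally, and weights are
    determined by their characters. *)
Lemma weight_nonzero om v : has_weight om v -> v != 0 -> exists i, om = wt i.
Proof.
move=> vom v0; have [i vi] : exists i, v i 0 != 0.
  apply/existsP; apply: contraNT v0; rewrite negb_exists => /forallP H.
  by apply/eqP/colP=> i; rewrite mxE; apply/eqP; have := H i; rewrite negbK.
exists i; apply/lfunP=> a; have /colP/(_ i) := vom a; rewrite act_mx_uk_entry mxE.
by move/(mulIf vi)/ratpoly_inj/polyC_inj/qpow_inj.
Qed.

Lemma weight_x ep i r om v : has_weight om v ->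
  has_weight (om + (sg ep)%:~R *: Defs.root h i) (act_mx (x ep i r) *m v).
Proof.
move=> vom a; rewrite mulmxA -act_mxM uk_ux act_mxZ act_mxM -scalemxAl -mulmxA vom -scalemxAr scalerA.
by rewrite -ratpolyM -polyCM -qpowD lfunE /= lfunE /= addrC.
Qed.

(** x^+ raises heights by one, x^- lowers them by one, and a nonzero vector has
    one of finitely many weights, so long words in the x^+, or in the x^-,
    vanish. By window_x the letters may be taken in a finite set. Hence finitely
    many words generate over A a module stable under all the letters. *)
Lemma finite_generators ep (s : seq X) : (forall v, v \in s -> exists om, has_weight om v) ->
  exists G : seq X, [/\ forall v, v \in s -> v \in G,
    forall v, v \in G -> exists om, has_weight om v,
    forall Z : X -> Prop, (forall v, v \in s -> Z v) -> (forall i r, stabilizes Z (x ep i r)) ->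
      forall v, v \in G -> Z v
    & forall i r, stabilizes (aspan (fun v => v \in G)) (x ep i r)].
Proof.
move=> sw; have [D DP] := choice (window_x ep).
pose letters := [seq (i, r) | i <- enum 'I_n, r <- iota 0 (D i).+1].
pose step (t : seq X) : seq X := [seq act_mx (x ep p.1 p.2%:Z) *m v | p <- letters, v <- t].
have stepP (t : seq X) i (r : nat) v : v \in t -> (r <= D i)%N -> act_mx (x ep i r%:Z) *m v \in step t.
  move=> vt rD; apply/allpairsP; exists ((i, r), v); split=> //=.
  by apply/allpairsPdep; exists i, r; rewrite mem_enum mem_iota /= add0n ltnS.
have sht (t : seq X) : (forall v, v \in t -> exists om, has_weight om v) ->
    exists c0 : rat, forall v, v \in t ->
      exists om, has_weight om v /\ - c0 <= (sg ep)%:~R * height om.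
  elim: t => [|v t IH] tw; first by exists 0.
  have [|c0 c0P] := IH; first by move=> w wt'; apply: tw; rewrite inE wt' orbT.
  have [om vom] := tw v (mem_head _ _).
  exists (Num.max c0 (- ((sg ep)%:~R * height om))) => w; rewrite inE => /orP[/eqP->|wt'].
    by exists om; split=> //; rewrite lerNl le_max lexx orbT.
  have [om' [wom' c0om']] := c0P _ wt'; exists om'; split=> //.
  by apply: le_trans c0om'; rewrite lerN2 le_max lexx.
have [c0 c0P] := sht s sw.
have iterw l v : v \in iter l step s ->
    exists om, has_weight om v /\ l%:R - c0 <= (sg ep)%:~R * height om.
  elim: l v => [|l IH] v /=; first by rewrite sub0r; apply: c0P.
  move=> /allpairsP[[[i r] w] /= [_ /IH[om [wom lom]] ->]].
  exists (om + (sg ep)%:~R *: Defs.root h i); split; first exact: weight_x.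
  rewrite (linD (@height_linear _ _ h)) (linZ (@height_linear _ _ h)) height_root.
  rewrite /GRing.scale /= mulr1 mulrDr.
  have -> : (sg ep)%:~R * (sg ep)%:~R = 1 :> rat by case: (ep); rewrite ?mulr1 // mulrNN mulr1.
  by rewrite -natr1 addrAC lerD2r.
pose HB : rat := \sum_i `|height (wt i)|.
pose L := Num.bound `|c0 + HB|.
(* A word of length L would leave the range of heights of the basis vectors. *)
have big0 v : v \in iter L step s -> v = 0.
  move=> /iterw[om [vom Lom]]; apply/eqP; apply: contraT => v0.
  have [i omE] := weight_nonzero vom v0.
  have : (sg ep)%:~R * height om <= HB.
    apply: le_trans (ler_norm _) _; rewrite normrM.
    have -> : `|(sg ep)%:~R| = 1 :> rat by case: (ep); rewrite ?normrN normr1.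
    rewrite mul1r omE /HB (bigD1 i) //= lerDl; apply: sumr_ge0 => j _; exact: normr_ge0.
  move=> /(le_trans Lom); rewrite lerBlDl; apply: contraLR => _; rewrite -ltNge.
  by apply: le_lt_trans (ler_norm _) (archi_boundP _); apply: normr_ge0.
pose G := flatten [seq iter l step s | l <- iota 0 L.+1].
have inG v l : (l <= L)%N -> v \in iter l step s -> v \in G.
  move=> lL vl; apply/flatten_mapP; exists l => //.
  by rewrite mem_iota /= add0n ltnS.
have Gin v : v \in G -> exists2 l, (l <= L)%N & v \in iter l step s.
  by move=> /flatten_mapP[l]; rewrite mem_iota /= add0n ltnS; exists l.
exists G; split.
- by move=> v vs; apply: (inG v 0%N).
- by move=> v /Gin[l _ /iterw[om [vom _]]]; exists om.
- move=> Z Zs Zx v /Gin[l _]; elim: l v => [|l IH] v /=; first exact: Zs.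
  by move=> /allpairsP[[[i r] w] /= [_ /IH Zw ->]]; apply: Zx.
move=> i r; have GA := @aspan_Asubmod K X (fun v => v \in G).
apply: (DP i (fun M => forall v, aspan (fun v => v \in G) v -> aspan (fun v => v \in G) (M *m v))).
  split=> [v _|a M M' Aa MG M'G v Gv]; first by rewrite mul0mx; apply: aspan0.
  rewrite mulmxDl -scalemxAl; apply: (Asubmod_comb GA) => //; [exact: MG|exact: M'G].
move=> {}r rD; apply: aspan_sub.
  split=> [|a v w Aa Gv Gw]; first by rewrite mulmx0; apply: aspan0.
  by rewrite mulmxDr -scalemxAr; apply: (Asubmod_comb GA).
move=> v /Gin[l]; rewrite leq_eqVlt => /orP[/eqP-> /big0->|lL vl].
  by rewrite mulmx0; apply: aspan0.
by apply: aspan_gen; apply: (inG _ l.+1) => //; apply: stepP.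
Qed.

Local Notation inN m := (m \in linspan (fun m0 => exists g w, in_Uu g /\
  m0 = fusion_act (V1 := V1) (V2 := V2) Delta g (tens_in w 1))).
Local Notation untc := (untcoord (e := e)).

Lemma untcoord_op a v : untc (act_mx a *m v) = fusion_act Delta (tens_in a 1) (untc v).
Proof.
apply: (tcoord_inj ec).
by rewrite (tcoord_fusion_act rep1 rep2 ec hD) !(untcoordK ec).
Qed.

(** Finitely many x^+ words, then finitely many x^- words on the results,
    generate the full lattice, which contains N; these words are themselves in
    N. *)
Lemma lattice_generators : exists G : seq X, [/\ forall v, v \in G -> exists om, has_weight om v,
  forall v, v \in G -> inN (untc v) & forall m, inN m -> aspan (fun v => v \in G) (tc m)].
Proof.
pose s : seq X := [seq delta_mx j 0 | j <- enum 'I_d].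
have sw v : v \in s -> exists om, has_weight om v.
  by move=> /mapP[j _ ->]; exists (wt j); apply: weight_basis.
have sN v : v \in s -> inN (untc v).
  move=> /mapP[j _ ->]; have -> : untc (delta_mx j 0) = tens_in (e j) 1.
    apply: (tcoord_inj ec); rewrite (untcoordK ec) (tcoord_in ec).
    apply/colP=> i; rewrite !mxE andbT (coordinates_basis ec).
    by case: (i == j); rewrite ?scale1r ?scale0r.
  exact: (lattice_pure rep1 rep2 ec hD).
have Nx i r ep : stabilizes (fun v => inN (untc v)) (x ep i r).
  by move=> v vN; rewrite untcoord_op; apply: (lattice_act rep1 rep2 ec hD).
have [Gp [sGp Gpw Gpmin Gpx]] := @finite_generators true s sw.
have [G [GpG Gw Gmin Gx]] := @finite_generators false Gp Gpw.
have GA G' := @aspan_Asubmod K X (fun v => v \in (G' : seq X)).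
exists G; split=> //.
  by apply: (Gmin (fun v => inN (untc v))) => //; apply: (Gpmin (fun v => inN (untc v))).
move=> m /lattice_in_full; apply: xclosure_sub => // {m} v.
have Gp_G : forall v, aspan (fun v => v \in Gp) v -> aspan (fun v => v \in G) v.
  by apply: aspan_sub => // w wG; apply: aspan_gen; apply: GpG.
move=> vL; apply: Gp_G; move: v vL; apply: xclosure_sub => //.
apply: aspan_sub => // _ [j ->]; apply/aspan_gen/sGp/mapP; exists j => //.
by rewrite mem_enum.
Qed.

Local Notation dcl := (lattice_class (Delta := Delta) (V1 := V1) (V2 := V2)).

(** Modulo u - 1 the coefficients in A become scalars, so the classes of the
    generators of the lattice span the quotient. *)
Lemma otimes_d_spanned : exists s : seq (otimes_d Delta V1 V2),
  (forall y, y \in s -> exists om, weight_space om y) /\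
  forall y, y \in linspan (fun z => z \in s).
Proof.
have [G [Gw GN GG]] := lattice_generators.
exists [seq dcl (untc v) | v <- G]; split=> [_ /mapP[v vG ->]|y].
  have [om vom] := Gw _ vG; exists om => a /=.
  rewrite (otimes_d_act_class rep1 rep2 ec hD) ?GN //.
  rewrite -untcoord_op vom.
  have -> : untc (ratpoly (qpow qp (om a))%:P *: v) = qpow qp (om a) *: untc v.
    by apply: (tcoord_inj ec); rewrite (tcoord_scale ec) !(untcoordK ec).
  by rewrite lattice_classZ ?GN.
have [m mN ->] := lattice_class_surj y; rewrite -(tcoordK ec m).
pose Z v := inN (untc v) /\ dcl (untc v) \in linspan (fun z => z \in [seq dcl (untc v) | v <- G]).
suff [] : Z (tc m) by [].
apply: aspan_sub (GG _ mN) => [|v vG]; last first.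
  by split; [exact: GN|apply: mem_linspan; apply/mapP; exists v].
split=> [|a v w /[dup] Aa /in_A_residue[z [g [Ag aE]]] [vN vS] [wN wS]].
  rewrite /Z; have -> : untc 0 = 0 by apply: (tcoord_inj ec); rewrite (untcoordK ec) (tcoord0 ec).
  by split; [exact: rpred0|rewrite lattice_class0; exact: rpred0].
(* Replace the coefficient a by its residue z at u = 1 modulo (u - 1) N. *)
have E : untc (a *: v + w) = z *: untc v +
    (ratscale (ratu K - 1) (ratscale g (untc v)) + untc w).
  apply: (tcoord_inj ec); rewrite !(tcoordD ec) (tcoord_scale ec) !(tcoordZ ec) !(untcoordK ec).
  by rewrite aE scalerDl scalerA addrA.
have Au : in_A (ratu K - 1) by rewrite -ratpoly1 -ratpolyB; apply: in_A_poly.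
have gN : inN (ratscale g (untc v)) by apply: (lattice_ratscale rep1 rep2 ec hD).
have ugN : inN (ratscale (ratu K - 1) (ratscale g (untc v))).
  by apply: (lattice_ratscale rep1 rep2 ec hD).
rewrite /Z E; split; first by rewrite rpredD ?rpredZ ?rpredD.
have DE : dcl (ratscale (ratu K - 1) (ratscale g (untc v)) + untc w) = dcl (untc w).
  by apply: etrans (lattice_classD ugN wN) _; rewrite (lattice_class_kill rep1 rep2 ec hD gN) add0r.
rewrite lattice_class_comb //; last by rewrite rpredD.
rewrite DE.
by rewrite rpredD ?rpredZ.
Qed.
End Lattice.

(** * Modules spanned by finitely many weight vectors *)

Section WeightModules.
Context {K : fieldType} {n : nat} {C : cartan_datum n} {h : realization C}
  {qp : quantum_parameter K}.
Local Notation weight := 'Hom(h, rat^o).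
Implicit Types (V W : prerep h qp).

Lemma weight_space_comb V (om : weight) z u v : is_rep V ->
  weight_space (V := V) om u -> weight_space (V := V) om v -> weight_space (V := V) om (z *: u + v).
Proof.
move=> rV uw vw a; rewrite (rep_act_linear _ rV) uw vw scalerDr !scalerA.
by rewrite [z * _]mulrC.
Qed.

Lemma weight_space0 V (om : weight) : is_rep V -> weight_space (V := V) om 0.
Proof. by move=> rV a; rewrite (lin0 (rep_act_linear _ rV)) scaler0. Qed.

Lemma weight_space_sum V (om : weight) (I : Type) (s : seq I) (P : pred I) (v : I -> V) :
  is_rep V -> (forall i, P i -> weight_space (V := V) om (v i)) ->
  weight_space (V := V) om (\sum_(i <- s | P i) v i).
Proof.
move=> rV vw; elim/big_ind: _ => //; first exact: weight_space0.
by move=> u w uw ww; rewrite -[u]scale1r; apply: weight_space_comb.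
Qed.

(** Distinct weights give distinct characters of the torus, as qpow is
    injective; this is the independence of eigenvectors. *)
Lemma weight_spaces_independent V (s : seq weight) (f : weight -> V) : is_rep V -> uniq s ->
  (forall om, weight_space (V := V) om (f om)) -> \sum_(om <- s) f om = 0 ->
  forall om, om \in s -> f om = 0.
Proof.
move=> rV; elim: s f => [//|om0 s IH] f /= /andP[om0s us] fw f0.
have fs om : om \in s -> f om = 0.
  move=> oms; have [a oma] : exists a, om a != om0 a.
    apply/not_existsP => H; case/negP: om0s; suff <- : om = om0 by [].
    by apply/lfunP => a; apply/eqP; apply: contra_notT (H a).
  pose g (om : weight) := (qpow qp (om a) - qpow qp (om0 a)) *: f om.
  have : g om = 0.
    apply: IH oms => // [om'|].
      by rewrite /g -[_ *: _]addr0; apply: weight_space_comb => //; apply: weight_space0.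
    transitivity (rep_act (uk qp a) (\sum_(om' <- om0 :: s) f om') -
        qpow qp (om0 a) *: \sum_(om' <- om0 :: s) f om'); last first.
      by rewrite f0 (lin0 (rep_act_linear _ rV)) scaler0 subrr.
    rewrite (lin_sum (rep_act_linear _ rV)) scaler_sumr -sumrB big_cons fw subrr add0r.
    by apply: eq_bigr => om' _; rewrite fw /g scalerBl.
  move/eqP; rewrite scaler_eq0 subr_eq0 => /orP[/eqP/qpow_inj E|/eqP //].
  by rewrite E eqxx in oma.
move=> om; rewrite inE => /orP[/eqP->|/fs//].
by move: f0; rewrite big_cons big_seq big1 ?addr0 // => i /fs.
Qed.

(** Grouping the generators by weight gives the weight decomposition. All the
    weights of V are those of generators, hence finitely many, and heights tell
    om from om + r alpha_i and om - r alpha_i for large r. *)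
Lemma spanned_in_Modf V (s : seq V) : is_rep V ->
  (forall v, v \in s -> exists om, weight_space (V := V) om v) ->
  (forall v : V, v \in linspan (fun w => w \in s)) -> in_Modf V.
Proof.
move=> rV sw sV.
have /choice[wt wtP] v : exists om, v \in s -> weight_space (V := V) om v.
  case vs : (v \in s); last by exists 0.
  by have [om] := sw v vs; exists om.
pose las := [seq wt v | v <- s].
(* The component of weight om is written with the generators of weight om. *)
have decomp v : exists f : weight -> V,
  [/\ forall om, weight_space (V := V) om (f om),
      forall om, f om \in linspan (fun w => w \in [seq w <- s | wt w == om]),
      forall om, om \notin las -> f om = 0
    & forall S, uniq S -> {subset las <= S} -> v = \sum_(om <- S) f om].
  have /asboolP[l [a [t [ts ->]]]] := sV v.
  exists (fun om => \sum_(i < l | wt (t i) == om) a i *: t i); split.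
  - move=> om; apply: weight_space_sum => // i /eqP <-; rewrite -[_ *: _]addr0.
    apply: weight_space_comb => //; [exact/wtP/ts|exact: weight_space0].
  - move=> om; apply: rpred_sum => i wi; apply/rpredZ/mem_linspan.
    by rewrite mem_filter wi; exact: ts.
  - move=> om omS; rewrite big1 // => i /eqP wi; case/negP: omS.
    by rewrite -wi; apply/map_f/ts.
  - move=> S uS lS; under [RHS]eq_bigr do rewrite big_mkcond.
    rewrite exchange_big; apply: eq_bigr => i _.
    rewrite (bigD1_seq (wt (t i))) //=; last by apply/lS/map_f/ts.
    by rewrite eqxx big1 ?addr0 // => om; rewrite eq_sym => /negPf->.
(* A weight vector is its own component: compare it with its decomposition. *)
have component v om : weight_space (V := V) om v ->
    v \in linspan (fun w => w \in [seq w <- s | wt w == om]) /\ (v != 0 -> om \in las).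
  move=> vw; have [f [fw fs f0 fE]] := decomp v.
  pose S := undup (om :: las).
  have vE : v = f om.
    have SE := fE S (undup_uniq _) _.
    pose g (om' : weight) := if om' == om then f om - v else f om'.
    suff : g om = 0 by rewrite /g eqxx => /eqP; rewrite subr_eq0 => /eqP.
    apply: (@weight_spaces_independent V S) => //; first exact: undup_uniq.
    - move=> om'; rewrite /g; case: eqP => // ->.
      by rewrite addrC -scaleN1r; apply: weight_space_comb.
    - rewrite (bigD1_seq om) ?undup_uniq ?mem_undup ?mem_head //= {1}/g eqxx.
      rewrite (eq_bigr f) => [|om' /negPf]; last by rewrite /g => ->.
      rewrite addrAC -(bigD1_seq om) ?undup_uniq ?mem_undup ?mem_head //=.
      by rewrite -SE ?subrr // => x xl; rewrite mem_undup inE xl orbT.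
    - by rewrite mem_undup mem_head.
  split; first by rewrite vE.
  by apply: contraNT => /f0; rewrite vE => ->.
have findimV : findim (fun _ : V => True) by exists s.
split=> //; split=> //.
- split=> [v|S f uS fw f0 om]; last exact: (weight_spaces_independent rV uS fw f0).
  have [f [fw _ _ fE]] := decomp v.
  exists (undup las), f; split=> //; apply: fE; first exact: undup_uniq.
  by move=> om; rewrite mem_undup.
- move=> om; exists [seq w <- s | wt w == om]; split.
    by move=> v; rewrite mem_filter => /andP[/eqP <-]; apply: wtP.
  by move=> v /component[].
- exists las => om [v /component[_ H] v0]; exists om; first exact: H.
  by exists (fun=> 0%N); rewrite big1 ?subr0 // => i _; rewrite mulr0n.
- move=> om i.
  have [b bP] : exists b : rat, forall la, la \in las -> `|height la| <= b.
    elim: (las) => [|la S [b bP]]; first by exists 0.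
    exists (Num.max `|height la| b) => la'; rewrite inE le_max => /orP[/eqP->|/bP->].
      by rewrite lexx.
    by rewrite orbT.
  exists (Num.bound (`|height om| + `|b|)) => r br v.
  have rb : `|height om| + b < r%:R.
    apply: le_lt_trans (lt_le_trans (archi_boundP _) (_ : _ <= r%:R)); last by rewrite ler_nat; exact: br.
      by rewrite lerD2l ler_norm.
    by rewrite addr_ge0 ?normr_ge0.
  have htr : height (Defs.root h i *+ r) = r%:R.
    elim: (r) => [|r' IH]; first by rewrite mulr0n (lin0 (@height_linear _ _ h)).
    by rewrite mulrSr (linD (@height_linear _ _ h)) IH height_root natr1.
  have key (om' : weight) : r%:R <= `|height om' - height om| -> om' \notin las.
    move=> H; apply/negP => /bP oml; move: rb; rewrite ltNge => /negP; apply.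
    apply: le_trans H _; apply: le_trans (ler_normB _ _) _.
    by rewrite addrC lerD2l.
  move=> H; apply/eqP; apply: contraT => v0; case: H => /component[_ /(_ v0)].
    rewrite (negPf (key _ _)) // (linD (@height_linear _ _ h)) htr addrAC subrr add0r.
    exact: ler_norm.
  rewrite (negPf (key _ _)) // (linB (@height_linear _ _ h)) htr addrAC subrr sub0r normrN.
  exact: ler_norm.
Qed.

Lemma Modf_weight_spanned V : in_Modf V -> exists s : seq V,
  (forall v, v \in s -> exists om, weight_space (V := V) om v) /\
  (forall v : V, v \in linspan (fun w => w \in s)).
Proof.
case=> -[rV [dec _] _ _ _] [s [_ sV]].
suff [S [Sw sS]] : exists S : seq V, (forall v, v \in S -> exists om, weight_space (V := V) om v) /\
    forall v, v \in s -> v \in linspan (fun w => w \in S).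
  exists S; split=> // v; have := sV v I; exact: (@linspan_linear K V V _ _ id (@id_linear _ V) sS).
elim: s {sV} => [|v s [S [Sw sS]]]; first by exists [::].
have [W [f [fw vE]]] := dec v.
exists ([seq f om | om <- W] ++ S); split=> [w|w].
  by rewrite mem_cat => /orP[/mapP[om _ ->]|/Sw //]; exists om.
rewrite inE => /orP[/eqP->|/sS].
  rewrite vE big_seq; apply: rpred_sum => om omW; apply: mem_linspan.
  by rewrite mem_cat map_f.
apply: (@linspan_linear K V V _ _ id) => // w' w'S; apply: mem_linspan.
by rewrite mem_cat w'S orbT.
Qed.

(** The pure tensors of weight vectors span V1 (x) V2; a basis is extracted from
    them. *)
Lemma tensor_weight_basis V1 V2 : in_Modf V1 -> in_Modf V2 ->
  exists d (e : 'I_d -> tens V1 V2) c (wt : 'I_d -> weight), coordinates e c /\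
    forall i a, tens_act (tens_in (uk qp a) (uk qp a)) (e i) = qpow qp (wt i a) *: e i.
Proof.
move=> mV1 mV2; have rep1 : is_rep V1 by case: mV1 => -[].
have rep2 : is_rep V2 by case: mV2 => -[].
have [s1 [s1w s1V]] := Modf_weight_spanned mV1.
have [s2 [s2w s2V]] := Modf_weight_spanned mV2.
pose s := [seq tens_in v1 v2 | v1 <- s1, v2 <- s2].
pose P (w : tens V1 V2) := exists om : weight, forall a,
  tens_act (tens_in (uk qp a) (uk qp a)) w = qpow qp (om a) *: w.
have sP w : w \in s -> P w.
  move=> /allpairsP[[v1 v2] /= [/s1w[om1 w1] /s2w[om2 w2] ->]].
  exists (om1 + om2) => a; rewrite tens_act_pure // w1 w2 tens_inZl tens_inZr scalerA.
  by rewrite -qpowD lfunE.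
have sW w : w \in linspan (fun v => v \in s).
  rewrite [w]tens_sum; apply: rpred_sum => -[v1 v2] _ /=.
  have L1 v := (@tens_in_bilin _ V1 V2).1 v.
  have L2 v := (@tens_in_bilin _ V1 V2).2 v.
  apply: (linspan_linear (L1 v2) _ (s1V v1)) => u1 u1s.
  apply: (linspan_linear (L2 u1) _ (s2V v2)) => u2 u2s.
  by apply: mem_linspan; apply/allpairsP; exists (u1, u2).
have [d [e [c [ec eP]]]] := basis_exists sP sW.
by have [wt wtE] := choice eP; exists d, e, c, wt.
Qed.

Lemma otimes_d_in_Modf (Delta : qaff_u h qp -> int -> tens (qaff h qp) (qaff h qp)) V1 V2 :
  drinfeld_coproduct Delta -> in_Modf V1 -> in_Modf V2 -> in_Modf (otimes_d Delta V1 V2).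
Proof.
move=> hD mV1 mV2; have rep1 : is_rep V1 by case: mV1 => -[].
have rep2 : is_rep V2 by case: mV2 => -[].
have [d [e [c [wt [ec wtE]]]]] := tensor_weight_basis mV1 mV2.
have [s [sw sV]] := otimes_d_spanned rep1 rep2 ec hD wtE.
exact: spanned_in_Modf (otimes_d_rep rep1 rep2 ec hD) sw sV.
Qed.

End WeightModules.

(** * Morphisms and functoriality *)

Section Morphisms.
Context {K : fieldType} {n : nat} {C : cartan_datum n} {h : realization C}
  {qp : quantum_parameter K}.
Variable Delta : qaff_u h qp -> int -> tens (qaff h qp) (qaff h qp).
Hypothesis hD : drinfeld_coproduct Delta.
Variables V1 V2 W1 W2 : modf h qp.
Variables (f1 : V1 -> W1) (f2 : V2 -> W2).
Hypotheses (hom1 : is_rep_hom f1) (hom2 : is_rep_hom f2).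
Local Notation F := (ratfun K).

Let rV1 : is_rep V1. Proof. by case: (modfP V1) => -[]. Qed.
Let rV2 : is_rep V2. Proof. by case: (modfP V2) => -[]. Qed.
Let rW1 : is_rep W1. Proof. by case: (modfP W1) => -[]. Qed.
Let rW2 : is_rep W2. Proof. by case: (modfP W2) => -[]. Qed.
Let L1 : linear f1. Proof. by case: hom1. Qed.
Let L2 : linear f2. Proof. by case: hom2. Qed.
Let L12 : linear (tens_map f1 f2). Proof. exact: tens_map_linear. Qed.

Lemma fusion_map_linear : linear (fusion_map f1 f2).
Proof. exact: tens_map_linear. Qed.

Lemma fusion_map_in w (f : F) :
  fusion_map f1 f2 (tens_in w f) = tens_in (tens_map f1 f2 w) f.
Proof. exact: tens_map_in. Qed.

Lemma fusion_map_ratscale f m : fusion_map f1 f2 (ratscale f m) = ratscale f (fusion_map f1 f2 m).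
Proof.
move: m; apply: (tens_linear_ext (f := fun m => fusion_map f1 f2 (ratscale f m))
  (g := fun m => ratscale f (fusion_map f1 f2 m))).
- by apply: comp_linear; [exact: fusion_map_linear|exact: ratscale_linear].
- by apply: comp_linear; [exact: ratscale_linear|exact: fusion_map_linear].
- by move=> w g; rewrite ratscale_in !fusion_map_in ratscale_in.
Qed.

Lemma tens_map_act t w : tens_map f1 f2 (tens_act t w) = tens_act t (tens_map f1 f2 w).
Proof.
move: t; apply: (tens_linear_ext (f := fun t => tens_map f1 f2 (tens_act t w))
  (g := fun t => tens_act t (tens_map f1 f2 w))).
- by apply: comp_linear; [exact: L12|exact: tens_act_linearl].
- exact: tens_act_linearl.
move=> a b; move: w; apply: (tens_linear_ext (f := fun w => tens_map f1 f2 (tens_act (tens_in a b) w))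
  (g := fun w => tens_act (tens_in a b) (tens_map f1 f2 w))).
- by apply: comp_linear; [exact: L12|exact: tens_act_linear].
- by apply: comp_linear; [exact: tens_act_linear|exact: L12].
- move=> v1 v2; rewrite tens_act_pure // !tens_map_in // tens_act_pure //.
  by case: hom1 => _ ->; case: hom2 => _ ->.
Qed.

Lemma fusion_map_expansion (m : fusion_space V1 V2) L : is_tens_expansion m L ->
  is_tens_expansion (fusion_map f1 f2 m) (tens_map f1 f2 \o L).
Proof.
move=> [l [w [f [a [fa -> LE]]]]]; exists l, (fun i => tens_map f1 f2 (w i)), f, a.
split=> // [|k]; last by rewrite /= LE (lin_comb L12).
by rewrite (lin_sum fusion_map_linear); apply: eq_bigr => i _; rewrite fusion_map_in.
Qed.

(** f1 (x) f2 intertwines the coefficients of Delta_u(g), hence the series, and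
    the fusion action is determined by the series. *)
Lemma fusion_map_act g m :
  fusion_map f1 f2 (fusion_act Delta g m) = fusion_act Delta g (fusion_map f1 f2 m).
Proof.
have [d [e [c [wt [ec _]]]]] := tensor_weight_basis (modfP V1) (modfP V2).
have [d' [e' [c' [wt' [ec' _]]]]] := tensor_weight_basis (modfP W1) (modfP W2).
apply/esym/(fusion_rel_eq rW1 rW2 ec' hD).
have [L mL gmL] := fusion_rel_act rV1 rV2 ec hD g m.
exists (tens_map f1 f2 \o L); first exact: fusion_map_expansion.
have := fusion_map_expansion gmL; congr is_tens_expansion; apply/funext=> k /=.
apply: conv_map.
- exact: tens_act0.
- exact: tens_act0r.
- exact: tens_act0.
- exact: tens_act0r.
- exact: tens_map_act.
- exact: (lin0 L12).
- exact: (lin0 L12).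
- exact: (linD L12).
- exact: Delta_laurent.
- exact: (tens_expansion_laurent ec mL).
Qed.

Local Notation inN V1 V2 m := (m \in linspan (fun m0 : fusion_space V1 V2 =>
  exists g w, in_Uu g /\ m0 = fusion_act Delta g (tens_in w 1))).

Lemma fusion_map_lattice m : inN V1 V2 m -> inN W1 W2 (fusion_map f1 f2 m).
Proof.
apply: linspan_linear => [|_ [g [w [gU ->]]]]; first exact: fusion_map_linear.
apply: mem_linspan; exists g, (tens_map f1 f2 w); split=> //.
by rewrite fusion_map_act fusion_map_in.
Qed.

(** The extension of f1 (x) f2 is linear over K(u), so it maps (u - 1) N to (u -
    1) N and descends to the quotients. *)
Lemma otimes_d_map_class m : inN V1 V2 m ->
  otimes_d_map f1 f2 (lattice_class (Delta := Delta) m) = lattice_class (Delta := Delta) (fusion_map f1 f2 m).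
Proof.
have [d' [e' [c' [wt' [ec' _]]]]] := tensor_weight_basis (modfP W1) (modfP W2).
move=> mN; rewrite /otimes_d_map; set m' := lattice_val _.
have m'N : inN V1 V2 m' by exact: lattice_valP.
have : lattice_class m' = lattice_class (Delta := Delta) m.
  rewrite -[RHS](qreprK (lattice_class m)); congr (qclass _ _); apply: lattice_val_inj.
  by rewrite to_latticeK.
move=> /(lattice_class_eq m'N mN)[m0 m0N m0E].
have -> : m' = 1 *: ratscale (ratu K - 1) m0 + m by rewrite scale1r -m0E subrK.
rewrite -[LHS]/(lattice_class (Delta := Delta) _) fusion_map_linear fusion_map_ratscale lattice_class_comb.
- by rewrite (lattice_class_kill rW1 rW2 ec' hD) ?fusion_map_lattice // scaler0 add0r.
- apply: (lattice_ratscale rW1 rW2 ec' hD); last exact: fusion_map_lattice.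
  by rewrite -ratpoly1 -ratpolyB; exact: in_A_poly.
- exact: fusion_map_lattice.
Qed.

Lemma lattice_class_lattice_val (m : lattice Delta V1 V2) : lattice_class (lattice_val m) = otimes_d_class m.
Proof.
congr (qclass _ _); apply: lattice_val_inj; rewrite to_latticeK //.
exact: lattice_valP.
Qed.

Lemma otimes_d_map_wfP : otimes_d_map_wf Delta f1 f2.
Proof.
split=> m; first by apply/to_latticeK/fusion_map_lattice/lattice_valP.
by rewrite -lattice_class_lattice_val otimes_d_map_class //; exact: lattice_valP.
Qed.

Lemma otimes_d_map_hom : is_rep_hom (V := otimes_d Delta V1 V2) (W := otimes_d Delta W1 W2)
  (otimes_d_map f1 f2).
Proof.
have [d [e [c [wt [ec _]]]]] := tensor_weight_basis (modfP V1) (modfP V2).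
have [d' [e' [c' [wt' [ec' _]]]]] := tensor_weight_basis (modfP W1) (modfP W2).
have N1 m := @fusion_map_lattice m.
split=> [z u v|a y].
  have [m mN ->] := lattice_class_surj u; have [m' mN' ->] := lattice_class_surj v.
  rewrite -lattice_class_comb // !otimes_d_map_class ?rpredD ?rpredZ //.
  by rewrite -lattice_class_comb ?N1 // fusion_map_linear.
have [m mN ->] := lattice_class_surj y.
rewrite /= (otimes_d_act_class rV1 rV2 ec hD) // !otimes_d_map_class //.
  by rewrite (otimes_d_act_class rW1 rW2 ec' hD) ?N1 // fusion_map_act.
exact: (lattice_act rV1 rV2 ec hD).
Qed.
End Morphisms.

Lemma otimes_d_is_bifunctor (K : fieldType) (n : nat) (C : cartan_datum n)
  (h : realization C) (qp : quantum_parameter K)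
  (Delta : qaff_u h qp -> int -> tens (qaff h qp) (qaff h qp)) :
  drinfeld_coproduct Delta -> otimes_d_bifunctor Delta.
Proof.
move=> hD; exists (fun V1 V2 => otimes_d_in_Modf hD (modfP V1) (modfP V2)).
exists (fun V1 V2 W1 W2 f1 f2 => otimes_d_map_hom hD (rep_homP f1) (rep_homP f2)).
split.
- move=> V1 V2; have [d [e [c [wt [ec _]]]]] := tensor_weight_basis (modfP V1) (modfP V2).
  apply: (otimes_d_wfP _ _ ec hD); [by case: (modfP V1) => -[]|by case: (modfP V2) => -[]].
- by move=> *; apply: (otimes_d_map_wfP hD); apply: rep_homP.
split=> [[V1 V2]|[V1 V2] [W1 W2] [X1 X2] [f1 f2] [g1 g2]].
  apply: rep_hom_eq => y /=; have [m mN ->] := lattice_class_surj y.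
  rewrite (otimes_d_map_class hD) //; try exact: rep_id_hom.
  congr lattice_class; rewrite /fusion_map -[RHS](tens_map_id m); congr (tens_map _ id m).
  by apply/funext => w; rewrite tens_map_id.
apply: rep_hom_eq => y /=; have [m mN ->] := lattice_class_surj y.
have [F1 _] := rep_homP f1; have [F2 _] := rep_homP f2.
have [G1 _] := rep_homP g1; have [G2 _] := rep_homP g2.
have gN := fusion_map_lattice hD (rep_homP g1) (rep_homP g2) mN.
rewrite (otimes_d_map_class hD (rep_comp_hom f1 g1) (rep_comp_hom f2 g2) mN).
rewrite (otimes_d_map_class hD (rep_homP g1) (rep_homP g2) mN).
rewrite (otimes_d_map_class hD (rep_homP f1) (rep_homP f2) gN).
congr lattice_class; rewrite /fusion_map.
rewrite -[RHS](tens_map_comp (tens_map_linear G1 G2) (@id_linear _ _)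
  (tens_map_linear F1 F2) (@id_linear _ _) m); congr (tens_map _ _ m).
by apply/funext => w; rewrite -tens_map_comp.
Qed.

Theorem theorem4p13 (R : realType) (n : nat) (C : cartan_datum n)
  (h : realization C) (qp : quantum_parameter R[i])
  (Delta : qaff_u h qp -> int -> tens (qaff h qp) (qaff h qp)) :
  drinfeld_coproduct Delta -> otimes_d_bifunctor Delta.
Proof. exact: otimes_d_is_bifunctor. Qed.
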